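(* Let $X$ be a spectrally-negative Lévy process and let $T\sim\mathrm{PH}(\boldsymbol\alpha,\mathbf T)$ be the life time of a transient Markov chain $J$ independent of $X$, with initial distribution $\boldsymbol\alpha$ and sub-intensity matrix $\mathbf T$. Then the (sub-)intensity matrix $\mathbf G$ of the Markov chain $(J_{\tau_x^+})_{x\ge0}$ is given by $\mathbf G=-\Phi(-\mathbf T)$.
   Context: Lévy process: $X=(X_t)_{t\ge0}$ with $X_0=0$ is a real Lévy process with no positive jumps whose paths are not a.s. non-increasing. Its Laplace exponent $\psi$ is given by $\mathbb E e^{\theta X_t}=e^{\psi(\theta)t}$, $\theta\ge0$. First passage times: $\tau_x^+=\inf\{t\ge0:X_t>x\}$. The function $\Phi$: for $q>0$, $\Phi(q)$ is the unique positive solution of $\psi(\theta)=q$; equivalently $\mathbb E e^{-q\tau_x^+}=e^{-\Phi(q)x}$ for $x\ge0$ (with $e^{-q\cdot\infty}=0$). It has the representation $\Phi(q)=\overline q+\overline d q-\int_0^\infty(e^{-qx}-1)\overline\nu(\mathrm dx)$ with $\overline q,\overline d\ge0$ and a measure $\overline\nu$ on $(0,\infty)$ with $\int_0^\infty(1\wedge x)\overline\nu(\mathrm dx)<\infty$, and correspondingly $\Phi(-\mathbf T)=\overline q\mathbf I-\overline d\mathbf T-\int_0^\infty(e^{\mathbf Tx}-\mathbf I)\overline\nu(\mathrm dx)$ (all eigenvalues of $-\mathbf T$ have positive real part). Phase-type distribution: $(J_t)_{t\ge0}$ is a continuous-time Markov chain on $\{1,\dots,p\}$ with initial distribution $\boldsymbol\alpha$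 and transient sub-intensity matrix $\mathbf T$ (killed at rate $-\mathbf T\mathbf 1$, where $\mathbf 1$ is the vector of ones); $T$ is its life time. The process $(J_{\tau_x^+})_{x\ge0}$ is the chain $J$ observed at first passage times of $X$, considered as killed once $\tau_x^+\ge T$ (in particular if $\tau_x^+=\infty$). Thus $\mathbb P(J_{\tau_x^+}=j,\tau_x^+<T\mid J_0=i)=(e^{\mathbf Gx})_{ij}$ for $x\ge0$. *)

(* Defs.v *)
From mathcomp Require Export all_boot all_order all_algebra.
From mathcomp Require Export all_classical all_reals all_analysis.
Export Order.TTheory GRing.Theory Num.Theory.
Export numFieldNormedType.Exports.

Set Implicit Arguments.
Unset Strict Implicit.
Unset Printing Implicit Defensive.

Global Open Scope classical_set_scope.
Global Open Scope ring_scope.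

(* Time and space parameters range over the
   nonnegative elements of R; the values of a process at negative parameters
   are junk and are never constrained. *)

Section MatrixFunctions.
Context {R : realType} {p : nat}.
Implicit Types A : 'M[R]_p.

Definition expmx A : 'M[R]_p :=
  \matrix_(i, j) limn (series (fun k => (A ^+ k) i j / k`!%:R)).

Definition sub_intensity A : Prop :=
  (forall i j, i != j -> 0 <= A i j) /\ (forall i, \sum_j A i j <= 0).

(* The row sum is the probability, starting from i, of not being killed by
   time t: killing is almost sure from every state. *)
Definition transient A : Prop :=
  forall i, (\sum_j expmx (t *: A) i j) @[t --> +oo] --> (0 : R).

End MatrixFunctions.

Section BernsteinFunctions.
Context {R : realType}.
Variables (qbar dbar : R) (nu : {measure set (measurableTypeR R) -> \bar R}).

(* nu stands for a measure on (0, +oo): it is only ever used there. *)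
Definition bernstein_triplet : Prop :=
  [/\ 0 <= qbar, 0 <= dbar &
      (\int[nu]_(x in `]0%R, +oo[) (Num.min 1 x)%:E < +oo)%E].

Definition bernstein (q : R) : R :=
  qbar + dbar * q - \int[nu]_(x in `]0, +oo[) (expR (- q * x) - 1).

Definition bernstein_mx (p : nat) (A : 'M[R]_p) : 'M[R]_p :=
  qbar%:M + dbar *: A
  - \matrix_(i, j)
      \int[nu]_(x in `]0, +oo[) ((expmx (x *: - A) - 1%:M) i j).

End BernsteinFunctions.

Section Levy.
Context {R : realType} {d : measure_display} {Omega : measurableType d}.
Variable P : probability Omega R.
Implicit Types X : R -> Omega -> R.

Definition cadlag (f : R -> R) : Prop :=
  (forall t : R, 0 <= t -> f s @[s --> t^'+] --> f t) /\
  (forall t : R, 0 < t -> cvg (f s @[s --> t^'-])).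

Definition independent_increments X : Prop :=
  forall (n : nat) (t : nat -> R) (B : nat -> set R),
    0 <= t 0%N -> (forall k, t k <= t k.+1) -> (forall k, measurable (B k)) ->
    P (\bigcap_(k in `I_n) [set w | B k (X (t k.+1) w - X (t k) w)]) =
    (\prod_(k < n) P [set w | B k (X (t k.+1) w - X (t k) w)%R])%E.

Definition stationary_increments X : Prop :=
  forall (s t : R) (B : set R), 0 <= s -> 0 <= t -> measurable B ->
    P [set w | B (X (s + t) w - X s w)] = P [set w | B (X t w)].

Definition levy_process X : Prop :=
  [/\ forall t : R, 0 <= t -> measurable_fun setT (X t),
      forall w, X 0 w = 0,
      independent_increments X,
      stationary_increments X &
      forall w, cadlag (fun t => X t w)].

Definition no_positive_jumps X : Prop :=
  forall w (t : R), 0 < t -> X t w <= lim (X s w @[s --> t^'-]).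

Definition as_nonincreasing X : Prop :=
  {ae P, forall w, forall s t : R, 0 <= s -> s <= t -> X t w <= X s w}.

Definition spectrally_negative X : Prop :=
  [/\ levy_process X, no_positive_jumps X & ~ as_nonincreasing X].

Definition laplace_exponent X (psi : R -> R) : Prop :=
  forall theta t : R, 0 <= theta -> 0 <= t ->
    'E_P[fun w => expR (theta * X t w)]%E = (expR (psi theta * t))%:E.

Definition unique_positive_root (psi Phi : R -> R) : Prop :=
  forall q : R, 0 < q ->
    [/\ 0 < Phi q, psi (Phi q) = q &
        forall theta : R, 0 < theta -> psi theta = q -> theta = Phi q].

(* Equal to +oo when the level x is never exceeded. *)
Definition first_passage X (x : R) (w : Omega) : \bar R :=
  ereal_inf [set t%:E | t in [set t : R | 0 <= t /\ x < X t w]].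

End Levy.

Section KilledChains.
Context {R : realType} {d : measure_display} {Omega : measurableType d}.
Variables (P : probability Omega R) (p : nat).
Implicit Types (J : R -> Omega -> option 'I_p) (X : R -> Omega -> R).

Definition initial_distribution (alpha : 'rV[R]_p) : Prop :=
  (forall i, 0 <= alpha 0 i) /\ \sum_i alpha 0 i = 1.

(* A killed continuous-time Markov chain; None is the cemetery, and the
   Markov property is expressed by the finite-dimensional distributions. *)
Definition markov_chain (alpha : 'rV[R]_p) (A : 'M[R]_p) J : Prop :=
  [/\ initial_distribution alpha /\ sub_intensity A,
      forall (t : R) i, 0 <= t -> measurable [set w | J t w = Some i],
      forall w (s t : R), 0 <= s -> s <= t -> J s w = None -> J t w = None,
      forall w (t : R), 0 <= t -> \forall s \near t^'+, J s w = J t w &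
      forall (n : nat) (t : nat -> R) (i : nat -> 'I_p),
        t 0%N = 0 -> (forall k, t k <= t k.+1) ->
        P (\bigcap_(k in `I_n.+1) [set w | J (t k) w = Some (i k)]) =
        (alpha 0 (i 0%N) *
         \prod_(k < n) expmx ((t k.+1 - t k) *: A) (i k) (i k.+1))%:E].

Definition life_time J (w : Omega) : \bar R :=
  ereal_inf [set t%:E | t in [set t : R | 0 <= t /\ J t w = None]].

(* x |-> J_{tau_x^+}, killed once tau_x^+ >= life time. *)
Definition chain_at_passage X J (x : R) (w : Omega) : option 'I_p :=
  if (first_passage X x w < life_time J w)%E
  then J (fine (first_passage X x w)) w else None.

Definition process_sigma (E : Type) (G : set (set E)) (Y : R -> Omega -> E) :
    set (set Omega) :=
  <<s [set Y t @^-1` B | t in [set t : R | 0 <= t] & B in G] >>.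

Definition independent_processes X J : Prop :=
  forall A B, process_sigma measurable X A -> process_sigma setT J B ->
    P (A `&` B) = (P A * P B)%E.

Definition cond_prob (A B : set Omega) : R :=
  fine (P (A `&` B)) / fine (P B).

End KilledChains.

(* Main.v *)
(* Fix levels x_0 <= ... <= x_n and rates q_m > 0. The exponential martingale of X
   whose tilt is Phi(q_m) between the passages over x_(m-1) and x_m, stopped at the
   last passage, is bounded; as X has no positive jumps it sits exactly at a level
   when it passes it. Optional stopping therefore gives the joint Laplace transform
   of the successive gaps of x |-> tau_x^+, a product of exp(-(x_m - x_(m-1)) Phi(q_m)).
   Uniformization turns each of these scalar identities into an identity of power
   series, into which -T may be substituted for q_m, one gap at a time. As X and J
   are independent, the finite-dimensional laws of J at passage times are expectations
   of products of matrices exp(T gap), so they become products of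
   exp(-(x_m - x_(m-1)) Phi(-T)). Optional stopping and independence are both obtained
   by approximating passage times from a discrete time grid. *)
From HB Require Import structures.
Require Import Defs.
From mathcomp Require Import ring lra measurable_realfun.
Set Implicit Arguments.
Unset Strict Implicit.
Unset Printing Implicit Defensive.

(** * Power series of matrices *)

(** The Laplace identity E exp(-q D) = exp(-y Phi(q)) is available for real q > 0 only, while -T may
    have complex eigenvalues and need not be diagonalizable. Uniformization avoids complex analysis:
    with T = r (S - 1) and S substochastic, q = r (1 - z) puts a real z of (0, 1) in the place of S,
    and all functions involved are power series in z with summable coefficients. Real z determine
    these coefficients, and since the powers of S have entries in [0, 1], the same series can be
    summed at S. The strong Markov property is invoked neither for X nor for J. The tilt of the
    exponential martingale is a function of the running maximum, hence known before the next
    increment, and a single martingale treats all gaps together; paths that never pass the last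
    level contribute 0 because psi(Phi(q)) = q > 0. For J, the finite-dimensional laws at
    deterministic grid times suffice: grid hits approach the passage times from the right, where X
    is right continuous and J locally constant. *)

Section Series.
Context {R : realType}.
Implicit Types u v g d : nat -> R.

Lemma cvg_series_dominated u g :
  cvgn (series g) -> (forall n, `|u n| <= g n) -> cvgn (series u).
Proof.
move=> cg ug; apply: normed_cvg; apply: series_le_cvg cg => // n.
- exact: normr_ge0.
- exact: le_trans (normr_ge0 _) (ug n).
Qed.

Lemma series_ge0 u N : (forall n, 0 <= u n) -> 0 <= series u N.
Proof. by move=> u0; apply: sumr_ge0. Qed.

Lemma series_le_lim u N :
  (forall n, 0 <= u n) -> cvgn (series u) -> series u N <= limn (series u).
Proof.
by move=> u0 cu; apply: nondecreasing_cvgn_le => //; apply: nondecreasing_series.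
Qed.

Lemma cvgn_series_le u M : (forall n, 0 <= u n) -> (forall N, series u N <= M) ->
  cvgn (series u).
Proof.
move=> u0 uM; apply: nondecreasing_is_cvgn; first exact: nondecreasing_series.
by exists M => _ [N _ <-]; exact: uM.
Qed.

(** Tannery's theorem, dominated convergence for series, in a form suited to truncations: the number
    of terms [L N] is any function above [N], such as the size of a polynomial. Beyond a fixed [M]
    the two tails cost at most e / 4 each; the first [M] terms converge one by one. *)
Lemma tannery (u : nat -> nat -> R) v g (L : nat -> nat) :
  cvgn (series g) -> (forall N n, `|u N n| <= g n) ->
  (forall n, u N n @[N --> \oo] --> v n) -> (forall N, (N <= L N)%N) ->
  series (u N) (L N) @[N --> \oo] --> limn (series v).
Proof.
move=> cg ug uv NL.
have g0 n : 0 <= g n by exact: le_trans (normr_ge0 _) (ug 0%N n).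
have vg n : `|v n| <= g n.
  have /cvg_norm := uv n => /cvg_lim <- //.
  apply: limr_le; last by apply: nearW => N; exact: ug.
  by apply/cvg_ex; exists `|v n|; apply: cvg_norm.
have cv := cvg_series_dominated cg vg.
suff h : series (u N) (L N) - series v (L N) @[N --> \oo] --> 0.
  have LL : L N @[N --> \oo] --> \oo.
    move=> P [m _ mP]; exists m => // N /= mN; apply: mP => /=.
    exact: leq_trans mN (NL N).
  have cvL : series v (L N) @[N --> \oo] --> limn (series v).
    exact: (cvg_comp _ _ LL cv).
  rewrite (_ : (fun N => series (u N) (L N)) = (fun N =>
      (series (u N) (L N) - series v (L N)) + series v (L N))).
    by rewrite -[limn _]add0r; exact: cvgD.
  by apply/funext => N; rewrite subrK.
apply/cvgrPdist_le => e e0.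
pose G := limn (series g).
have [M /(_ _ (leqnn _)) HM] : exists M, forall N, (M <= N)%N -> G - series g N <= e / 4.
  have /cvgrPdist_le/(_ (e / 4)) := cg.
  rewrite divr_gt0// => /(_ isT) [M _ HM]; exists M => N MN.
  by apply: le_trans (HM N MN); rewrite ler_norm.
have hM : `|series (u N) M - series v M| @[N --> \oo] --> 0.
  rewrite -(normr0 R) -(subrr (series v M)); apply: cvg_norm; apply: cvgB; last exact: cvg_cst.
  rewrite /series /=; apply: cvg_big => [|n _]; last exact: uv.
  exact: add_continuous.
move/cvgrPdist_le : hM => /(_ (e / 2)); rewrite divr_gt0// => /(_ isT) hM.
near=> N.
have MN : (M <= N)%N by near: N; exists M.
have hMN : `|series (u N) M - series v M| <= e / 2.
  by near: N; apply: filterS hM => N; rewrite sub0r normrN normr_id.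
have ML := leq_trans MN (NL N).
have split_series w : series w (L N) = series w M + \sum_(M <= k < L N) w k.
  by rewrite /series /= -big_cat_nat.
rewrite sub0r normrN !split_series opprD addrACA -[X in _ + X]sumrB.
apply: le_trans (ler_normD _ _) _.
have -> : e = e / 2 + (e / 4 + e / 4) by lra.
apply: lerD => //; apply: le_trans (ler_norm_sum _ _ _) _.
have tail : \sum_(M <= k < L N) g k <= e / 4.
  apply: le_trans HM; rewrite lerBrDl -split_series.
  exact: series_le_lim.
apply: (@le_trans _ _ (\sum_(M <= k < L N) (g k + g k))).
  by apply: ler_sum => k _; apply: le_trans (ler_normB _ _) _; rewrite lerD.
by rewrite big_split /= lerD.
Unshelve. all: by end_near. Qed.

Lemma power_series_cvg d z : cvgn (series (fun n => `|d n|)) -> 0 < z < 1 ->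
  cvgn (series (fun n => d n * z ^+ n)).
Proof.
move=> cd /andP[z0 z1]; apply: cvg_series_dominated cd _ => k.
by rewrite normrM normrX (gtr0_norm z0) ler_piMr// exprn_ile1// ltW.
Qed.

(** With D the sum of all |d_n|, the terms of positive degree add up to at most z D in absolute
    value. At z = |d_0| / (2 D), which is at most 1/2, this is |d_0| / 2, too small to cancel a
    nonzero d_0. *)
Lemma power_series_coef0 d :
  cvgn (series (fun n => `|d n|)) ->
  (forall z : R, 0 < z < 1 -> limn (series (fun n => d n * z ^+ n)) = 0) ->
  d 0%N = 0.
Proof.
pose D := limn (series (fun n => `|d n|)).
move=> cd h; apply/eqP/negPn/negP => d00.
have dD N : series (fun n => `|d n|) N <= D by exact: series_le_lim.
have d0p : 0 < `|d 0%N| by rewrite normr_gt0.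
have Dp : 0 < D.
  by apply: lt_le_trans d0p _; have := dD 1%N; rewrite /series /= big_nat1.
pose z := `|d 0%N| / (2 * D).
have z01 : 0 < z < 1.
  rewrite divr_gt0 ?mulr_gt0//= ltr_pdivrMr ?mulr_gt0// mul1r.
  by have := dD 1%N; rewrite /series /= big_nat1; lra.
have [z0 z1] := andP z01.
have le N : `|series (fun n => d n * z ^+ n) N.+1 - d 0%N| <= z * D.
  rewrite /series /= big_nat_recl// expr0 mulr1 addrC addKr.
  apply: le_trans (ler_norm_sum _ _ _) _.
  apply: (@le_trans _ _ (z * \sum_(0 <= i < N) `|d i.+1|)).
    rewrite big_distrr/= ler_sum// => k _.
    rewrite normrM normrX (gtr0_norm z0) mulrC exprS -mulrA ler_wpM2l ?(ltW z0)//.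
    by rewrite ler_piMl// exprn_ile1// ltW.
  rewrite ler_wpM2l ?(ltW z0)//; apply: le_trans (dD N.+1).
  by rewrite /series /= big_nat_recl// lerDr.
have : `|0 - d 0%N| <= z * D.
  rewrite -(h _ z01).
  have cvn := power_series_cvg cd z01.
  have cvS : `|series (fun n => d n * z ^+ n) N.+1 - d 0%N| @[N --> \oo] -->
      `|limn (series (fun n => d n * z ^+ n)) - d 0%N|.
    by apply: cvg_norm; apply: cvgB; [rewrite cvg_shiftS | exact: cvg_cst].
  rewrite -(cvg_lim _ cvS)//; apply: limr_le; first by apply/cvg_ex; eexists; exact: cvS.
  by apply: nearW => N; exact: le.
rewrite sub0r normrN /z mulrAC; have -> : `|d 0%N| * D / (2 * D) = `|d 0%N| / 2.
  by field; rewrite gt_eqF.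
lra.
Qed.

(** Once d_0 = 0, division by z > 0 gives the same hypothesis for the shifted sequence. *)
Lemma power_series_eq0 d :
  cvgn (series (fun n => `|d n|)) ->
  (forall z : R, 0 < z < 1 -> limn (series (fun n => d n * z ^+ n)) = 0) ->
  forall n, d n = 0.
Proof.
move=> cd h n; elim: n d cd h => [|n IH] d cd h; first exact: power_series_coef0.
have d0 := power_series_coef0 cd h.
apply: (IH (fun n => d n.+1)).
  rewrite (_ : series _ = fun N => series (fun n => `|d n|) N.+1 - `|d 0%N|).
    apply: is_cvgB; last exact: is_cvg_cst.
    by apply/cvg_ex; exists (limn (series (fun n => `|d n|))); rewrite cvg_shiftS.
  by apply/funext => N; rewrite /series /= big_nat_recl// addrC addKr.
move=> z z01; apply: cvg_lim => //; have [z0 z1] := andP z01.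
rewrite (_ : series _ = fun N => z^-1 * series (fun n => d n * z ^+ n) N.+1).
  rewrite -[X in _ --> X](mulr0 z^-1) -(h _ z01); apply: cvgMr.
  by rewrite cvg_shiftS; exact: power_series_cvg.
apply/funext => N; rewrite /series /= big_nat_recl// d0 mul0r add0r big_distrr/=.
by apply: eq_bigr => k _; rewrite exprS; field; rewrite gt_eqF.
Qed.
End Series.

(** * The matrix exponential as an entrywise series *)

Section MatrixExponential.
Context {R : realType}.

Lemma mxpow_norm_le {p} (A : 'M[R]_p) a k i j :
  (forall i, \sum_j `|A i j| <= a) -> `|(A ^+ k) i j| <= a ^+ k.
Proof.
move=> Aa; have a0 : 0 <= a by apply: le_trans (Aa i); exact: sumr_ge0.
elim: k i j => [|k IH] i j.
  by rewrite !expr0 mxE; case: (i == j); rewrite ?normr1 ?normr0.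
rewrite !exprS -mulmxE mxE; apply: le_trans (ler_norm_sum _ _ _) _.
apply: (@le_trans _ _ (\sum_l `|A i l| * a ^+ k)).
  by apply: ler_sum => l _; rewrite normrM ler_wpM2l.
by rewrite -big_distrl/= ler_wpM2r ?exprn_ge0.
Qed.

Lemma exp_series_cvg (a : R) : cvgn (series (fun k => a ^+ k / k`!%:R)).
Proof. exact: is_cvg_series_exp_coeff. Qed.

Lemma row_norm_bound {p} (A : 'M[R]_p) : exists a, forall i, \sum_j `|A i j| <= a.
Proof.
exists (\sum_i \sum_j `|A i j|) => i; rewrite [leRHS](bigD1 i)//= lerDl.
by apply: sumr_ge0 => k _; exact: sumr_ge0.
Qed.

(** Tannery's theorem with dominating terms a^k / k!, as the bound on absolute row sums is
    submultiplicative. The exponent and the truncation vary together, which covers polynomials that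
    approximate both. *)
Lemma expmx_approx {p} (A_ : nat -> 'M[R]_p) (A : 'M[R]_p) a (L : nat -> nat) i j :
  (forall N i, \sum_j `|A_ N i j| <= a) ->
  (forall i j, A_ N i j @[N --> \oo] --> A i j) -> (forall N, (N <= L N)%N) ->
  series (fun k => (A_ N ^+ k) i j / k`!%:R) (L N) @[N --> \oo] --> expmx A i j.
Proof.
move=> Aa AA NL; rewrite /expmx mxE.
apply: (tannery (g := fun k => a ^+ k / k`!%:R)) => //.
- exact: exp_series_cvg.
- by move=> N k; rewrite normrM (ger0_norm (_ : 0 <= _^-1))// ler_wpM2r// mxpow_norm_le.
move=> k; apply: cvgMl.
elim: k i j => [|k IH] i j; first by under eq_fun do rewrite expr0; exact: cvg_cst.
rewrite exprS -mulmxE mxE.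
under eq_fun => N do rewrite exprS -mulmxE mxE.
apply: cvg_big => [|l _]; first exact: add_continuous.
by apply: cvgM; [exact: AA|exact: IH].
Qed.

Lemma cvg_expmx {p} (A : 'M[R]_p) i j :
  series (fun k => (A ^+ k) i j / k`!%:R) @ \oo --> expmx A i j.
Proof.
have [a Aa] := row_norm_bound A.
by apply: (@expmx_approx _ (fun=> A) A a id) => // *; exact: cvg_cst.
Qed.

Arguments cvg_expmx {p} A i j.

Lemma expmx0 {p} : expmx (0 : 'M[R]_p) = 1%:M.
Proof.
apply/matrixP => i j; have h := cvg_expmx (0 : 'M[R]_p) i j.
rewrite -(cvg_lim _ h)//; apply: cvg_lim => //; rewrite -cvg_shiftS.
rewrite (_ : (fun _ => _) = cst ((1%:M : 'M[R]_p) i j)); first exact: cvg_cst.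
apply/funext => N; rewrite /series /= big_nat_recl// big1 ?addr0.
  by rewrite expr0 fact0 divr1.
by move=> k _; rewrite expr0n/= mxE mul0r.
Qed.

(** A scalar matrix commutes with A, so the binomial formula turns the exponential series into a
    Cauchy product. *)
Lemma expmx_scalarD {p} (A : 'M[R]_p) (c : R) :
  expmx (c%:M + A) = expR c *: expmx A.
Proof.
apply/matrixP => i j; rewrite [RHS]mxE.
have [a Aa] := row_norm_bound A.
have h := cvg_expmx (c%:M + A) i j; rewrite -(cvg_lim _ h)//; apply: cvg_lim => //.
(* The N-th partial sum is a sum over the triangle n + m < N; [u N n] is its column with A^n. *)
pose u N n := if (n < N)%N then
  (A ^+ n) i j / n`!%:R * series (exp_coeff c) (N - n)%N else 0.
have comm k : ((c%:M + A) ^+ k) i j / k`!%:R =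
   \sum_(n < k.+1) (A ^+ n) i j / n`!%:R * exp_coeff c (k - n)%N.
  rewrite exprDn_comm; last exact/esym/comm_mx_scalar.
  rewrite summxE mulr_suml; apply: eq_bigr => n _.
  rewrite /exp_coeff /= -(rmorphXn (@scalar_mx R p))/= -mulmxE mul_scalar_mx.
  rewrite mulmxnE mxE.
  have nk : (n <= k)%N by rewrite -ltnS.
  rewrite -mulr_natr -(bin_fact nk) !natrM; field.
  by rewrite !pnatr_eq0 -!lt0n !fact_gt0 bin_gt0 nk.
rewrite (_ : series _ = fun N => series (u N) N).
  have -> : expR c * expmx A i j = limn (series (fun n =>
      (A ^+ n) i j / n`!%:R * expR c)).
    apply/esym/cvg_lim => //.
    rewrite (_ : series _ = fun N => expR c * series (fun n => (A ^+ n) i j / n`!%:R) N).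
      by apply: cvgMr; exact: cvg_expmx.
    by apply/funext => N; rewrite /series/= big_distrr; apply: eq_bigr => k _; rewrite mulrC.
  apply: (tannery (g := fun k => a ^+ k / k`!%:R * expR `|c|)) => //.
  - rewrite (_ : series _ = fun N => expR `|c| * series (fun n => a ^+ n / n`!%:R) N).
      by apply: is_cvgMr; exact: exp_series_cvg.
    by apply/funext => N; rewrite /series/= big_distrr; apply: eq_bigr => k _; rewrite mulrC.
  - move=> N n; rewrite /u; case: ifPn => _; last first.
      by rewrite normr0 !mulr_ge0 ?expR_ge0 ?exprn_ge0//; apply: le_trans (Aa i); exact: sumr_ge0.
    rewrite normrM ler_pM//.
      by rewrite normrM (ger0_norm (_ : 0 <= _^-1))// ler_wpM2r// mxpow_norm_le.
    apply: le_trans (ler_norm_sum _ _ _) _.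
    rewrite (eq_bigr (fun k => exp_coeff `|c| k)).
      by apply: series_le_lim => [k|]; [exact: exp_coeff_ge0|exact: is_cvg_series_exp_coeff].
    by move=> k _; rewrite /exp_coeff /= normrM normrX (ger0_norm (_ : 0 <= _^-1)).
  - move=> n; apply: (@cvg_trans _ ((A ^+ n) i j / n`!%:R * series (exp_coeff c) (N - n)%N @[N --> \oo])).
      apply: near_eq_cvg; exists n.+1 => // N /= nN.
      by rewrite /u nN.
    apply: cvgMr; rewrite -(cvg_shiftn n)/=.
    under eq_fun do rewrite addnK.
    exact: is_cvg_series_exp_coeff.
apply/funext => N; rewrite /series /=.
under eq_bigr => k _ do rewrite comm.
rewrite [RHS]big_mkord.
under [RHS]eq_bigr => n _ do rewrite /u ltn_ord /series/= big_distrr/=.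
elim: N => [|N IHN]; first by rewrite big_nil big_ord0.
rewrite big_nat_recr//= IHN [RHS]big_ord_recr/= subSnn big_nat1.
rewrite [X in _ + X = _]big_ord_recr/= subnn addrA; congr (_ + _).
rewrite -big_split/=; apply: eq_bigr => n _.
by rewrite subSn 1?ltnW// big_nat_recr.
Qed.

End MatrixExponential.

(** * The exponential of a power series with nonnegative coefficients *)

Section PowerSeriesExponential.
Context {R : realType}.
Implicit Types P Q : {poly R}.

(** An order on polynomials with nonnegative coefficients that is stable under products; for it the
    truncated exponentials [E N] increase in N. *)
Definition coef_le P Q := forall n, 0 <= P`_n <= Q`_n.

Lemma coef_leM P P' Q Q' :
  coef_le P P' -> coef_le Q Q' -> coef_le (P * Q) (P' * Q').
Proof.
move=> h k n; rewrite !coefM; apply/andP; split.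
  apply: sumr_ge0 => i _; have /andP[? _] := h i; have /andP[? _] := k (n - i)%N.
  exact: mulr_ge0.
by apply: ler_sum => i _; have /andP[? ?] := h i; have /andP[? ?] := k (n - i)%N;
  exact: ler_pM.
Qed.

Lemma coef_leX P Q k : coef_le P Q -> coef_le (P ^+ k) (Q ^+ k).
Proof.
move=> h; elim: k => [|k IH]; last by rewrite !exprS; exact: coef_leM.
by move=> n; rewrite !expr0 lexx andbT coef1; case: (n == 0%N).
Qed.

Lemma horner_mx_entry q (S : 'M[R]_q.+1) P N i j : (size P <= N)%N ->
  (horner_mx S P) i j = \sum_(0 <= n < N) P`_n * (S ^+ n) i j.
Proof.
move=> PN; have {1}-> : P = \sum_(0 <= n < N) P`_n *: 'X^n.
  by rewrite big_mkord -poly_def; apply/polyP => n; rewrite coef_poly;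
    case: ltnP => // /(leq_trans PN) /leq_sizeP ->.
rewrite raddf_sum summxE; apply: eq_bigr => n _.
by rewrite /= linearZ/= rmorphXn/= horner_mx_X mxE.
Qed.

Definition mxseries q (b : nat -> R) (S : 'M[R]_q) : 'M[R]_q :=
  \matrix_(i, j) limn (series (fun n => b n * (S ^+ n) i j)).

Section Coefficients.
Variables (b : nat -> R) (y : R).
Hypotheses (b0 : forall n, 0 <= b n) (cb : cvgn (series b)) (y0 : 0 <= y).

(** [B N] truncates the series y b and [E N] truncates the exponential of [B N]. Being polynomials,
    they can be evaluated at matrices of every size, and their coefficients do not depend on the
    matrix. *)
Let B N : {poly R} := \poly_(n < N) (y * b n).
Let E N : {poly R} := \sum_(0 <= k < N) k`!%:R^-1 *: B N ^+ k.

Let B_le N M : (N <= M)%N -> coef_le (B N) (B M).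
Proof.
move=> NM n; rewrite !coef_poly; have yb : 0 <= y * b n by exact: mulr_ge0.
case: ltnP => [nN|_]; first by rewrite (leq_trans nN NM) yb/=.
by rewrite lexx/=; case: ifP.
Qed.

Let E_le N M : (N <= M)%N -> coef_le (E N) (E M).
Proof.
move=> NM n; rewrite !coef_sum; have h k : 0 <= (k`!%:R^-1 *: B N ^+ k)`_n <= (k`!%:R^-1 *: B M ^+ k)`_n.
  rewrite !coefZ; have /andP[h1 h2] := coef_leX k (B_le NM) n.
  by rewrite mulr_ge0//= ler_wpM2l.
apply/andP; split; first by apply: sumr_ge0 => k _; have /andP[] := h k.
rewrite [leRHS](big_cat_nat (n := N))//=; apply: ler_wpDr.
  by apply: sumr_ge0 => k _; have /andP[hk /(le_trans hk)] := h k.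
by apply: ler_sum => k _; have /andP[] := h k.
Qed.

Let E0 N n : 0 <= (E N)`_n.
Proof. by have /andP[] := E_le (leqnn N) n. Qed.

Let entry_le1 q (S : 'M[R]_q.+1) : Prop := forall n i j, `|(S ^+ n) i j| <= 1.

Let cvg_bS q (S : 'M[R]_q.+1) i j : entry_le1 S ->
  cvgn (series (fun n => b n * (S ^+ n) i j)).
Proof.
move=> S1; apply: cvg_series_dominated cb _ => n.
by rewrite normrM (ger0_norm (b0 n)) ler_piMr.
Qed.

Let E_cvg q (S : 'M[R]_q.+1) i j : entry_le1 S ->
  (horner_mx S (E N)) i j @[N --> \oo] --> expmx (y *: mxseries b S) i j.
Proof.
move=> S1.
have BS N i' j' : (horner_mx S (B N)) i' j' = y * series (fun n => b n * (S ^+ n) i' j') N.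
  rewrite (@horner_mx_entry _ _ _ N) ?size_poly// big_distrr/=.
  by apply: eq_big_nat => n /andP[_ nN]; rewrite coef_poly nN mulrA.
pose a := q.+1%:R * (y * limn (series b)).
rewrite (_ : (fun N => _) = fun N => series (fun k => ((horner_mx S (B N)) ^+ k) i j / k`!%:R) N).
  apply: (@expmx_approx _ _ (fun N => horner_mx S (B N)) (y *: mxseries b S) a id) => //.
  - move=> N i'; apply: (@le_trans _ _ (\sum_(j' < q.+1) y * limn (series b))).
      apply: ler_sum => j' _; rewrite BS normrM ger0_norm// ler_wpM2l//.
      apply: le_trans (ler_norm_sum _ _ _) _.
      apply: le_trans (series_le_lim N b0 cb).
      by apply: ler_sum => n _; rewrite normrM (ger0_norm (b0 n)) ler_piMr.
    by rewrite sumr_const card_ord /a mulr_natl.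
  - move=> i' j'; under eq_fun do rewrite BS.
    by rewrite !mxE; apply: cvgMr; exact: cvg_bS.
apply/funext => N; rewrite /E raddf_sum summxE/=; apply: eq_bigr => k _.
by rewrite linearZ/= rmorphXn/= mxE mulrC.
Qed.

(** The sum of the coefficients of [E N] is its value at the 1 by 1 identity matrix, and these
    values increase to the right-hand side by [E_cvg]. *)
Let E1 N M : series (fun n => (E N)`_n) M <= expR (y * limn (series b)).
Proof.
have S1 : entry_le1 (1%:M : 'M[R]_1).
  by move=> n i j; rewrite expr1n mxE; case: (i == j); rewrite ?normr1 ?normr0.
have h := @E_cvg _ _ 0 0 S1.
have bE : y *: mxseries b (1%:M : 'M[R]_1) = (y * limn (series b))%:M.
  apply/matrixP => i j; rewrite !mxE !ord1 eqxx mulr1n.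
  rewrite (_ : (fun n => _) = b)//; apply/funext => n.
  by rewrite expr1n mxE eqxx mulr1.
rewrite bE -[X in expmx X]addr0 expmx_scalarD expmx0 !mxE eqxx mulr1 in h.
have HE N' K : (size (E N') <= K)%N ->
    (horner_mx 1%:M (E N') : 'M[R]_1) 0 0 = series (fun n => (E N')`_n) K.
  move=> sK; rewrite (@horner_mx_entry _ _ _ K)//; apply: eq_bigr => n _.
  by rewrite expr1n mxE mulr1.
apply: (@le_trans _ _ ((horner_mx 1%:M (E N) : 'M[R]_1) 0 0)).
  rewrite (HE _ (maxn M (size (E N)))) ?leq_maxr//.
  by apply: nondecreasing_series => //; rewrite leq_maxl.
rewrite -(cvg_lim _ h)//; apply: nondecreasing_cvgn_le.
  move=> n m nm; pose K := maxn (size (E n)) (size (E m)).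
  rewrite (HE _ K) ?leq_maxl// (HE _ K) ?leq_maxr//.
  by apply: ler_sum => k _; have /andP[] := E_le nm k.
by apply/cvg_ex; eexists; exact: h.
Qed.

(** The coefficients of [E N] increase with N and have bounded sums; [e] is their limit. One
    sequence [e] serves matrices of every size, so that 1 by 1 matrices can identify it before it is
    used for S. *)
Lemma exp_power_series : exists e : nat -> R,
  [/\ forall n, 0 <= e n, cvgn (series e) &
   forall q (S : 'M[R]_q.+1), (forall n i j, `|(S ^+ n) i j| <= 1) ->
     mxseries e S = expmx (y *: mxseries b S)].
Proof.
pose e n := limn (fun N => (E N)`_n).
have Emono n : nondecreasing_seq (fun N => (E N)`_n).
  by move=> N M /E_le /(_ n) /andP[].
have ce n : cvgn (fun N => (E N)`_n).
  apply: nondecreasing_is_cvgn => //; exists (expR (y * limn (series b))).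
  move=> _ [N _ <-]; apply: le_trans (E1 N n.+1).
  by rewrite /series/= big_nat_recr//= lerDr sumr_ge0.
have Ee N n : (E N)`_n <= e n by exact: (nondecreasing_cvgn_le (Emono n) (@ce n)).
have e0 n : 0 <= e n by apply: le_trans (E0 0%N n) (Ee _ _).
have se : cvgn (series e).
  apply: (@cvgn_series_le _ _ (expR (y * limn (series b)))) => // M.
  have h : series (fun n => (E N)`_n) M @[N --> \oo] --> series e M.
    by apply: cvg_big => [|n _]; [exact: add_continuous|exact: ce].
  rewrite -(cvg_lim _ h)//; apply: limr_le; first by apply/cvg_ex; eexists; exact: h.
  by apply: nearW => N; exact: E1.
exists e; split => // q S S1; apply/matrixP => i j; rewrite [LHS]mxE.
rewrite -(cvg_lim _ (@E_cvg _ _ i j S1))//; apply/esym/cvg_lim => //.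
(* Evaluation of [E N] takes at least [size (E N)] terms, Tannery's theorem at least [N]; hence the
   maximum. *)
under eq_fun => N do rewrite (@horner_mx_entry _ _ _ (maxn N (size (E N)))) ?leq_maxr//.
apply: (@tannery _ (fun N n => (E N)`_n * (S ^+ n) i j) _ e
  (fun N => maxn N (size (E N)))) => //.
- move=> N n; rewrite normrM (ger0_norm (E0 _ _)) -[leRHS]mulr1.
  by apply: ler_pM => //.
- by move=> n; apply: cvgMl; exact: ce.
- by move=> N; exact: leq_maxl.
Qed.

End Coefficients.

Lemma mxseries_scalar1 (b : nat -> R) (z : R) :
  mxseries b (z%:M : 'M[R]_1) = (limn (series (fun n => b n * z ^+ n)))%:M.
Proof.
apply/matrixP => i j; rewrite !mxE !ord1 eqxx mulr1n; congr (limn _).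
apply/funext => k; apply: eq_bigr => n _.
by rewrite -(rmorphXn (@scalar_mx R 1))/= mxE eqxx mulr1n.
Qed.

Lemma expmx_scalar q (c : R) : expmx (c%:M : 'M[R]_q) = (expR c)%:M.
Proof. by rewrite -[c%:M]addr0 expmx_scalarD expmx0 scalemx1. Qed.

(* Coefficients of a power series are determined by its values on (0, 1), so
   an identity between power series in a scalar z passes to a matrix S. *)
Lemma mxseries_exp (a b : nat -> R) (y kappa : R) q (S : 'M[R]_q.+1) :
  (forall n, 0 <= b n) -> cvgn (series b) -> 0 <= y ->
  (forall n, 0 <= a n) -> cvgn (series a) ->
  (forall z, 0 < z < 1 -> limn (series (fun n => a n * z ^+ n)) =
      kappa * expR (y * limn (series (fun n => b n * z ^+ n)))) ->
  (forall n i j, `|(S ^+ n) i j| <= 1) ->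
  mxseries a S = kappa *: expmx (y *: mxseries b S).
Proof.
move=> b0 cb y0 a0 ca ha S1.
have [e [e0 ce he]] := exp_power_series b0 cb y0.
have norm1 (f : nat -> R) : (forall n, 0 <= f n) -> cvgn (series f) ->
    cvgn (series (fun n => `|f n|)).
  by move=> f0; rewrite (_ : (fun n => `|f n|) = f)//; apply/funext => n; rewrite ger0_norm.
have cZ (f : nat -> R) c : cvgn (series f) -> series (fun n => c * f n) @ \oo --> c * limn (series f).
  move=> cf; rewrite (_ : series _ = fun N => c * series f N); first exact: cvgMr.
  by apply/funext => N; rewrite /series/= big_distrr.
have cB (f g : nat -> R) : cvgn (series f) -> cvgn (series g) ->
    series (fun n => f n - g n) @ \oo --> limn (series f) - limn (series g).
  move=> cf cg; rewrite (_ : series _ = fun N => series f N - series g N); first exact: cvgB.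
  by apply/funext => N; rewrite /series/= sumrB.
pose d n := a n - kappa * e n.
have d0 : forall n, d n = 0.
  apply: power_series_eq0.
    have cke : cvgn (series (fun n => `|kappa| * e n)).
      by apply/cvg_ex; eexists; exact: cZ.
    apply: (@cvg_series_dominated _ _ (fun n => a n + `|kappa| * e n)).
      rewrite (_ : series _ = fun N => series a N + series (fun n => `|kappa| * e n) N).
        exact: is_cvgD.
      by apply/funext => N; rewrite /series/= big_split.
    move=> n; rewrite normr_id /d; apply: le_trans (ler_normB _ _) _.
    by rewrite (ger0_norm (a0 n)) normrM (ger0_norm (e0 n)).
  move=> z z01; apply: cvg_lim => //.
  rewrite (_ : (fun n => d n * z ^+ n) = fun n => a n * z ^+ n - kappa * (e n * z ^+ n)); last first.
    by apply/funext => n; rewrite /d mulrBl mulrA.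
  have caz := power_series_cvg (norm1 _ a0 ca) z01.
  have cez := power_series_cvg (norm1 _ e0 ce) z01.
  have := cB _ _ caz (cvgP _ (cZ _ kappa cez)).
  rewrite (cvg_lim _ (cZ _ kappa cez))// ha//.
  suff -> : limn (series (fun n => e n * z ^+ n)) =
    expR (y * limn (series (fun n => b n * z ^+ n))) by rewrite subrr.
  (* The scalar z is seen as a 1 by 1 matrix, to which the coefficients [e] apply as well. *)
  have z1 : forall n i j, `|((z%:M : 'M[R]_1) ^+ n) i j| <= 1.
    move=> n i j; rewrite -(rmorphXn (@scalar_mx R 1))/= mxE !ord1 eqxx mulr1n.
    by have [z0 zl1] := andP z01; rewrite normrX (gtr0_norm z0) exprn_ile1// ltW.
  have := he _ _ z1; rewrite !mxseries_scalar1 scale_scalar_mx expmx_scalar.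
  by move=> /matrixP/(_ 0 0); rewrite !mxE eqxx !mulr1n.
have -> : a = fun n => kappa * e n.
  by apply/funext => n; have /eqP := d0 n; rewrite subr_eq0 => /eqP.
rewrite -he//; apply/matrixP => i j; rewrite !mxE.
rewrite (_ : (fun n => _) = (fun n => kappa * (e n * (S ^+ n) i j))); last first.
  by apply/funext => n; rewrite mulrA.
apply: cvg_lim => //; apply: cZ; apply: cvg_series_dominated ce _ => n.
by rewrite normrM (ger0_norm (e0 n)) ler_piMr.
Qed.

End PowerSeriesExponential.

Lemma series_recl {R : realType} (u : nat -> R) :
  cvgn (series (fun n => u n.+1)) ->
  series u @ \oo --> u 0%N + limn (series (fun n => u n.+1)).
Proof.
move=> cu; rewrite -cvg_shiftS.
rewrite (_ : (fun n => _) = fun N => u 0%N + series (fun n => u n.+1) N).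
  by apply: cvgD => //; exact: cvg_cst.
by apply/funext => N; rewrite /series/= big_nat_recl.
Qed.

(** * Uniformization of a sub-intensity matrix *)

Section Uniformization.
Context {R : realType} {p : nat}.
Implicit Types S T : 'M[R]_p.

Definition substochastic S : Prop :=
  (forall i j, 0 <= S i j) /\ (forall i, \sum_j S i j <= 1).

(** The rate r = 1 + sum_i |T_ii| dominates every exit rate -T_ii, so that S = 1 + T / r has
    nonnegative entries; the summand 1 keeps r positive when the diagonal of T is 0. *)
Lemma uniformization T : sub_intensity T -> exists r S,
  [/\ 0 < r, substochastic S & forall t, t *: T = (- (r * t))%:M + (r * t) *: S].
Proof.
move=> [Toff Trow]; pose r := 1 + \sum_i `|T i i|.
have r0 : 0 < r by rewrite ltr_pwDl// sumr_ge0.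
have rT i : - T i i <= r.
  rewrite /r (bigD1 i)//=; apply: (@le_trans _ _ `|T i i|); first by rewrite -normrN ler_norm.
  by rewrite addrCA lerDl addr_ge0// sumr_ge0.
exists r, (1%:M + r^-1 *: T); split => //; last first.
  move=> t; apply/matrixP => i j; rewrite !mxE; case: (i == j); rewrite ?mulr1n ?mulr0n.
    by field; rewrite gt_eqF.
  by field; rewrite gt_eqF.
split=> i.
  move=> j; rewrite !mxE; case: eqVneq => [<-|ij].
    have -> : 1 + r^-1 * T i i = r^-1 * (r - - T i i) by field; rewrite gt_eqF.
    by rewrite mulr_ge0 ?subr_ge0// invr_ge0 ltW.
  by rewrite mulr0n add0r mulr_ge0 ?Toff// invr_ge0 ltW.
under eq_bigr do rewrite !mxE.
rewrite big_split/= -mulr_sumr (bigD1 i)//= eqxx big1 ?addr0.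
  by rewrite gerDl mulr_ge0_le0// invr_ge0 ltW.
by move=> j ji; rewrite eq_sym (negbTE ji).
Qed.

Lemma substochasticX S n : substochastic S -> substochastic (S ^+ n).
Proof.
move=> [S0 S1]; elim: n => [|n [IH0 IH1]].
  rewrite expr0; split=> i; first by move=> j; rewrite mxE; case: (i == j).
  rewrite (bigD1 i)//= !mxE eqxx big1 ?addr0// => j ji.
  by rewrite !mxE eq_sym (negbTE ji).
rewrite exprS -mulmxE; split=> i.
  by move=> j; rewrite mxE sumr_ge0// => k _; rewrite mulr_ge0.
under eq_bigr do rewrite mxE.
rewrite exchange_big/=; apply: le_trans (S1 i); apply: ler_sum => k _.
by rewrite -mulr_sumr ler_piMr.
Qed.

Lemma substochastic_le1 S i j : substochastic S -> S i j <= 1.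
Proof.
move=> [S0 S1]; apply: le_trans (S1 i).
by rewrite (bigD1 j)//= lerDl sumr_ge0.
Qed.

Lemma substochasticX_norm_le1 S n i j : substochastic S -> `|(S ^+ n) i j| <= 1.
Proof.
move=> hS; have hn := substochasticX n hS.
by rewrite ger0_norm ?substochastic_le1//; case: hn.
Qed.

Definition poisson_weight (x : R) (n : nat) : R := expR (- x) * (x ^+ n / n`!%:R).

Lemma poisson_weight_ge0 x n : 0 <= x -> 0 <= poisson_weight x n.
Proof. by move=> x0; rewrite !mulr_ge0 ?expR_ge0 ?exprn_ge0. Qed.

(** The generating function of the Poisson law of mean x. *)
Lemma cvg_poisson_weight_pow x z :
  series (fun n => poisson_weight x n * z ^+ n) @ \oo --> expR (- ((1 - z) * x)).
Proof.
rewrite (_ : - ((1 - z) * x) = - x + x * z); last by ring.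
rewrite expRD (_ : series _ = fun N => expR (- x) * series (exp_coeff (x * z)) N).
  by apply: cvgMr; exact: is_cvg_series_exp_coeff.
apply/funext => N; rewrite /series/= big_distrr/=; apply: eq_bigr => n _.
by rewrite /poisson_weight /exp_coeff /= exprMn; ring.
Qed.

Lemma cvg_poisson_weight x : series (poisson_weight x) @ \oo --> (1 : R).
Proof.
have := @cvg_poisson_weight_pow x 1; rewrite subrr mul0r oppr0 expR0.
by rewrite (_ : (fun n => _) = poisson_weight x)//; apply/funext => n; rewrite expr1n mulr1.
Qed.

(** The chain with generator T makes a step of S at each point of a Poisson process of rate r. *)
Lemma cvg_expmx_poisson r S T (t : R) i j :
  (forall t, t *: T = (- (r * t))%:M + (r * t) *: S) ->
  series (fun n => poisson_weight (r * t) n * (S ^+ n) i j) @ \oo -->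
    expmx (t *: T) i j.
Proof.
move=> ->; rewrite expmx_scalarD mxE.
rewrite (_ : series _ = fun N => expR (- (r * t)) *
    series (fun n => (((r * t) *: S) ^+ n) i j / n`!%:R) N).
  by apply: cvgMr; exact: cvg_expmx.
apply/funext => N; rewrite /series/= big_distrr/=; apply: eq_bigr => n _.
have -> : ((r * t) *: S) ^+ n = (r * t) ^+ n *: S ^+ n.
  elim: n => [|n IH]; first by rewrite !expr0 scale1r.
  by rewrite !exprS IH -mulmxE -scalemxAl -scalemxAr scalerA.
by rewrite mxE /poisson_weight; ring.
Qed.

(** A mixture of the substochastic powers of S with Poisson weights. *)
Lemma expmx_substochastic T t : sub_intensity T -> 0 <= t ->
  substochastic (expmx (t *: T)).
Proof.
move=> hT t0; have [r [S [r0 hS hrS]]] := uniformization hT.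
have w0 n : 0 <= poisson_weight (r * t) n by rewrite poisson_weight_ge0// mulr_ge0// ltW.
split=> i.
  move=> j; have h := cvg_expmx_poisson (t := t) (i := i) (j := j) hrS.
  rewrite -(cvg_lim _ h)//; apply: limr_ge; first exact: cvgP h.
  apply: nearW => N; apply: series_ge0 => n; apply: mulr_ge0 => //.
  by have [] := substochasticX n hS.
have h : \sum_j series (fun n => poisson_weight (r * t) n * (S ^+ n) i j) N
    @[N --> \oo] --> \sum_j expmx (t *: T) i j.
  by apply: cvg_big => [|j _]; [exact: add_continuous|exact: cvg_expmx_poisson].
rewrite -(cvg_lim _ h)//; apply: limr_le; first exact: cvgP h.
apply: nearW => N; rewrite -(cvg_lim _ (@cvg_poisson_weight (r * t)))//.
apply: (@le_trans _ _ (series (poisson_weight (r * t)) N)); last first.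
  by apply: series_le_lim => //; exact: cvgP (@cvg_poisson_weight _).
rewrite /series/= exchange_big/=; apply: ler_sum => n _.
by rewrite -mulr_sumr ler_piMr//; have [] := substochasticX n hS.
Qed.

Lemma poisson_weight_tail_cvg x : cvgn (series (fun n => poisson_weight x n.+1)).
Proof.
rewrite (_ : series _ = fun N => series (poisson_weight x) N.+1 - poisson_weight x 0).
  apply: is_cvgB; last exact: is_cvg_cst.
  by apply: (cvgP (1 : R)); rewrite (@cvg_shiftS R); exact: cvg_poisson_weight.
by apply/funext => N; rewrite /series/= big_nat_recl// addrC addKr.
Qed.

Lemma poisson_series_cvg x (s : nat -> R) : 0 <= x -> (forall n, 0 <= s n <= 1) ->
  cvgn (series (fun n => poisson_weight x n.+1 * s n)).
Proof.
move=> x0 s01; apply: cvg_series_dominated (@poisson_weight_tail_cvg x) _ => n.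
have /andP[? s1] := s01 n; have w := poisson_weight_ge0 n.+1 x0.
by rewrite ger0_norm; [rewrite ler_piMr|rewrite mulr_ge0].
Qed.

Lemma poisson_series_ge0 x (s : nat -> R) : 0 <= x -> (forall n, 0 <= s n <= 1) ->
  0 <= limn (series (fun n => poisson_weight x n.+1 * s n)).
Proof.
move=> x0 s01; apply: limr_ge; first exact: poisson_series_cvg.
apply: nearW => N; apply: series_ge0 => n; have /andP[? s1] := s01 n.
by rewrite mulr_ge0// poisson_weight_ge0.
Qed.

(** The weight of index 0 is split off because it tends to 1 as x tends to 0, where a Lévy measure
    may have infinite mass. The other weights add up to 1 - exp(-x), which is of order x. *)
Lemma poisson_series_recl x (s : nat -> R) (l : R) : 0 <= x -> (forall n, 0 <= s n <= 1) ->
  series (fun n => poisson_weight x n * s n) @ \oo --> l ->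
  l = expR (- x) * s 0%N + limn (series (fun n => poisson_weight x n.+1 * s n.+1)).
Proof.
move=> x0 s01 sl; rewrite -(cvg_lim _ sl)//; apply: cvg_lim => //.
have -> : expR (- x) = poisson_weight x 0.
  by rewrite /poisson_weight expr0 fact0 divr1 mulr1.
exact: (@series_recl _ (fun n => poisson_weight x n * s n)
  (poisson_series_cvg x0 (fun n => s01 n.+1))).
Qed.

End Uniformization.

(** * Integrals of series of Poisson weights *)

Section PoissonIntegral.
Local Open Scope ereal_scope.
Context {R : realType} {d : measure_display} {U : measurableType d}.
Variables (m : {measure set U -> \bar R}) (D : set U) (W tau : U -> R) (r : R).
Hypotheses (mD : measurable D) (mW : measurable_fun D W) (mtau : measurable_fun D tau).
Hypotheses (W0 : forall x, (0 <= W x)%R) (tau0 : forall x, D x -> (0 <= tau x)%R) (r0 : (0 < r)%R).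
Hypothesis finW : \int[m]_(x in D) (W x * (1 - expR (- (r * tau x))))%:E < +oo.

Lemma nneseries_EFin (u : nat -> R) l : (forall n, (0 <= u n)%R) ->
  series u @ \oo --> l -> \sum_(n <oo) (u n)%:E = l%:E.
Proof.
move=> u0 ul; apply/cvg_lim => //.
rewrite (_ : (fun _ => _) = EFin \o series u).
  by apply: cvg_EFin; [exact: nearW|exact: ul].
by apply/funext => N; rewrite /= sumEFin.
Qed.

(** Used for the Lévy measure of Phi, with [W = 1] and [tau] the identity, and for P, with [tau] a
    gap between passage times. Index n belongs to the Poisson weight n + 1, since the weight of
    index 0 need not be integrable. *)
Definition poisson_coef (n : nat) : R :=
  fine (\int[m]_(x in D) (W x * poisson_weight (r * tau x) n.+1)%:E).

Let w0 x n : D x -> (0 <= poisson_weight (r * tau x) n)%R.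
Proof. by move=> Dx; rewrite poisson_weight_ge0// mulr_ge0 ?(ltW r0) ?tau0. Qed.

Let mw n : measurable_fun D (fun x => (W x * poisson_weight (r * tau x) n)%:E).
Proof.
apply/measurable_EFinP; apply: measurable_funM => //.
have mrt : measurable_fun D (fun x => (r * tau x)%R) by exact: measurable_funM.
apply: measurable_funM.
  by apply: measurableT_comp => //; exact: measurable_funN.
by apply: measurable_funM => //; exact: measurable_funX.
Qed.

Let cvg_tail x : D x -> series (fun n => poisson_weight (r * tau x) n.+1) @ \oo -->
  (1 - expR (- (r * tau x)))%R.
Proof.
move=> Dx; have h := @cvg_poisson_weight R (r * tau x).
rewrite (_ : series _ = fun N => (series (poisson_weight (r * tau x)) N.+1 - expR (- (r * tau x)))%R).
  by apply: cvgB; [rewrite cvg_shiftS | exact: cvg_cst].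
apply/funext => N; rewrite /series/= big_nat_recl//.
by rewrite /poisson_weight expr0 fact0 divr1 mulr1 addrC addKr.
Qed.

Lemma poisson_coefE n :
  (poisson_coef n)%:E = \int[m]_(x in D) (W x * poisson_weight (r * tau x) n.+1)%:E.
Proof.
rewrite /poisson_coef fineK// ge0_fin_numE; last first.
  by apply: integral_ge0 => x Dx; rewrite lee_fin mulr_ge0// w0.
apply: le_lt_trans finW; apply: ge0_le_integral => //.
- by move=> x Dx; rewrite lee_fin mulr_ge0// w0.
- apply/measurable_EFinP; apply: measurable_funM => //.
  apply: measurable_funB => //; apply: measurableT_comp => //; apply: measurableT_comp => //.
  exact: measurable_funM.
move=> x Dx; rewrite lee_fin ler_wpM2l//.
rewrite -(cvg_lim _ (cvg_tail Dx))//.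
apply: le_trans (series_le_lim n.+1 _ (cvgP _ (cvg_tail Dx))).
  by rewrite /series/= big_nat_recr//= lerDr sumr_ge0// => k _; exact: w0.
by move=> k; exact: w0.
Qed.

Lemma poisson_coef_ge0 n : (0 <= poisson_coef n)%R.
Proof.
by rewrite fine_ge0// integral_ge0// => x Dx; rewrite lee_fin mulr_ge0// w0.
Qed.

Lemma poisson_integral_nneseries (s : nat -> R) : (forall n, (0 <= s n <= 1)%R) ->
  \int[m]_(x in D) (W x * limn (series (fun n => poisson_weight (r * tau x) n.+1 * s n)))%R%:E =
  \sum_(n <oo) (poisson_coef n * s n)%:E.
Proof.
move=> s01; have s0 n : (0 <= s n)%R by have /andP[] := s01 n.
transitivity (\int[m]_(x in D) \sum_(n <oo) (W x * (poisson_weight (r * tau x) n.+1 * s n))%:E).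
  apply: eq_integral => x; rewrite inE => Dx; apply/esym.
  have cv : cvgn (series (fun n => poisson_weight (r * tau x) n.+1 * s n)%R).
    apply: cvg_series_dominated (cvgP _ (cvg_tail Dx)) _ => n.
    have /andP[? s1] := s01 n.
    by rewrite ger0_norm; [rewrite ler_piMr// w0|rewrite mulr_ge0// w0].
  apply: nneseries_EFin => [n|]; first by do 2![apply: mulr_ge0 => //]; exact: w0.
  rewrite (_ : series (fun n => W x * _)%R = fun N => (W x * series (fun n => poisson_weight (r * tau x) n.+1 * s n) N)%R).
    exact: cvgMr cv.
  by apply/funext => N; rewrite /series/= big_distrr.
rewrite integral_nneseries//.
- apply: eq_eseriesr => n _; rewrite EFinM poisson_coefE muleC -ge0_integralZl//.
  + by apply: eq_integral => x _; rewrite -EFinM; congr (_%:E); ring.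
  + by move=> x Dx; rewrite lee_fin mulr_ge0// w0.
  + by rewrite lee_fin.
- move=> n; rewrite (_ : (fun x => _) = (fun x => (s n)%:E * (W x * poisson_weight (r * tau x) n.+1)%:E)).
    exact: measurable_funeM.
  by apply/funext => x; rewrite -EFinM; congr (_%:E); ring.
- by move=> n x Dx; rewrite lee_fin; do 2![apply: mulr_ge0 => //]; exact: w0.
Qed.



(** Taking s = 1, the total is the integral of W (1 - exp(-r tau)), finite by [finW]. *)
Lemma poisson_coef_cvg : cvgn (series poisson_coef).
Proof.
have int0 : 0 <= \int[m]_(x in D) (W x * (1 - expR (- (r * tau x))))%:E.
  apply: integral_ge0 => x Dx.
  by rewrite lee_fin mulr_ge0// subr_ge0 expR_le1 oppr_le0 mulr_ge0 ?tau0// ltW.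
apply: (@cvgn_series_le _ _ (fine (\int[m]_(x in D) (W x * (1 - expR (- (r * tau x))))%:E))).
  exact: poisson_coef_ge0.
move=> N; rewrite -lee_fin fineK; last by rewrite ge0_fin_numE.
have h := @poisson_integral_nneseries (fun=> 1%R) (fun=> _).
rewrite (_ : \int[m]_(x in D) _ = \sum_(n <oo) (poisson_coef n)%:E).
  rewrite /series/= -sumEFin.
  by apply: nneseries_lim_ge => n _; rewrite lee_fin poisson_coef_ge0.
transitivity (\sum_(n <oo) (poisson_coef n * 1)%:E); last first.
  by apply: eq_eseriesr => n _; rewrite mulr1.
rewrite -h; last by rewrite ler01 lexx.
apply: eq_integral => x; rewrite inE => Dx; congr (_ * _)%R%:E.
rewrite -(cvg_lim _ (cvg_tail Dx))//; congr (limn (series _)).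
by apply/funext => n; rewrite mulr1.
Qed.

Lemma poisson_coef_cvgM (s : nat -> R) : (forall n, (0 <= s n <= 1)%R) ->
  cvgn (series (fun n => poisson_coef n * s n)%R).
Proof.
move=> s01; apply: cvg_series_dominated poisson_coef_cvg _ => n.
have /andP[s0 s1] := s01 n.
by rewrite ger0_norm; [rewrite ler_piMr// poisson_coef_ge0|rewrite mulr_ge0// poisson_coef_ge0].
Qed.

Lemma poisson_integral (s : nat -> R) : (forall n, (0 <= s n <= 1)%R) ->
  \int[m]_(x in D) (W x * limn (series (fun n => poisson_weight (r * tau x) n.+1 * s n)))%R%:E =
  (limn (series (fun n => poisson_coef n * s n)%R))%:E.
Proof.
move=> s01; rewrite poisson_integral_nneseries//; apply: nneseries_EFin.
  by move=> n; have /andP[? _] := s01 n; rewrite mulr_ge0// poisson_coef_ge0.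
exact: poisson_coef_cvgM.
Qed.

Lemma measurable_poisson_series (s : nat -> R) : (forall n, (0 <= s n <= 1)%R) ->
  measurable_fun D (fun x => limn (series (fun n => poisson_weight (r * tau x) n.+1 * s n))%R).
Proof.
move=> s01.
apply: (@measurable_fun_cvg _ U R D (fun N x => series (fun n => poisson_weight (r * tau x) n.+1 * s n) N)%R).
  move=> N; apply: measurable_sum => n; apply: measurable_funM => //.
  have mrt : measurable_fun D (fun x => (r * tau x)%R) by exact: measurable_funM.
  apply: measurable_funM.
    by apply: measurableT_comp => //; exact: measurable_funN.
  by apply: measurable_funM => //; exact: measurable_funX.
move=> x Dx; apply: cvg_series_dominated (cvgP _ (cvg_tail Dx)) _ => n.
have /andP[? s1] := s01 n.
by rewrite ger0_norm; [rewrite ler_piMr// w0|rewrite mulr_ge0// w0].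
Qed.

End PoissonIntegral.

(** * Bernstein functions as power series in z, where q = r (1 - z) *)

Section Bernstein.
Context {R : realType}.
Variables (qbar dbar : R) (nu : {measure set (measurableTypeR R) -> \bar R}) (r : R).
Hypotheses (hnu : bernstein_triplet qbar dbar nu) (r0 : 0 < r).

Let D0 : set (measurableTypeR R) := [set` `]0%R, +oo[].
Let mD0 : measurable D0. Proof. exact: measurable_itv. Qed.
Let D0_gt0 x : D0 x -> 0 < x. Proof. by rewrite /D0 /= in_itv/= andbT. Qed.

Let mexp : measurable_fun D0 (fun x : R => 1 - expR (- (r * x))).
Proof.
apply: measurable_funB => //; apply: measurableT_comp => //; apply: measurable_funN.
exact: measurable_funM.
Qed.

Let exp01 x : D0 x -> 0 <= 1 - expR (- (r * x)).
Proof. by move=> /D0_gt0 x0; rewrite subr_ge0 expR_le1 oppr_le0 mulr_ge0// ltW. Qed.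

(** 1 - exp(-r x) is at most 1 and at most r x, hence at most (1 + r) min(1, x). *)
Let finW : (\int[nu]_(x in D0) (1 * (1 - expR (- (r * x))))%:E < +oo)%E.
Proof.
have [_ _ h] := hnu.
apply: (@le_lt_trans _ _ (\int[nu]_(x in D0) ((1 + r)%:E * (Num.min 1 x)%:E))%E); last first.
  rewrite ge0_integralZl//.
  - by rewrite lte_mul_pinfty// lee_fin addr_ge0// ltW.
  - by apply/measurable_EFinP; exact: measurable_minr.
  - by move=> x /D0_gt0 x0; rewrite lee_fin le_min ler01 ltW.
  - by rewrite lee_fin addr_ge0// ltW.
apply: ge0_le_integral => //.
- by move=> x Dx; rewrite lee_fin mul1r exp01.
- by apply/measurable_EFinP; exact: measurable_funM.
- apply: measurable_funeM; apply/measurable_EFinP; exact: measurable_minr.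
move=> x Dx; have x0 := D0_gt0 Dx; rewrite -EFinM lee_fin mul1r.
have h1 : 1 - expR (- (r * x)) <= r * x.
  by have := expR_ge1Dx (- (r * x)); lra.
have h2 := expR_ge0 (- (r * x)).
case: (leP 1 (x : R)) => x1.
  by rewrite mulr1 (@le_trans _ _ 1)// ?lerDl ?(ltW r0)// lerBlDr lerDl.
by apply: le_trans h1 _; rewrite mulrDl mul1r lerDr ltW.
Qed.

(** For a subordinator with Lévy measure [nu], the rate of the jumps that cover exactly n + 1 points
    of an independent Poisson process of rate r; [levy_mass] is the rate of those that cover at
    least one. *)
Definition levy_coef : nat -> R := poisson_coef nu D0 (fun=> 1) id r.
Definition levy_mass : R := fine (\int[nu]_(x in D0) (1 - expR (- (r * x)))%:E).

Let finM : (\int[nu]_(x in D0) (1 - expR (- (r * x)))%:E < +oo)%E.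
Proof. by apply: le_lt_trans finW; under [leRHS]eq_integral do rewrite mul1r. Qed.

Lemma levy_coef_ge0 n : 0 <= levy_coef n.
Proof. by apply: poisson_coef_ge0 => // x /D0_gt0 /ltW. Qed.

Lemma levy_coef_cvg : cvgn (series levy_coef).
Proof. by apply: poisson_coef_cvg => // x /D0_gt0 /ltW. Qed.

Let int_exp : nu.-integrable D0 (EFin \o (fun x => 1 - expR (- (r * x)))).
Proof.
apply/integrableP; split; first exact/measurable_EFinP.
apply: le_lt_trans finM; apply: ge0_le_integral => //.
- by apply: measurableT_comp => //; exact/measurable_EFinP.
- exact/measurable_EFinP.
- by move=> x Dx; rewrite /= ger0_norm ?exp01.
Qed.

(** Common to the scalar function, with s0 = 1 and s_n = z^(n+1), and to the matrix entries, with s0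
    the Kronecker symbol and s_n = (S^(n+1))_ij. The two summands of f are integrable separately. *)
Lemma levy_integral (s0 : R) (s : nat -> R) (f : R -> R) : (forall n, 0 <= s n <= 1) ->
  (forall x, 0 < x -> f x = s0 * (expR (- (r * x)) - 1) +
     limn (series (fun n => poisson_weight (r * x) n.+1 * s n))) ->
  \int[nu]_(x in D0) f x =
    - (s0 * levy_mass) + limn (series (fun n => levy_coef n * s n)).
Proof.
move=> s01 fE.
have tau0 (x : R) : D0 x -> 0 <= x by move=> /D0_gt0 /ltW.
pose g x := limn (series (fun n => poisson_weight (r * x) n.+1 * s n)).
have mg : measurable_fun D0 g.
  by apply: (@measurable_poisson_series _ _ _ D0 id r).
have Ig : (\int[nu]_(x in D0) (g x)%:E = (limn (series (fun n => levy_coef n * s n)))%:E)%E.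
  rewrite -(@poisson_integral _ _ _ nu D0 (fun=> 1) id r)//.
  by apply: eq_integral => x _; rewrite mul1r.
have g0 x : D0 x -> 0 <= g x.
  by move=> /tau0 x0; apply: poisson_series_ge0 => //; rewrite mulr_ge0// ltW.
have ig : nu.-integrable D0 (EFin \o g).
  apply/integrableP; split; first exact/measurable_EFinP.
  rewrite (_ : (\int[nu]_(x in D0) _)%E = (\int[nu]_(x in D0) (g x)%:E)%E).
    by rewrite Ig ltry.
  by apply: eq_integral => x; rewrite inE => Dx; rewrite /= ger0_norm ?g0.
transitivity (\int[nu]_(x in D0) (- s0 * (1 - expR (- (r * x))) + g x)).
  apply: eq_Rintegral => x; rewrite inE => Dx.
  by rewrite fE ?D0_gt0//; congr (_ + _); ring.
have is0 : nu.-integrable D0 (EFin \o (fun x => - s0 * (1 - expR (- (r * x))))).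
  by move: (integrableZl mD0 (- s0) int_exp); apply: eq_integrable.
rewrite RintegralD//.
rewrite RintegralZl// mulNr; congr (_ + _).
by rewrite /Rintegral Ig.
Qed.

(** The coefficient of z^n in [bernstein_rate] minus the Bernstein function at r (1 - z). The drift
    term dbar r (1 - z) puts dbar r on z^1, and the jumps contribute from z^1 on. *)
Definition bernstein_coef (n : nat) : R :=
  if n is n'.+1 then levy_coef n' + (if n' == 0%N then dbar * r else 0) else 0.

Definition bernstein_rate : R := qbar + dbar * r + levy_mass.

Let cvg_drift (s : nat -> R) : series (fun n => (if n == 0%N then dbar * r else 0) * s n) @ \oo -->
  dbar * r * s 0%N.
Proof.
rewrite -cvg_shiftS (_ : (fun n => _) = cst (dbar * r * s 0%N)); first exact: cvg_cst.
apply/funext => N; rewrite /series/= big_nat_recl//= big1 ?addr0// => i _.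
by rewrite mul0r.
Qed.

Lemma bernstein_coef_ge0 n : 0 <= bernstein_coef n.
Proof.
have [_ d0 _] := hnu.
case: n => [|n] //=; rewrite addr_ge0 ?levy_coef_ge0//; case: ifP => // _.
by rewrite mulr_ge0// ltW.
Qed.

Let bernstein_coef_cvg_shift (s : nat -> R) : cvgn (series (fun n => levy_coef n * s n)) ->
  series (fun n => bernstein_coef n.+1 * s n) @ \oo -->
  limn (series (fun n => levy_coef n * s n)) + dbar * r * s 0%N.
Proof.
move=> cs; rewrite (_ : series _ = fun N => series (fun n => levy_coef n * s n) N +
   series (fun n => (if n == 0%N then dbar * r else 0) * s n) N).
  by apply: cvgD => //; exact: cvg_drift.
apply/funext => N; rewrite /series/= -big_split/=; apply: eq_bigr => n _.
by rewrite mulrDl.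
Qed.

Lemma bernstein_coef_cvg : cvgn (series bernstein_coef).
Proof.
have c1 : series (fun n => levy_coef n * 1) = series levy_coef.
  by congr series; apply/funext => n; rewrite mulr1.
have := @bernstein_coef_cvg_shift (fun=> 1); rewrite c1 => /(_ levy_coef_cvg) h.
have c2 : series (fun n => bernstein_coef n.+1 * 1) = series (fun n => bernstein_coef n.+1).
  by congr series; apply/funext => n; rewrite mulr1.
rewrite c2 in h; exact: cvgP (series_recl (cvgP _ h)).
Qed.

Lemma bernstein_coef_lim (s : nat -> R) : (forall n, 0 <= s n <= 1) ->
  limn (series (fun n => bernstein_coef n * s n)) =
  limn (series (fun n => levy_coef n * s n.+1)) + dbar * r * s 1%N.
Proof.
move=> s01; apply: cvg_lim => //.
have cs : cvgn (series (fun n => levy_coef n * s n.+1)).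
  by apply: (@poisson_coef_cvgM _ _ _ nu D0 (fun=> 1) id r) => // x /D0_gt0 /ltW.
have h := bernstein_coef_cvg_shift cs.
rewrite -(cvg_lim _ h)//.
by have := @series_recl _ (fun n => bernstein_coef n * s n) (cvgP _ h); rewrite mul0r add0r.
Qed.

Lemma bernstein_power_series (z : R) : 0 < z < 1 ->
  bernstein qbar dbar nu (r * (1 - z)) =
  bernstein_rate - limn (series (fun n => bernstein_coef n * z ^+ n)).
Proof.
move=> /andP[z0 z1].
have z01 n : 0 <= z ^+ n <= 1 by rewrite exprn_ge0 ?exprn_ile1 ?ltW.
rewrite bernstein_coef_lim// expr1 /bernstein (@levy_integral 1 (fun n => z ^+ n.+1))//.
  rewrite /bernstein_rate; ring.
move=> x x0; have rx : 0 <= r * x by rewrite mulr_ge0// ltW.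
have := poisson_series_recl rx z01 (@cvg_poisson_weight_pow R (r * x) z).
rewrite expr0 mulr1 mul1r (_ : - ((1 - z) * (r * x)) = - (r * (1 - z)) * x); last by ring.
by move=> ->; rewrite addrAC.
Qed.

(** Since -T = r (1 - S), this is the scalar expansion with S for z; it is checked entry by entry
    because the integral in [bernstein_mx] is entrywise. *)
Lemma bernstein_mx_power_series p (S T : 'M[R]_p) : substochastic S ->
  (forall t, t *: T = (- (r * t))%:M + (r * t) *: S) ->
  bernstein_mx qbar dbar nu (- T) = bernstein_rate%:M - mxseries bernstein_coef S.
Proof.
move=> hS hrS; apply/matrixP => i j; rewrite !mxE.
have s01 n : 0 <= (S ^+ n) i j <= 1.
  by have hn := substochasticX n hS; rewrite substochastic_le1// andbT; case: hn.
rewrite bernstein_coef_lim// expr1.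
have TE : T i j = - r *+ (i == j) + r * S i j.
  by rewrite -[T]scale1r hrS !mxE mulr1.
rewrite (@levy_integral (i == j)%:R (fun n => (S ^+ n.+1) i j))//; last first.
  move=> x x0; rewrite opprK.
  have rx : 0 <= r * x by rewrite mulr_ge0// ltW.
  have := poisson_series_recl rx s01 (@cvg_expmx_poisson _ _ r S T x i j hrS).
  by move: (expmx _) => A h; rewrite !mxE h expr0 mxE; ring.
by rewrite TE /bernstein_rate; case: (i == j); rewrite ?mulr1n ?mulr0n; ring.
Qed.
End Bernstein.

(** Off the diagonal only the series in S remains, which is nonnegative. The powers of S have row
    sums at most 1, so those of the series are at most the sum of the coefficients, which is
    [bernstein_rate] - qbar. *)
Lemma bernstein_sub_intensity {R : realType} (qbar dbar : R)
    (nu : {measure set (measurableTypeR R) -> \bar R}) p (T : 'M[R]_p) :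
  bernstein_triplet qbar dbar nu -> sub_intensity T ->
  sub_intensity (- bernstein_mx qbar dbar nu (- T)).
Proof.
move=> hnu hT; have [q0 d0 _] := hnu.
have [r [S [r0 hS hrS]]] := uniformization hT.
have b0 n := bernstein_coef_ge0 hnu r0 n.
have cb := bernstein_coef_cvg hnu r0.
have cbS (S' : 'M[R]_p) i j : substochastic S' -> cvgn (series (fun n => bernstein_coef dbar nu r n * (S' ^+ n) i j)).
  move=> hS'; apply: cvg_series_dominated cb _ => n.
  by rewrite normrM (ger0_norm (b0 n)) ler_piMr// substochasticX_norm_le1.
rewrite (bernstein_mx_power_series hnu r0 hS hrS); split=> i.
  move=> j ij; rewrite !mxE (negbTE ij) sub0r opprK.
  apply: limr_ge; first exact: cbS.
  apply: nearW => N; apply: series_ge0 => n; rewrite mulr_ge0//.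
  by have [] := substochasticX n hS.
pose bt := bernstein_rate qbar dbar nu r.
have sb : limn (series (bernstein_coef dbar nu r)) <= bt.
  have one : forall n : nat, 0 <= (1 : R) <= 1 by move=> _; rewrite ler01 lexx.
  have := @bernstein_coef_lim _ _ _ _ _ hnu r0 (fun=> 1) one.
  rewrite (_ : (fun n => bernstein_coef dbar nu r n * 1) = bernstein_coef dbar nu r); last first.
    by apply/funext => n; rewrite mulr1.
  (* With s0 = 1 and s = 1 the integrand is 0, as the weights of positive index add up to 1 - exp(-r
     x); so the sum of [levy_coef] is [levy_mass]. *)
  move=> ->; have := @levy_integral _ _ _ _ _ hnu r0 1 (fun=> 1) (fun=> 0) one.
  rewrite {1}/Rintegral integral0 mul1r => h; have {}h := h _.
  suff pf : forall x, 0 < x -> 0 = 1 * (expR (- (r * x)) - 1) +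
     limn (series (fun n : nat => poisson_weight (r * x) n.+1 * 1)).
    have /= /esym/eqP := h pf; rewrite addrC subr_eq0 => /eqP ->.
    by rewrite mulr1 /bt /bernstein_rate -addrA [levy_mass _ _ + _]addrC lerDr.
  move=> x x0; have rx : 0 <= r * x by rewrite mulr_ge0// ltW.
  have pw : series (fun n => poisson_weight (r * x) n * 1) @ \oo --> (1 : R).
    rewrite (_ : (fun n => _) = poisson_weight (r * x)); first exact: cvg_poisson_weight.
    by apply/funext => n; rewrite mulr1.
  have := poisson_series_recl rx one pw; rewrite mulr1 mul1r addrAC => <-.
  by rewrite subrr.
have sub_entry (A B : 'M[R]_p) j : (- (A - B)) i j = B i j - A i j by rewrite !mxE opprB.
under eq_bigr do rewrite sub_entry.
have e1 : \sum_j (bt%:M : 'M[R]_p) i j = bt.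
  rewrite (bigD1 i)//= mxE eqxx mulr1n big1 ?addr0// => j ji.
  by rewrite mxE eq_sym (negbTE ji).
have h : \sum_j series (fun n => bernstein_coef dbar nu r n * (S ^+ n) i j) N
    @[N --> \oo] --> \sum_j mxseries (bernstein_coef dbar nu r) S i j.
  apply: cvg_big => [|j _]; first exact: add_continuous.
  by rewrite mxE; exact: cbS.
rewrite sumrB e1 subr_le0.
apply: le_trans sb; rewrite -(cvg_lim _ h)//; apply: limr_le; first exact: cvgP h.
apply: nearW => N; apply: le_trans (series_le_lim N b0 cb).
rewrite /series/= exchange_big/=; apply: ler_sum => n _.
by rewrite -mulr_sumr ler_piMr//; have [] := substochasticX n hS.
Qed.

(** * Transfer of Laplace transforms to matrices *)

Section Transfer.
Context {R : realType} {d : measure_display} {Omega : measurableType d}.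
Variable P : probability Omega R.

(* By uniformization T = r (S - 1) with S substochastic, both sides of the
   conclusion are power series in S; putting a scalar z of (0, 1) in place of S
   gives the hypothesis at q = r (1 - z). *)
Lemma laplace_transfer (Phi : R -> R) (qbar dbar : R)
    (nu : {measure set (measurableTypeR R) -> \bar R}) q (T : 'M[R]_q.+1)
    (W D : Omega -> R) (c y M : R) i j :
  bernstein_triplet qbar dbar nu ->
  (forall q, 0 < q -> Phi q = bernstein qbar dbar nu q) ->
  sub_intensity T ->
  measurable_fun setT W -> measurable_fun setT D ->
  (forall w, 0 <= W w <= M) -> (forall w, 0 <= D w) -> 0 <= y ->
  (forall q, 0 < q ->
    (\int[P]_w (W w * expR (- (q * D w)))%:E = (c * expR (- (y * Phi q)))%:E)%E) ->
  (\int[P]_w (W w * expmx (D w *: T) i j)%:E =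
    (c * expmx (y *: - bernstein_mx qbar dbar nu (- T)) i j)%:E)%E.
Proof.
move=> hnu hPhi hT mW mD W01 D0 y0 hL.
have [r [S [r0 hS hrS]]] := uniformization hT.
have W0 w : 0 <= W w by have /andP[] := W01 w.
have tau0 w : setT w -> 0 <= D w by [].
have e01 w : 0 <= expR (- (r * D w)) <= 1.
  by rewrite expR_ge0 expR_le1 oppr_le0 mulr_ge0// ltW.
have mE : measurable_fun setT (fun w => expR (- (r * D w))).
  by apply: measurableT_comp => //; apply: measurable_funN; exact: measurable_funM.
have intW (f : Omega -> R) : measurable_fun setT f -> (forall w, 0 <= f w <= 1) ->
    (\int[P]_w (W w * f w)%:E < +oo)%E.
  move=> mf f01; apply: (@le_lt_trans _ _ (\int[P]_w (cst M%:E w))%E).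
    apply: ge0_le_integral => //.
    - by move=> w _; rewrite lee_fin mulr_ge0//; have /andP[] := f01 w.
    - by apply/measurable_EFinP; exact: measurable_funM.
    - move=> w _; have /andP[f0 f1] := f01 w; have /andP[_ WM] := W01 w.
      by rewrite lee_fin; apply: le_trans WM; rewrite ler_piMr.
  by rewrite integral_cst//= [X in (_ * X)%E]probability_setT mule1 ltry.
have finW : (\int[P]_w (W w * (1 - expR (- (r * D w))))%:E < +oo)%E.
  apply: intW; first exact: measurable_funB.
  by move=> w; have /andP[e0 e1] := e01 w; rewrite subr_ge0 e1/= lerBlDr lerDl.
(* The coefficient of z^n in the expectation of W exp(-r (1 - z) D). Index 0 stands apart because
   [poisson_coef] starts at the weight of index 1. *)
pose a n := if n is n'.+1 then poisson_coef P setT W D r n' else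
  fine (\int[P]_w (W w * expR (- (r * D w)))%:E).
have a0 n : 0 <= a n.
  case: n => [|n] /=; last exact: poisson_coef_ge0.
  by apply: fine_ge0; apply: integral_ge0 => w _; rewrite lee_fin mulr_ge0// expR_ge0.
have ca : cvgn (series a).
  by apply: cvgP; apply: series_recl; exact: (@poisson_coef_cvg _ _ _ P setT W D r).
have key (s : nat -> R) (f : Omega -> R) : (forall n, 0 <= s n <= 1) ->
    (forall w, series (fun n => poisson_weight (r * D w) n * s n) @ \oo --> f w) ->
    (\int[P]_w (W w * f w)%:E = (limn (series (fun n => a n * s n)))%:E)%E.
  move=> s01 hf.
  have cs : cvgn (series (fun n => a n.+1 * s n.+1)).
    by apply: (@poisson_coef_cvgM _ _ _ P setT W D r) => // n; exact: s01.
  rewrite (cvg_lim _ (series_recl cs))// EFinD.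
  rewrite -(@poisson_integral _ _ _ P setT W D r _ _ _ _ _ _ _ (fun n => s n.+1))//.
  have -> : (a 0%N * s 0%N)%:E = (\int[P]_w ((W w * (expR (- (r * D w)) * s 0%N))%:E))%E.
    rewrite EFinM /a fineK; last first.
      rewrite ge0_fin_numE; first exact: intW.
      by apply: integral_ge0 => w _; rewrite lee_fin mulr_ge0// expR_ge0.
    rewrite -ge0_integralZr//.
    - by apply: eq_integral => w _; rewrite -EFinM mulrA.
    - by apply/measurable_EFinP; exact: measurable_funM.
    - by move=> w _; rewrite lee_fin mulr_ge0// expR_ge0.
    - by rewrite lee_fin; have /andP[] := s01 0%N.
  have s00 : 0 <= s 0%N by have /andP[] := s01 0%N.
  rewrite -ge0_integralD//.
  - apply: eq_integral => w _; rewrite -EFinD -mulrDr.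
    have rD : 0 <= r * D w by rewrite mulr_ge0// ltW.
    by rewrite (poisson_series_recl rD s01 (hf w)).
  - by move=> w _; rewrite lee_fin !mulr_ge0// expR_ge0.
  - by apply/measurable_EFinP; do 2![apply: measurable_funM => //].
  - move=> w _; rewrite lee_fin mulr_ge0//; apply: poisson_series_ge0 => //.
    by rewrite mulr_ge0// ltW.
  - apply/measurable_EFinP; apply: measurable_funM => //.
    exact: (@measurable_poisson_series _ _ _ setT D r).
have S1 n k l := substochasticX_norm_le1 n k l hS.
have Sn01 n : 0 <= (S ^+ n) i j <= 1.
  by have hn := substochasticX n hS; rewrite substochastic_le1// andbT; case: hn.
pose bt := bernstein_rate qbar dbar nu r.
(* -y Phi(r (1 - z)) = -y bt + y sum_n b_n z^n: the constant part goes into the prefactor, the rest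
   is y times a series with nonnegative coefficients. *)
have := @mxseries_exp _ a (bernstein_coef dbar nu r) y (c * expR (- (y * bt))) _ S
  (fun n => bernstein_coef_ge0 hnu r0 n) (bernstein_coef_cvg hnu r0) y0 a0 ca _ S1.
have h1 z : 0 < z < 1 -> limn (series (fun n => a n * z ^+ n)) =
   c * expR (- (y * bt)) * expR (y * limn (series (fun n => bernstein_coef dbar nu r n * z ^+ n))).
  move=> z01; have [z0 z1] := andP z01.
  have zn n : 0 <= z ^+ n <= 1 by rewrite exprn_ge0 ?exprn_ile1 ?ltW.
  have q0 : 0 < r * (1 - z) by rewrite mulr_gt0// subr_gt0.
  have := hL _ q0; rewrite hPhi// (bernstein_power_series hnu r0 z01).
  rewrite (_ : (\int[P]_w _)%E = (\int[P]_w (W w * expR (- ((1 - z) * (r * D w))))%:E)%E); last first.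
    by apply: eq_integral => w _; congr (_ * expR _)%:E; ring.
  rewrite (key (fun n => z ^+ n))//; last by move=> w; exact: cvg_poisson_weight_pow.
  by move=> [->]; rewrite -mulrA -expRD; congr (_ * expR _); rewrite /bt; ring.
move=> /(_ h1) /matrixP/(_ i j).
rewrite (key (fun n => (S ^+ n) i j))//; last by move=> w; exact: cvg_expmx_poisson.
rewrite [LHS]mxE => ->; congr EFin; rewrite (bernstein_mx_power_series hnu r0 hS hrS).
rewrite (_ : y *: - _ = (- (y * bt))%:M + y *: mxseries (bernstein_coef dbar nu r) S); last first.
  by rewrite opprB addrC scalerDr scalerN scale_scalar_mx raddfN.
by rewrite expmx_scalarD !mxE mulrA.
Qed.

End Transfer.

(** * Exponential martingales on a time grid *)

Section Independence.
Local Open Scope ereal_scope.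
Context {R : realType}.

Lemma measure_eq_rectangles d1 d2 (T1 : measurableType d1) (T2 : measurableType d2)
    (m1 m2 : {measure set (T1 * T2) -> \bar R}) :
  m1 setT < +oo ->
  (forall A B, measurable A -> measurable B -> m1 (A `*` B) = m2 (A `*` B)) ->
  forall C, measurable C -> m1 C = m2 C.
Proof.
move=> fin1 m12 C mC.
pose G : set (set (T1 * T2)) :=
  [set C | exists A, measurable A /\ exists B, measurable B /\ C = A `*` B].
apply: (measure_unique G (fun=> setT)) => //.
- rewrite measurable_prod_measurableType //; congr (<<s _ >>).
  rewrite predeqE; split => [[A mA [B mB <-]]|[A [mA [B [mB ->]]]]].
    by exists A; split => //; exists B.
  by exists A => //; exists B.
- move=> /= _ _ [X1 [mX1 [X2 [mX2 ->]]]] [Y1 [mY1 [Y2 [mY2 ->]]]].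
  rewrite -setXI; exists (X1 `&` Y1); split; first exact: measurableI.
  by exists (X2 `&` Y2); split => //; exact: measurableI.
- move=> _; exists setT; split => //; exists setT; split => //.
  by rewrite setXTT.
- by rewrite bigcup_const.
- by move=> _ [A [mA [B [mB ->]]]]; exact: m12.
Qed.

Context d {Omega : measurableType d} (P : probability Omega R).

(** Both sides are finite measures in [C], so the product formula passes from rectangles to all
    events about the pair. *)
Lemma independent_pair_event d1 (S : measurableType d1) (Z : Omega -> S)
    (D : Omega -> R) (F : set Omega) :
  measurable_fun setT Z -> measurable_fun setT D -> measurable F ->
  (forall A B, measurable A -> measurable B ->
    P (Z @^-1` A `&` D @^-1` B `&` F) = P (Z @^-1` A `&` D @^-1` B) * P F) ->
  forall C, measurable C ->
    P ((fun w => (Z w, D w)) @^-1` C `&` F) = P ((fun w => (Z w, D w)) @^-1` C) * P F.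
Proof.
move=> mZ mD mF h.
have mZD : measurable_fun setT (fun w => (Z w, D w)).
  by apply: measurable_fun_pair.
pose ZD : {mfun Omega >-> (S * R)%type} :=
  HB.pack (fun w => (Z w, D w)) (isMeasurableFun.Build _ _ _ _ _ mZD).
have c0 : (0 <= fine (P F))%R by rewrite fine_ge0.
pose m1 : {measure set (S * R)%type -> \bar R} := pushforward (mrestr P mF) ZD.
pose m2 := mscale (NngNum c0) (distribution P ZD).
have PF : P F = (fine (P F))%:E by rewrite fineK// fin_num_measure.
have m2E C' : m2 C' = P ((fun w => (Z w, D w)) @^-1` C') * P F.
  have -> : m2 C' = (fine (P F))%:E * P ((fun w => (Z w, D w)) @^-1` C') by [].
  by rewrite -PF muleC.
move=> C mC.
have -> : P ((fun w => (Z w, D w)) @^-1` C `&` F) = m1 mZD C by [].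
rewrite (@measure_eq_rectangles _ _ _ _ (m1 mZD) m2)//.
- have -> : m1 mZD setT = P (setT `&` F) by [].
  by rewrite setTI PF ltry.
- by move=> A B mA mB; exact: etrans (h _ _ mA mB) (esym (m2E _)).
Qed.

Lemma independent_integral d1 (S : measurableType d1) (Z : Omega -> S)
    (D : Omega -> R) (f : S * R -> \bar R) :
  measurable_fun setT Z -> measurable_fun setT D ->
  (forall A B, measurable A -> measurable B ->
    P (Z @^-1` A `&` D @^-1` B) = P (Z @^-1` A) * P (D @^-1` B)) ->
  measurable_fun setT f -> (forall x, 0 <= f x) ->
  \int[P]_w f (Z w, D w) = \int[P]_w \int[P]_w' f (Z w, D w').
Proof.
move=> mZ mD h mf f0.
have mZD : measurable_fun setT (fun w => (Z w, D w)).
  by apply: measurable_fun_pair.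
pose ZD : {mfun Omega >-> (S * R)%type} :=
  HB.pack (fun w => (Z w, D w)) (isMeasurableFun.Build _ _ _ _ _ mZD).
pose Zm : {mfun Omega >-> S} := HB.pack Z (isMeasurableFun.Build _ _ _ _ _ mZ).
pose Dm : {mfun Omega >-> R} := HB.pack D (isMeasurableFun.Build _ _ _ _ _ mD).
transitivity (\int[distribution P ZD]_x f x).
  by rewrite ge0_integral_distribution.
transitivity (\int[distribution P Zm \x distribution P Dm]_x f x).
  apply: eq_measure_integral => A mA _; apply/esym.
  by apply: product_measure_unique => // B C mB mC; exact: h.
rewrite fubini_tonelli1// /fubini_F ge0_integral_distribution//; last 2 first.
- exact: measurable_fun_fubini_tonelli_F.
- by move=> z; exact: integral_ge0.
apply: eq_integral => w _ /=; rewrite ge0_integral_distribution//.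
exact: measurableT_comp.
Qed.

(** * Recursions driven by independent increments *)

Section StateProcess.
Variables (D : nat -> Omega -> R).
Hypothesis mD : forall k, measurable_fun setT (D k).
Hypothesis indD : forall N n (B : nat -> set R), (forall k, measurable (B k)) ->
  P (\bigcap_(k in `I_n) [set w | B k (D (N + k)%N w)]) =
  \prod_(k < n) P [set w | B k (D (N + k)%N w)].
Context d1 (S : measurableType d1) (phi : S * R -> S) (s0 : S).
Hypothesis mphi : measurable_fun setT phi.

Fixpoint state N w : S := if N is N'.+1 then phi (state N' w, D N' w) else s0.

Lemma measurable_state N : measurable_fun setT (state N).
Proof.
elim: N => [|N IH] /=; first exact: measurable_cst.
by apply: (measurableT_comp mphi); apply: measurable_fun_pair.
Qed.

Let fut N n (B : nat -> set R) := \bigcap_(k in `I_n) [set w | B k (D (N + k)%N w)].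

Let measurable_preim (k : nat) (B : set R) : measurable B -> measurable [set w | B (D k w)].
Proof. by move=> mB; rewrite -[X in measurable X]setTI; exact: mD. Qed.

Let mfut N n B : (forall k, measurable (B k)) -> measurable (fut N n B).
Proof.
move=> mB; by apply: bigcap_measurableType => k _; exact: measurable_preim.
Qed.

Let futS N n B : fut N n.+1 B = [set w | B 0%N (D N w)] `&` fut N.+1 n (fun k => B k.+1).
Proof.
apply/seteqP; split=> w.
  move=> h; split; first by have := h 0%N isT; rewrite /= addn0.
  by move=> k kn; have := h k.+1 kn; rewrite /= addnS.
move=> [h0 h] [_|k kn]; first by rewrite /= addn0.
by have := h k kn; rewrite /= addnS.
Qed.

(** Induction on N for all n at once: the state at N + 1 is a function of the state at N and of
    [D N], and an event about [D N] counts as the first factor of a future of length n + 1 for the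
    induction hypothesis. *)
Lemma state_independent_future N n B A : (forall k, measurable (B k)) -> measurable A ->
  P (state N @^-1` A `&` fut N n B) = P (state N @^-1` A) * P (fut N n B).
Proof.
elim: N n B A => [|N IH] n B A mB mA.
  have [As|nAs] := pselect (A s0).
    have -> : state 0 @^-1` A = setT by apply/seteqP; split.
    by rewrite setTI probability_setT mul1e.
  have -> : state 0 @^-1` A = set0 by apply/seteqP; split.
  by rewrite set0I measure0 mul0e.
have -> : state N.+1 @^-1` A = (fun w => (state N w, D N w)) @^-1` (phi @^-1` A) by [].
apply: independent_pair_event => //.
- exact: measurable_state.
- exact: mfut.
- move=> A' B0 mA' mB0.
  pose B' k := if k is k'.+1 then B k' else B0.
  have mB' k : measurable (B' k) by case: k.
  have futB : fut N n.+1 B' = [set w | B0 (D N w)] `&` fut N.+1 n B by rewrite futS.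
  have fut1 : fut N 1 B' = [set w | B0 (D N w)].
    by rewrite futS /fut II0 bigcap_set0 setIT.
  have h1 := IH 1%N B' A' mB' mA'; rewrite fut1 in h1.
  have h2 := IH n.+1 B' A' mB' mA'; rewrite futB setIA in h2.
  rewrite h1 h2 -muleA; congr (_ * _).
  rewrite -futB /fut indD// big_ord_recl/= addn0; congr (_ * _).
  by rewrite indD//; apply: eq_bigr => k _; rewrite /bump /= add1n addnS.
- by rewrite -[X in measurable X]setTI; exact: mphi.
Qed.

Lemma state_integral N (f : S * R -> \bar R) :
  measurable_fun setT f -> (forall x, 0 <= f x) ->
  \int[P]_w f (state N w, D N w) = \int[P]_w \int[P]_w' f (state N w, D N w').
Proof.
move=> mf f0; apply: independent_integral => //; first exact: measurable_state.
move=> A B mA mB; have := @state_independent_future N 1 (fun=> B) A (fun=> mB) mA.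
by rewrite futS /fut II0 bigcap_set0 setIT.
Qed.

End StateProcess.

Section PredictableExponential.
Variables (D : nat -> Omega -> R).
Hypothesis mD : forall k, measurable_fun setT (D k).
Hypothesis indD : forall N n (B : nat -> set R), (forall k, measurable (B k)) ->
  P (\bigcap_(k in `I_n) [set w | B k (D (N + k)%N w)]) =
  \prod_(k < n) P [set w | B k (D (N + k)%N w)].
Variables (vt kappa : R -> R).
Hypotheses (mvt : measurable_fun setT vt) (mkappa : measurable_fun setT kappa).
Hypothesis int1 : forall N r, \int[P]_w (expR (vt r * D N w - kappa r))%:E = 1.

Definition walk N w : R := (\sum_(0 <= k < N) D k w)%R.
Fixpoint running_max N w : R :=
  if N is N'.+1 then Num.max (running_max N' w) (walk N'.+1 w) else 0%R.
(** Tilt and compensator of the k-th increment are read at the running maximum up to time k, which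
    is known before that increment. *)
Definition predictable_exponent N w : R :=
  (\sum_(0 <= k < N) (vt (running_max k w) * D k w - kappa (running_max k w)))%R.

(** One step of the triple (walk, running maximum, exponent), which is a function of the triple and
    the next increment. *)
Let phi (z : (R * R * R) * R) : R * R * R :=
  ((z.1.1.1 + z.2, Num.max z.1.1.2 (z.1.1.1 + z.2)),
   z.1.2 + (vt z.1.1.2 * z.2 - kappa z.1.1.2))%R.

Let m11 : measurable_fun setT (fun z : (R * R * R) * R => z.1.1.1).
Proof. by do 2![apply: measurableT_comp => //]. Qed.
Let m12 : measurable_fun setT (fun z : (R * R * R) * R => z.1.1.2).
Proof. by do 2![apply: measurableT_comp => //]. Qed.
Let m1 : measurable_fun setT (fun z : (R * R * R) * R => z.1.2).
Proof. by apply: measurableT_comp => //. Qed.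
Let m2 : measurable_fun setT (fun z : (R * R * R) * R => z.2).
Proof. exact: measurable_snd. Qed.

Let mincr : measurable_fun setT (fun z : (R * R * R) * R =>
  z.1.2 + (vt z.1.1.2 * z.2 - kappa z.1.1.2))%R.
Proof.
apply: measurable_funD => //; apply: measurable_funB; last exact: measurableT_comp.
by apply: measurable_funM => //; exact: measurableT_comp.
Qed.

Let mphi : measurable_fun setT phi.
Proof.
apply: measurable_fun_pair => //; apply: measurable_fun_pair.
  exact: measurable_funD.
by apply: measurable_maxr => //; exact: measurable_funD.
Qed.

Let stateE N w : state D phi (0, 0, 0)%R N w =
  ((walk N w, running_max N w), predictable_exponent N w).
Proof.
elim: N => [|N IH]; first by rewrite /= /walk /predictable_exponent !big_nil.
rewrite /= IH /phi/=; congr (_, _, _).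
- by rewrite /walk big_nat_recr.
- by rewrite /walk big_nat_recr.
- by rewrite /predictable_exponent big_nat_recr.
Qed.

(** The last increment is integrated out first: it is independent of the state, and its factor has
    mean 1 by [int1] whatever the value of the running maximum. *)
Lemma predictable_exponential N : \int[P]_w (expR (predictable_exponent N w))%:E = 1.
Proof.
elim: N => [|N IH].
  rewrite (eq_integral (cst 1)); last first.
    by move=> w _; rewrite /predictable_exponent big_nil expR0.
  by rewrite integral_cst//= probability_setT mule1.
pose f (z : (R * R * R) * R) : \bar R :=
  (expR (z.1.2 + (vt z.1.1.2 * z.2 - kappa z.1.1.2)))%:E.
have mf : measurable_fun setT f.
  by apply/measurable_EFinP; apply: measurableT_comp.
have f0 z : 0 <= f z by rewrite lee_fin expR_ge0.
transitivity (\int[P]_w f (state D phi (0, 0, 0)%R N w, D N w)).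
  apply: eq_integral => w _; rewrite stateE /f /=.
  by rewrite /predictable_exponent big_nat_recr.
rewrite (@state_integral D mD indD _ (R * R * R)%type phi (0, 0, 0)%R mphi)//; rewrite -IH; apply: eq_integral => w _.
rewrite stateE /f/=; under eq_integral do rewrite expRD EFinM.
rewrite ge0_integralZl//; first by rewrite int1 mule1.
- apply/measurable_EFinP; apply: measurableT_comp => //; apply: measurable_funB => //.
  exact: measurable_funM.
Qed.

End PredictableExponential.
End Independence.

(** * Hits of levels on a time grid *)

Section Grid.
Context {R : realType}.
Implicit Types (f : R -> R) (v N k m : nat) (x : R).

Definition grid v k : R := k%:R / v.+1%:R.

Lemma grid0 v : grid v 0 = 0. Proof. by rewrite /grid mul0r. Qed.

Lemma grid_ge0 v k : 0 <= grid v k. Proof. by rewrite divr_ge0. Qed.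

Lemma le_grid v k l : (k <= l)%N -> grid v k <= grid v l.
Proof. by move=> kl; rewrite ler_pM2r ?ler_nat// invr_gt0. Qed.

Lemma gridS v k : grid v k.+1 - grid v k = v.+1%:R^-1.
Proof. by rewrite /grid -mulrBl -natrB ?leqnSn// subSnn mul1r. Qed.

(* Equal to N when no grid point of index below N exceeds the level. *)
Definition hit f v N x : nat := find (fun k => x < f (grid v k)) (iota 0 N).

Lemma hit_le f v N x : (hit f v N x <= N)%N.
Proof. by rewrite /hit -{2}(size_iota 0 N) find_size. Qed.

Lemma hit_gt f v N x : (hit f v N x < N)%N -> x < f (grid v (hit f v N x)).
Proof.
move=> hN; have : has (fun k => x < f (grid v k)) (iota 0 N).
  by rewrite has_find size_iota.
by move=> /(nth_find 0%N); rewrite nth_iota// add0n.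
Qed.

Lemma before_hit f v N x k : (k < hit f v N x)%N -> f (grid v k) <= x.
Proof.
move=> kh; have kN := leq_trans kh (hit_le f v N x).
by have /negbT := before_find 0%N kh; rewrite nth_iota// add0n -leNgt.
Qed.

Lemma le_hit f v N x k : (k <= N)%N -> (forall i, (i < k)%N -> f (grid v i) <= x) ->
  (k <= hit f v N x)%N.
Proof.
move=> kN h; rewrite leqNgt; apply/negP => hk.
have hN := leq_trans hk kN.
by have := h _ hk; rewrite leNgt hit_gt.
Qed.

Lemma hit_le_index f v N x k : (k < N)%N -> x < f (grid v k) -> (hit f v N x <= k)%N.
Proof.
by move=> kN xk; rewrite leqNgt; apply/negP => /before_hit; rewrite leNgt xk.
Qed.

Lemma hit_mono f v N x y : x <= y -> (hit f v N x <= hit f v N y)%N.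
Proof.
by move=> xy; apply: le_hit; [exact: hit_le|move=> i /before_hit ix; exact: le_trans xy].
Qed.

Lemma sum_lt_telescope (a : nat -> R) s N : (s <= N)%N ->
  \sum_(0 <= j < N) (j < s)%N%:R * (a j.+1 - a j) = a s - a 0%N.
Proof.
move=> sN; rewrite (big_cat_nat (n := s))//=.
have -> : \sum_(s <= j < N) (j < s)%N%:R * (a j.+1 - a j) = 0.
  by rewrite big_nat_cond big1// => j /andP[/andP[sj _] _]; rewrite ltnNge sj mul0r.
rewrite addr0 -telescope_sumr//; apply: eq_big_nat => j /andP[_ ->].
by rewrite mul1r.
Qed.

(** Indices are shifted: m stands for the level x (m - 1), and 0 for a level passed from the start,
    so that gap m lies between the indices m and m + 1. [hit_level] follows the same shift. *)
Definition below (x : nat -> R) m (r : R) : R :=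
  if m is m'.+1 then (r <= x m')%R%:R else 0.

Definition hit_level f v N (x : nat -> R) m : nat :=
  if m is m'.+1 then hit f v N (x m') else 0%N.

Lemma hit_level_le f v N (x : nat -> R) m : (hit_level f v N x m <= N)%N.
Proof. by case: m => //= m; exact: hit_le. Qed.

(* Equal to u m as long as a running maximum r has exceeded x 0, ..., x (m - 1)
   but not x m, and to 0 once r has exceeded x (n - 1). *)
Definition level_weight n (x u : nat -> R) (r : R) : R :=
  \sum_(m < n) u m * (below x m.+1 r - below x m r).

Lemma level_weightP n (x : nat -> R) r : (forall k, x k <= x k.+1) ->
  (exists m, forall u, level_weight n x u r = u m) \/
  (forall u, level_weight n x u r = 0).
Proof.
move=> xS; have xmono k l : (k <= l)%N -> x k <= x l by move: k l; apply/nondecreasing_seqP.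
elim: n => [|n IH]; first by right => u; rewrite /level_weight big_ord0.
have [rn|rn] := eqVneq (below x n r) 0; last first.
  have e : below x n.+1 r - below x n r = 0.
    case: n rn {IH} => [|n] /=; first by rewrite eqxx.
    by case: (leP r (x n)) => [rx _|_]; rewrite ?eqxx// (le_trans rx (xS _)) subrr.
  have E u : level_weight n.+1 x u r = level_weight n x u r.
    by rewrite /level_weight big_ord_recr/= e mulr0 addr0.
  by case: IH => [[m h]|h]; [left; exists m|right] => u; rewrite E.
have b0 m : (m <= n)%N -> below x m r = 0.
  case: m => //= m mn; case: n rn mn {IH} => //= n.
  case: (leP r (x n)) => [_ /eqP|xr _ mn]; first by rewrite oner_eq0.
  by rewrite leNgt (le_lt_trans (xmono _ _ (mn : (m <= n)%N)) xr).
have E u : level_weight n.+1 x u r = u n * below x n.+1 r.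
  rewrite /level_weight big_ord_recr/= rn subr0 big1 ?add0r// => m _.
  by rewrite -[(r <= x m)%R%:R]/(below x m.+1 r) !b0 ?(ltnW (ltn_ord m))// subrr mulr0.
case: (leP r (x n)) => rx; [left; exists n|right] => u; rewrite E /= ?rx ?mulr1//.
by rewrite leNgt rx mulr0.
Qed.

Lemma measurable_level_weight n (x u : nat -> R) : measurable_fun setT (level_weight n x u).
Proof.
have mb m : measurable_fun setT (below x m).
  case: m => [|m] /=; first exact: measurable_cst.
  rewrite (_ : below x m.+1 = \1_(`]-oo, x m]%classic)).
    by apply: measurable_indic; exact: measurable_itv.
  by apply/funext => r; rewrite indicE /= mem_setE in_itv.
rewrite (_ : level_weight n x u = fun r => \sum_(m <- index_enum 'I_n)
    u m * (below x m.+1 r - below x m r)); last by [].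
apply: measurable_sum => m; apply: measurable_funM => //.
exact: measurable_funB.
Qed.

(** Translates weights that depend on the running maximum into indicators of times before a hit. *)
Lemma running_max_leE d (T : measurableType d) (D : nat -> T -> R) f v N x j w :
  (forall k, walk D k w = f (grid v k)) -> (j < N)%N ->
  (running_max D j w <= x) = (j < hit f v N x)%N.
Proof.
move=> wf jN; have -> : (running_max D j w <= x) = [forall i : 'I_j.+1, f (grid v i) <= x].
  elim: j {jN} => [|j IH].
    have -> : running_max D 0 w = f (grid v 0) by rewrite -wf /walk big_nil.
    apply/idP/forallP => [h i|/(_ ord0)//]; by rewrite ord1.
  rewrite /= ge_max IH wf; apply/andP/forallP => [[/forallP h1 h2] i|h].
    have [ij|] := ltnP i j.+1; first exact: (h1 (Ordinal ij)).
    by move=> ji; rewrite (_ : nat_of_ord i = j.+1)//; apply/eqP; rewrite eqn_leq ji -ltnS ltn_ord.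
  split; last exact: (h ord_max).
  by apply/forallP => i; exact: (h (widen_ord (leqnSn _) i)).
apply/forallP/idP => [h|jh i].
  by apply: le_hit => // i ij; exact: (h (Ordinal ij)).
by apply: (@before_hit _ _ N); apply: leq_ltn_trans jh; rewrite -ltnS.
Qed.

(** The weight [th m] is active exactly on the steps between the hits of indices m and m + 1, over
    which the increments telescope. *)
Lemma predictable_exponent_levels d (T : measurableType d) (D : nat -> T -> R) f v N n (x th q : nat -> R) w :
  (forall k, walk D k w = f (grid v k)) ->
  (forall k, D k w = f (grid v k.+1) - f (grid v k)) ->
  predictable_exponent D (level_weight n x th)
      (fun r => level_weight n x q r / v.+1%:R) N w =
  \sum_(m < n) (th m * (f (grid v (hit_level f v N x m.+1)) - f (grid v (hit_level f v N x m)))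
    - q m * (grid v (hit_level f v N x m.+1) - grid v (hit_level f v N x m))).
Proof.
move=> wf Df.
have bE m j : (j < N)%N -> below x m (running_max D j w) = (j < hit_level f v N x m)%N%:R.
  by case: m => [|m] //= jN; rewrite (running_max_leE (x m) wf jN).
transitivity (\sum_(0 <= j < N) \sum_(m < n)
    (th m * (((j < hit_level f v N x m.+1)%N%:R - (j < hit_level f v N x m)%N%:R) *
       (f (grid v j.+1) - f (grid v j)))
     - q m * (((j < hit_level f v N x m.+1)%N%:R - (j < hit_level f v N x m)%N%:R) *
       (grid v j.+1 - grid v j)))).
  apply: eq_big_nat => j /andP[_ jN].
  rewrite /level_weight !mulr_suml -sumrB; apply: eq_bigr => m _.
  by rewrite !bE// Df gridS; ring.
rewrite exchange_big/=; apply: eq_bigr => m _.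
have tel (a : nat -> R) k l : (k <= N)%N -> (l <= N)%N ->
    \sum_(0 <= j < N) (((j < k)%N%:R - (j < l)%N%:R) * (a j.+1 - a j)) = a k - a l.
  move=> kN lN; under eq_bigr do rewrite mulrBl.
  by rewrite sumrB !sum_lt_telescope//; ring.
rewrite sumrB -!mulr_sumr (tel (fun j => f (grid v j))) ?(tel (grid v))
  ?hit_le ?hit_level_le//.
Qed.

End Grid.

(** * The exponential martingale of the Lévy process on the grid *)

Section LevyMartingale.
Context {R : realType} {d : measure_display} {Omega : measurableType d}.
Variables (P : probability Omega R) (X : R -> Omega -> R) (psi : R -> R).
Hypotheses (hX : levy_process P X) (hpsi : laplace_exponent P X psi).

Let mX t : 0 <= t -> measurable_fun setT (X t). Proof. by case: hX => h _ _ _ _; exact: h. Qed.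

Let mincr s t : 0 <= s -> 0 <= t -> measurable_fun setT (fun w => X t w - X s w).
Proof. by move=> s0 t0; apply: measurable_funB; exact: mX. Qed.

Lemma laplace_increment s t theta : 0 <= s -> 0 <= t -> 0 <= theta ->
  (\int[P]_w (expR (theta * (X (s + t) w - X s w)))%:E = (expR (psi theta * t))%:E)%E.
Proof.
move=> s0 t0 th0; have := hpsi th0 t0; rewrite unlock => <-.
have st0 : 0 <= s + t by exact: addr_ge0.
pose Y : {mfun Omega >-> R} := HB.pack (fun w => X (s + t) w - X s w)
  (isMeasurableFun.Build _ _ _ _ _ (mincr s0 st0)).
pose Z : {mfun Omega >-> R} := HB.pack (X t)
  (isMeasurableFun.Build _ _ _ _ _ (mX t0)).
have mg : measurable_fun setT (fun y : R => (expR (theta * y))%:E).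
  by apply/measurable_EFinP; apply: measurableT_comp.
have g0 (y : R) : (0 <= (expR (theta * y))%:E)%E by rewrite lee_fin expR_ge0.
transitivity (\int[distribution P Y]_y (expR (theta * y))%:E)%E.
  by rewrite ge0_integral_distribution.
transitivity (\int[distribution P Z]_y (expR (theta * y))%:E)%E; last first.
  by rewrite ge0_integral_distribution.
apply: eq_measure_integral => A mA _.
by have [_ _ _ st _] := hX; exact: st.
Qed.

(** Optional stopping without a stopping theorem: the stopped exponent is a sum over all N steps
    with predictable weights that vanish after the last hit. *)
Lemma discrete_exponential_martingale v N n (x th : nat -> R) :
  (forall k, x k <= x k.+1) -> (forall k, 0 <= th k) ->
  (\int[P]_w (expR (\sum_(m < n)
     (th m * (X (grid v (hit_level (X^~ w) v N x m.+1)) w - X (grid v (hit_level (X^~ w) v N x m)) w)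
      - psi (th m) * (grid v (hit_level (X^~ w) v N x m.+1) - grid v (hit_level (X^~ w) v N x m)))))%:E = 1)%E.
Proof.
move=> xS th0; have [_ X0 ind _ _] := hX.
pose D k w := X (grid v k.+1) w - X (grid v k) w.
have mD k : measurable_fun setT (D k) by apply: mincr; exact: grid_ge0.
have walkE k w : walk D k w = X (grid v k) w.
  by rewrite /walk telescope_sumr// grid0 X0 subr0.
transitivity (\int[P]_w (expR (predictable_exponent D (level_weight n x th)
   (fun r => level_weight n x (psi \o th) r / v.+1%:R) N w))%:E)%E.
  apply: eq_integral => w _.
  by rewrite (@predictable_exponent_levels _ _ _ D (X^~ w)).
apply: predictable_exponential => //.
- move=> M k B mB; pose t l := grid v (M + l) : R.
  have DE l w : D (M + l)%N w = X (t l.+1) w - X (t l) w by rewrite /t addnS.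
  rewrite (_ : (fun l => [set w | B l (D (M + l)%N w)]) =
      (fun l => [set w | B l (X (t l.+1) w - X (t l) w)])); last first.
    by apply/funext => l; apply/seteqP; split=> w /=; rewrite DE.
  rewrite ind//; last by move=> l; apply: le_grid; rewrite leq_add2l.
    apply: eq_bigr => l _; congr (P _).
    by apply/seteqP; split=> w /=; rewrite DE.
  exact: grid_ge0.
- exact: measurable_level_weight.
- by apply: measurable_funM => //; exact: measurable_level_weight.
(* For a fixed value r, either a single tilt [th m] is active, with compensator psi(th m) times the
   step length, or none, and the factor is then 1. *)
- move=> M r; case: (level_weightP n r xS) => [[m h]|h].
    under eq_integral => w _ do rewrite !h expRD EFinM.
    rewrite ge0_integralZr//.
    + have gS : grid v M.+1 = grid v M + v.+1%:R^-1 :> R.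
        by apply/eqP; rewrite addrC -subr_eq gridS.
      rewrite /D gS laplace_increment ?grid_ge0 ?invr_ge0//.
      by rewrite -EFinM -expRD subrr expR0.
    + by apply/measurable_EFinP; apply: measurableT_comp => //; exact: measurable_funM.
  rewrite (eq_integral (cst 1%E)); last first.
    by move=> w _; rewrite !h !mul0r subrr expR0.
  by rewrite integral_cst//= [X in (_ * X)%E]probability_setT mule1.
Qed.

End LevyMartingale.

(** * First passage times *)

Section Paths.
Context {R : realType}.
Variable f : R -> R.
Hypothesis f_right : forall t : R, 0 <= t -> f s @[s --> t^'+] --> f t.

(** What [first_passage] unfolds to along a single path. *)
Definition passage_time (x : R) : \bar R :=
  ereal_inf [set t%:E | t in [set t : R | 0 <= t /\ x < f t]].

Lemma passage_time_ge0 x : (0 <= passage_time x)%E.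
Proof. by apply: le_ereal_inf_tmp => _ [t [t0 _] <-]; rewrite lee_fin. Qed.

Lemma passage_time_le x t : 0 <= t -> x < f t -> (passage_time x <= t%:E)%E.
Proof. by move=> t0 xt; apply: ereal_inf_lbound; exists t. Qed.

Lemma before_passage x t : 0 <= t -> (t%:E < passage_time x)%E -> f t <= x.
Proof.
move=> t0 tx; rewrite leNgt; apply/negP => xt.
by have := lt_le_trans tx (passage_time_le t0 xt); rewrite ltxx.
Qed.

Lemma passage_time_mono x y : x <= y -> (passage_time x <= passage_time y)%E.
Proof.
move=> xy; apply: le_ereal_inf_tmp => _ [t [t0 yt] <-].
by apply: passage_time_le => //; exact: le_lt_trans yt.
Qed.

Lemma passage_time_approx x (t0 e : R) : passage_time x = t0%:E -> 0 < e ->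
  exists t, [/\ t0 <= t, t < t0 + e & x < f t].
Proof.
move=> xt0 e0; have : (passage_time x < (t0 + e)%:E)%E by rewrite xt0 lte_fin ltrDl.
move=> /ereal_inf_lt [_ [t [t0' xt] <-]]; rewrite lte_fin => te.
by exists t; split => //; rewrite -lee_fin -xt0 passage_time_le.
Qed.

Lemma right_gt x t : 0 <= t -> x < f t ->
  exists2 e : R, 0 < e & forall s, t <= s -> s < t + e -> x < f s.
Proof.
move=> t0 xt; have /cvgr_gt/(_ _ xt) := f_right t0.
move=> [e /= e0 he]; exists e => // s ts se.
have [->//|st] := eqVneq s t.
apply: he => /=; last by rewrite lt_neqAle eq_sym st.
by rewrite distrC ger0_norm ?subr_ge0// ltrBlDl.
Qed.

Lemma grid_step (v : nat) (t : R) : 0 <= t ->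
  exists k, t <= grid v k /\ grid v k < t + 2 / v.+1%:R.
Proof.
move=> t0; have v0 : 0 < v.+1%:R :> R by [].
have tv : 0 <= t * v.+1%:R by rewrite mulr_ge0.
exists (Num.truncn (t * v.+1%:R)).+1; rewrite /grid.
have /andP[h1 h2] := truncn_itv tv.
rewrite ler_pdivlMr// (ltW h2); split => //.
rewrite ltr_pdivrMr// mulrDl divfK ?gt_eqF//.
by rewrite -natr1 -[2]/(1 + 1) addrA ltrD2r (le_lt_trans h1)// ltrDl.
Qed.

(** Right continuity keeps f above x on an interval that follows a time of exceedance, and a fine
    enough grid meets this interval. *)
Lemma grid_passage x (t0 e : R) : passage_time x = t0%:E -> 0 < e ->
  \forall v \near \oo, exists k, [/\ t0 <= grid v k, grid v k < t0 + e & x < f (grid v k)].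
Proof.
move=> xt0 e0; have [t [t0t te xt]] := passage_time_approx xt0 e0.
have t00 : 0 <= t0 by rewrite -lee_fin -xt0 passage_time_ge0.
have t1 := le_trans t00 t0t.
have [e1 e10 he1] := right_gt t1 xt.
pose e2 := Num.min e1 (t0 + e - t).
have e20 : 0 < e2 by rewrite lt_min e10 subr_gt0.
have : (2 * @harmonic R v) @[v --> \oo] --> 2 * (0 : R) by apply: cvgMr; exact: cvg_harmonic.
rewrite mulr0 => /cvgr_lt/(_ _ e20) h.
apply: filterS h => v hv; have [k [k1 k2]] := grid_step v t1.
have kt : grid v k < t + e2 by apply: lt_trans k2 _; rewrite ltrD2l.
exists k; split.
- exact: le_trans k1.
- by apply: lt_le_trans kt _; rewrite -lerBrDl ge_min lexx orbT.
- by apply: he1 => //; apply: lt_le_trans kt _; rewrite lerD2l ge_min lexx.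
Qed.

Lemma passage_le_grid_hit v N x t0 : passage_time x = t0%:E -> t0 <= grid v N ->
  t0 <= grid v (hit f v N x).
Proof.
move=> xt0 tN; have := hit_le f v N x; rewrite leq_eqVlt => /orP[/eqP ->//|/hit_gt h].
by rewrite -lee_fin -xt0; apply: passage_time_le h; exact: grid_ge0.
Qed.

(** The hits lie on the right of the passage time, the side on which the paths of X and J are
    continuous. *)
Lemma hit_near x (t0 e : R) : passage_time x = t0%:E -> 0 < e ->
  \forall v \near \oo, forall N, t0 + e <= grid v N ->
    [/\ (hit f v N x < N)%N, t0 <= grid v (hit f v N x) & grid v (hit f v N x) < t0 + e].
Proof.
move=> xt0 e0; apply: filterS (grid_passage xt0 e0) => v [k [k1 k2 k3]] N tN.
have kN : (k < N)%N.
  rewrite ltnNge; apply/negP => Nk.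
  by have := lt_le_trans k2 (le_trans tN (le_grid v Nk)); rewrite ltxx.
have hk := hit_le_index kN k3.
split; first exact: leq_ltn_trans kN.
  apply: passage_le_grid_hit => //; apply: le_trans k1 _; exact/le_grid/ltnW.
exact: le_lt_trans (le_grid v hk) k2.
Qed.

Lemma hit_capped (K : R) v N x : (K%:E <= passage_time x)%E -> grid v N <= K ->
  hit f v N x = N.
Proof.
move=> Kx NK; apply/eqP; rewrite eqn_leq hit_le /=; apply: le_hit => // i iN.
apply: before_passage; first exact: grid_ge0.
apply: lt_le_trans Kx; rewrite lte_fin; apply: lt_le_trans NK.
by rewrite ltr_pM2r ?ltr_nat// invr_gt0.
Qed.

Lemma cvg_right_seq (u : nat -> R) (t : R) : 0 <= t ->
  (forall e, 0 < e -> \forall v \near \oo, t <= u v < t + e) ->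
  u v @[v --> \oo] --> t /\ f (u v) @[v --> \oo] --> f t.
Proof.
move=> t0 ut; split.
  apply/cvgrPdist_lt => e e0; apply: filterS (ut e e0) => v /andP[h1 h2].
  by rewrite distrC ger0_norm ?subr_ge0// ltrBlDl.
apply/cvgrPdist_lt => e e0.
have /cvgrPdist_lt/(_ _ e0) [d /= d0 hd] := f_right t0.
apply: filterS (ut d d0) => v /andP[h1 h2].
have [->|ne] := eqVneq (u v) t; first by rewrite subrr normr0.
apply: hd => /=; last by rewrite lt_neqAle eq_sym ne.
by rewrite distrC ger0_norm ?subr_ge0// ltrBlDl.
Qed.

Definition capped_passage (K : nat) (x : R) : R := fine (mine (passage_time x) K%:R%:E).

Lemma capped_passage_itv K x : 0 <= capped_passage K x <= K%:R.
Proof.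
rewrite /capped_passage; case: (leP (passage_time x) K%:R%:E) => h; last by rewrite ler0n lexx.
have := passage_time_ge0 x; case: (passage_time x) h => //= t.
by rewrite !lee_fin => -> ->.
Qed.

(** The grid of K (v + 1) steps ends exactly at time K, so the default value of [hit] acts as the
    cap. *)
Lemma capped_passage_cvg (K : nat) x :
  grid v (hit f v (K * v.+1) x) @[v --> \oo] --> capped_passage K x /\
  f (grid v (hit f v (K * v.+1) x)) @[v --> \oo] --> f (capped_passage K x).
Proof.
have gK v : grid v (K * v.+1) = K%:R :> R by rewrite /grid natrM mulfK.
rewrite /capped_passage; case: (leP K%:R%:E (passage_time x)) => h.
  have hK v : hit f v (K * v.+1) x = (K * v.+1)%N by apply: (hit_capped h); rewrite gK.
  by split; under eq_fun do rewrite hK gK; exact: cvg_cst.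
have h0 := passage_time_ge0 x.
case xt0 : (passage_time x) h h0 => [t0| |]//=; rewrite lte_fin lee_fin => t0K t00.
apply: cvg_right_seq => // e e0.
(* The bound [K - t0] keeps the window after the passage inside the grid. *)
pose e' := Num.min e (K%:R - t0).
have e'0 : 0 < e' by rewrite lt_min e0 subr_gt0.
apply: filterS (hit_near xt0 e'0) => v /(_ (K * v.+1)%N).
rewrite gK -lerBrDl ge_min lexx orbT => /(_ isT) [_ -> /=] hl.
by apply: lt_le_trans hl _; rewrite lerD2l ge_min lexx.
Qed.

Hypothesis f0 : f 0 = 0.
Hypothesis f_left : forall t : R, 0 < t -> cvg (f s @[s --> t^'-]).
Hypothesis f_jump : forall t : R, 0 < t -> f t <= lim (f s @[s --> t^'-]).

(** Before the passage f stays at most x, hence so does its left limit, and without positive jumps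
    the value cannot exceed that limit. At time 0 the starting value 0 is at most x. *)
Lemma le_at_passage x t : 0 <= x -> 0 <= t -> (t%:E <= passage_time x)%E -> f t <= x.
Proof.
move=> x0 t0 tx; have [->|tn0] := eqVneq t 0; first by rewrite f0.
have tp : 0 < t by rewrite lt_neqAle eq_sym tn0.
apply: le_trans (f_jump tp) _; apply: limr_le; first exact: f_left.
near=> s; apply: before_passage.
  by near: s; apply: nbhs_left_ge.
by apply: lt_le_trans tx; rewrite lte_fin; near: s; exact: nbhs_left_lt.
Unshelve. all: by end_near. Qed.

(** A value below x would persist on an interval to the right, against the exceedance times that
    accumulate there. *)
Lemma at_passage x t : 0 <= x -> passage_time x = t%:E -> f t = x.
Proof.
move=> x0 xt; have t0 : 0 <= t by rewrite -lee_fin -xt passage_time_ge0.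
apply/eqP; rewrite eq_le le_at_passage ?xt//= leNgt; apply/negP => fx.
have /cvgr_lt/(_ _ fx) [e /= e0 he] := f_right t0.
have [s [ts se xs]] := passage_time_approx xt e0.
have [st|st] := eqVneq s t; first by move: xs; rewrite st ltNge (ltW fx).
have : f s < x.
  apply: he => /=; last by rewrite lt_neqAle eq_sym st.
  by rewrite distrC ger0_norm ?subr_ge0// ltrBlDl.
by rewrite ltNge (ltW xs).
Qed.

End Paths.

(** * Limits under the expectation *)

Section UniformIntegrability.
Local Open Scope ereal_scope.
Context {R : realType} {d : measure_display} {Omega : measurableType d}.
Variable P : probability Omega R.

Lemma bounded_cvg_integral (g_ : nat -> Omega -> R) (g : Omega -> R) (M : R) :
  (forall n, measurable_fun setT (g_ n)) -> (forall n w, (0 <= g_ n w <= M)%R) ->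
  (forall w, g_ n w @[n --> \oo] --> g w) ->
  measurable_fun setT g /\
  \int[P]_w (g_ n w)%:E @[n --> \oo] --> \int[P]_w (g w)%:E.
Proof.
move=> mg bg cg.
have mg' : measurable_fun setT g.
  by apply: (@measurable_fun_cvg _ Omega R setT g_) => // w _; exact: cg.
split => //.
have [] // := @dominated_convergence _ _ _ P setT measurableT
  (fun n w => (g_ n w)%:E) (fun w => (g w)%:E) (cst M%:E).
- by move=> n; exact/measurable_EFinP.
- exact/measurable_EFinP.
- apply/aeW => w _; apply: cvg_EFin; first exact: nearW.
  exact: cg.
- exact: finite_measure_integrable_cst.
- apply/aeW => w n _; have /andP[h1 h2] := bg n w.
  by rewrite /= lee_fin ger0_norm.
Qed.

(** Fatou's lemma gives the upper bound. For the lower one, g <= min(g, A) + g^2 / A bounds the loss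
    from truncation at A by C / A, uniformly in n, and the truncated sequence converges
    boundedly. *)
Lemma uniformly_integrable_cvg (g_ : nat -> Omega -> R) (g : Omega -> R) (C : R) :
  (forall n, measurable_fun setT (g_ n)) -> (forall n w, (0 <= g_ n w)%R) ->
  (forall w, g_ n w @[n --> \oo] --> g w) ->
  (forall n, \int[P]_w (g_ n w)%:E = 1) ->
  (forall n, \int[P]_w (g_ n w ^+ 2)%:E <= C%:E) ->
  measurable_fun setT g /\ \int[P]_w (g w)%:E = 1.
Proof.
move=> mg g0 cg int1 int2.
have mg' : measurable_fun setT g.
  by apply: (@measurable_fun_cvg _ Omega R setT g_) => // w _; exact: cg.
have g0' w : (0 <= g w)%R.
  rewrite -(cvg_lim _ (@cg w))//; apply: limr_ge; first exact: cvgP (@cg w).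
  exact: nearW.
split => //; apply/eqP; rewrite eq_le; apply/andP; split.
  have mf n : measurable_fun setT (fun w => (g_ n w)%:E) by exact/measurable_EFinP.
  have f0 n w : setT w -> 0 <= (g_ n w)%:E by rewrite lee_fin.
  have := fatou P measurableT mf f0.
  have -> : \int[P]_w limn_einf (fun n => (g_ n w)%:E) = \int[P]_w (g w)%:E.
    apply: eq_integral => w _.
    have c : (g_ n w)%:E @[n --> \oo] --> (g w)%:E by apply: cvg_EFin; [exact: nearW|exact: cg].
    by rewrite is_cvg_limn_einfE; [exact/cvg_lim|exact: cvgP c].
  rewrite (_ : (fun n => \int[P]_w _) = cst 1); last by apply/funext => n; exact: int1.
  rewrite is_cvg_limn_einfE; last exact: is_cvg_cst.
  have -> : limn (cst 1) = 1 :> \bar R by apply/cvg_lim => //; exact: cvg_cst.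
  by [].
have C0 : (0 <= C)%R.
  rewrite -lee_fin; apply: le_trans (int2 0%N); apply: integral_ge0 => w _.
  by rewrite lee_fin exprn_ge0.
suff h A : (0 < A)%R -> 1 <= \int[P]_w (g w)%:E + (C / A)%:E.
  (* Chosen so that C / A <= e; the 1 keeps A positive when C = 0. *)
  apply/lee_addgt0Pr => e e0; pose A := ((C + 1) / e)%R.
  have A0 : (0 < A)%R by rewrite divr_gt0// ltr_wpDl.
  apply: le_trans (h A A0) _; apply: leeD => //; rewrite lee_fin.
  rewrite ler_pdivrMr// /A mulrC divfK ?gt_eqF// lerDl.
  exact: ler01.
move=> A0.
have bA n w : (0 <= Num.min (g_ n w) A <= A)%R.
  by rewrite le_min g0 (ltW A0)/= ge_min lexx orbT.
have cA w : Num.min (g_ n w) A @[n --> \oo] --> Num.min (g w) A.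
  rewrite minr_absE; under eq_fun do rewrite minr_absE.
  apply: cvgMl; apply: cvgB; first by apply: cvgD; [exact: cg|exact: cvg_cst].
  by apply: cvg_norm; apply: cvgB; [exact: cg|exact: cvg_cst].
have mA n : measurable_fun setT (fun w => Num.min (g_ n w) A).
  exact: measurable_minr.
have [mgA cgA] := bounded_cvg_integral mA bA cA.
apply: (@le_trans _ _ (\int[P]_w (Num.min (g w) A)%:E + (C / A)%:E)); last first.
  apply: leeD => //; apply: ge0_le_integral => //.
  - by move=> w _; rewrite lee_fin le_min g0' ltW.
  - exact/measurable_EFinP.
  - exact/measurable_EFinP.
  - by move=> w _; rewrite lee_fin ge_min lexx.
have key n : 1 - (C / A)%:E <= \int[P]_w (Num.min (g_ n w) A)%:E.
  rewrite leeBlDr// -(int1 n).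
  have mg2 : measurable_fun setT (fun w => (g_ n w ^+ 2)%:E).
    by apply/measurable_EFinP; exact: measurable_funX.
  have A10 : (0 <= A^-1)%R by rewrite invr_ge0 ltW.
  apply: (@le_trans _ _ (\int[P]_w ((Num.min (g_ n w) A)%:E + (A^-1)%:E * (g_ n w ^+ 2)%:E))).
    apply: ge0_le_integral => //.
    - by move=> w _; rewrite lee_fin.
    - exact/measurable_EFinP.
    - apply: emeasurable_funD; first exact/measurable_EFinP.
      exact: measurable_funeM.
    - move=> w _; rewrite -EFinM -EFinD lee_fin.
      case: (leP (g_ n w) A) => h; first by rewrite lerDl mulr_ge0// exprn_ge0.
      rewrite ler_wpDl ?(ltW A0)// mulrC ler_pdivlMr// expr2 ler_wpM2l//.
      exact: ltW.
  rewrite ge0_integralD//.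
  - apply: leeD => //; rewrite ge0_integralZl//.
    + rewrite mulrC EFinM; apply: lee_wpmul2l; first by rewrite lee_fin.
      exact: int2.
    + by move=> w _; rewrite lee_fin exprn_ge0.
  - by move=> w _; rewrite lee_fin; have /andP[] := bA n w.
  - exact/measurable_EFinP.
  - by move=> w _; rewrite -EFinM lee_fin mulr_ge0// exprn_ge0.
  - exact: measurable_funeM.
rewrite -leeBlDr//; rewrite -(cvg_lim _ cgA)//; apply: lime_ge; first exact: cvgP cgA.
by apply: nearW => n; exact: key.
Qed.
End UniformIntegrability.

Section MeasurableHit.
Context {R : realType} {d : measure_display} {Omega : measurableType d}.
Variable X : R -> Omega -> R.
Hypothesis mX : forall t, 0 <= t -> measurable_fun setT (X t).

Lemma measurable_hit v N x k : measurable [set w | hit (X^~ w) v N x = k].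
Proof.
have ge l : measurable [set w | (l <= hit (X^~ w) v N x)%N].
  have [lN|Nl] := leqP l N; last first.
    rewrite (_ : [set _ | _] = set0)//; apply/seteqP; split=> w //=.
    by move=> /leq_trans /(_ (hit_le _ _ _ _)); rewrite leqNgt Nl.
  rewrite (_ : [set _ | _] = \bigcap_(i in `I_l) [set w | X (grid v i) w <= x]).
    apply: bigcap_measurableType => i _.
    have := mX (grid_ge0 v i) measurableT (measurable_itv `]-oo, x]).
    by rewrite setTI; congr measurable; apply/seteqP; split=> w /=; rewrite in_itv.
  apply/seteqP; split=> w /= h.
    by move=> i /= il; apply: (@before_hit _ (X^~ w) v N); exact: leq_trans h.
  by apply: le_hit => // i il; exact: h.
rewrite (_ : [set _ | _] = [set w | (k <= hit (X^~ w) v N x)%N] `\`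
    [set w | (k.+1 <= hit (X^~ w) v N x)%N]); first exact: measurableD.
apply/seteqP; split=> w /=; first by move=> ->; rewrite leqnn ltnn.
by move=> [h1 /negP]; rewrite -leqNgt => h2; apply/eqP; rewrite eqn_leq h1 h2.
Qed.

Lemma measurable_hit_level v N (x : nat -> R) m k :
  measurable [set w | hit_level (X^~ w) v N x m = k].
Proof.
case: m => [|m] /=; last exact: measurable_hit.
have [->|k0] := eqVneq k 0%N.
  by rewrite (_ : [set _ | _] = setT)//; apply/seteqP; split.
rewrite (_ : [set _ | _] = set0)//; apply/seteqP; split=> w //= /esym k0'.
by move: k0; rewrite k0' eqxx.
Qed.

Lemma measurable_fun_index (s : Omega -> nat) N (g : nat -> Omega -> R) :
  (forall k, measurable [set w | s w = k]) -> (forall w, (s w <= N)%N) ->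
  (forall k, measurable_fun setT (g k)) -> measurable_fun setT (fun w => g (s w) w).
Proof.
move=> ms sN mg.
rewrite (_ : (fun w => _) = fun w => \sum_(k <- index_enum 'I_N.+1) \1_[set w | s w = k] w * g k w).
  by apply: measurable_sum => k; apply: measurable_funM => //; exact: measurable_indic.
apply/funext => w; rewrite (bigD1 (Ordinal (sN w : (s w < N.+1)%N)))//= big1 ?addr0.
  by rewrite indicE mem_set// mul1r.
move=> k ks; rewrite indicE memNset ?mul0r// => /= sk.
by move/eqP : ks; apply; apply/val_inj.
Qed.

End MeasurableHit.

(** * The joint Laplace transform of the passage gaps *)

Section PassageLaplace.
Context {R : realType} {d : measure_display} {Omega : measurableType d}.
Variables (P : probability Omega R) (X : R -> Omega -> R) (psi : R -> R).
Hypotheses (hX : levy_process P X) (hJ : no_positive_jumps X).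
Hypothesis hpsi : laplace_exponent P X psi.
Variables (n : nat) (x : nat -> R).
Hypotheses (xS : forall k, x k <= x k.+1) (x0 : 0 <= x 0%N).

Let mX t : 0 <= t -> measurable_fun setT (X t). Proof. by case: hX => h _ _ _ _; exact: h. Qed.
Let X0 w : X 0 w = 0. Proof. by case: hX. Qed.
Let Xr w (t : R) : 0 <= t -> X s w @[s --> t^'+] --> X t w.
Proof. by case: hX => _ _ _ _ /(_ w) [h _]; exact: h. Qed.
Let Xl w (t : R) : 0 < t -> cvg (X s w @[s --> t^'-]).
Proof. by case: hX => _ _ _ _ /(_ w) [_ h]; exact: h. Qed.
Let x_ge0 m : 0 <= x m. Proof. by elim: m => // m IH; exact: le_trans (xS m). Qed.

Definition capped_level K m w : R :=
  if m is m'.+1 then capped_passage (X^~ w) K (x m') else 0.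

(** Gap 0 leads from the starting point 0 of X to [x 0]. *)
Definition level_gap m : R := if m is m'.+1 then x m'.+1 - x m' else x 0%N.

Definition capped_martingale (th : nat -> R) K w : R :=
  expR (\sum_(m < n.+1) (th m * (X (capped_level K m.+1 w) w - X (capped_level K m w) w)
      - psi (th m) * (capped_level K m.+1 w - capped_level K m w))).

(* Unlike its limit capped_martingale, this grid version is unbounded since the
   grid overshoots the levels; its square is at most a constant times the version
   with 2 * th, which has mean 1, and so it is uniformly integrable. *)
Let grid_mart (th : nat -> R) K v w : R :=
  expR (\sum_(m < n.+1)
     (th m * (X (grid v (hit_level (X^~ w) v (K * v.+1) x m.+1)) w - X (grid v (hit_level (X^~ w) v (K * v.+1) x m)) w)
      - psi (th m) * (grid v (hit_level (X^~ w) v (K * v.+1) x m.+1) - grid v (hit_level (X^~ w) v (K * v.+1) x m)))).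

Let measurable_grid_mart th K v : measurable_fun setT (grid_mart th K v).
Proof.
have mh m : measurable_fun setT (fun w => X (grid v (hit_level (X^~ w) v (K * v.+1) x m)) w).
  apply: (@measurable_fun_index _ _ _ (fun w => hit_level (X^~ w) v (K * v.+1) x m) (K * v.+1)
    (fun k => X (grid v k))).
  - by move=> k; exact: measurable_hit_level.
  - by move=> w; exact: hit_level_le.
  - by move=> k; apply: mX; exact: grid_ge0.
have mg m : measurable_fun setT (fun w => grid v (hit_level (X^~ w) v (K * v.+1) x m) : R).
  apply: (@measurable_fun_index _ _ _ (fun w => hit_level (X^~ w) v (K * v.+1) x m) (K * v.+1)
    (fun k => cst (grid v k))).
  - by move=> k; exact: measurable_hit_level.
  - by move=> w; exact: hit_level_le.
  - by move=> k; exact: measurable_cst.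
apply: measurableT_comp => //.
have := @measurable_sum _ Omega R setT _ (index_enum 'I_n.+1) (fun m w =>
  th m * (X (grid v (hit_level (X^~ w) v (K * v.+1) x m.+1)) w - X (grid v (hit_level (X^~ w) v (K * v.+1) x m)) w)
      - psi (th m) * (grid v (hit_level (X^~ w) v (K * v.+1) x m.+1) - grid v (hit_level (X^~ w) v (K * v.+1) x m))).
apply => m; apply: measurable_funB; apply: measurable_funM => //; exact: measurable_funB.
Qed.

Let cvg_level K w m :
  grid v (hit_level (X^~ w) v (K * v.+1) x m) @[v --> \oo] --> capped_level K m w /\
  X (grid v (hit_level (X^~ w) v (K * v.+1) x m)) w @[v --> \oo] --> X (capped_level K m w) w.
Proof.
case: m => [|m] /=; last exact: (@capped_passage_cvg _ (X^~ w) (@Xr w) K (x m)).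
by split; under eq_fun do rewrite grid0; exact: cvg_cst.
Qed.

Lemma capped_martingale_integral th K : (forall k, 0 <= th k) ->
  measurable_fun setT (capped_martingale th K) /\
  (\int[P]_w (capped_martingale th K w)%:E = 1)%E.
Proof.
(* With a an increment of X and b the time it takes, 2 (th a - psi(th) b) is (2 th) a - psi(2 th) b
   plus (psi(2 th) - 2 psi(th)) b, and 0 <= b <= K. *)
move=> th0; pose C := expR (\sum_(m < n.+1) `|psi (2 * th m) - 2 * psi (th m)| * K%:R).
apply: (@uniformly_integrable_cvg _ _ _ P (grid_mart th K) _ C).
- by move=> v; exact: measurable_grid_mart.
- by move=> v w; exact: expR_ge0.
- move=> w; rewrite /grid_mart /capped_martingale.
  apply: continuous_cvg; first exact: continuous_expR.
  apply: cvg_big => [|m _]; first exact: add_continuous.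
  have [c1 c2] := cvg_level K w m; have [c3 c4] := cvg_level K w m.+1.
  by apply: cvgB; apply: cvgMr; apply: cvgB.
- by move=> v; exact: discrete_exponential_martingale.
- move=> v; apply: (@le_trans _ _ (\int[P]_w (C%:E * (grid_mart (fun k => 2 * th k) K v w)%:E))%E).
    apply: ge0_le_integral => //.
    + by move=> w _; rewrite lee_fin exprn_ge0// expR_ge0.
    + by apply/measurable_EFinP; exact: measurable_funX.
    + by apply: measurable_funeM; exact/measurable_EFinP.
    + move=> w _; rewrite -EFinM lee_fin /C /grid_mart -expRM_natl -expRD ler_expR.
      rewrite mulr_sumr -big_split/=; apply: ler_sum => m _.
      set a := X _ _ - X _ _; set b := grid _ _ - grid _ _.
      have b0 : 0 <= b.
        rewrite /b subr_ge0 le_grid//; case: (m : nat) => [|m'] //=; exact: hit_mono.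
      have bK : b <= K%:R.
        have gK : grid v (K * v.+1) = K%:R :> R by rewrite /grid natrM mulfK.
        apply: (@le_trans _ _ (grid v (hit_level (X^~ w) v (K * v.+1) x m.+1))).
          by rewrite /b gerBl grid_ge0.
        by rewrite -gK le_grid// hit_level_le.
      have := ler_norm (psi (2 * th m) - 2 * psi (th m)).
      set N := `|_| => hN.
      have h1 : (psi (2 * th m) - 2 * psi (th m)) * b <= N * K%:R.
        by apply: (@le_trans _ _ (N * b)); [exact: ler_wpM2r|
            by apply: ler_wpM2l => //; exact: normr_ge0].
      lra.
  rewrite ge0_integralZl//; last 3 first.
  + exact/measurable_EFinP.
  + by move=> w _; rewrite lee_fin expR_ge0.
  + by rewrite lee_fin expR_ge0.
  rewrite discrete_exponential_martingale ?mule1// => k.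
  by rewrite mulr_ge0.
Qed.

Definition level_passage m w : R :=
  if m is m'.+1 then fine (passage_time (X^~ w) (x m')) else 0.

Definition passage_indicator w : R := (passage_time (X^~ w) (x n) < +oo)%E%:R.

(** The indicator discards the paths that miss the last level: there [fine] sends an infinite time
    to 0, and the difference could be negative. *)
Definition passage_gap m w : R :=
  passage_indicator w * (level_passage m.+1 w - level_passage m w).

Let tau_fin w m : (m <= n)%N -> (passage_time (X^~ w) (x n) < +oo)%E ->
  passage_time (X^~ w) (x m) = (fine (passage_time (X^~ w) (x m)))%:E.
Proof.
move=> mn h; rewrite fineK// ge0_fin_numE ?passage_time_ge0//.
apply: le_lt_trans h; apply: passage_time_mono.
by move: m n mn; apply/nondecreasing_seqP.
Qed.

Let capped_eventually w m : (m <= n.+1)%N -> (passage_time (X^~ w) (x n) < +oo)%E ->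
  \forall K \near \oo, capped_level K m w = level_passage m w.
Proof.
case: m => [|m] mn h /=; first exact: nearW.
have e := tau_fin (mn : (m <= n)%N) h; near=> K.
rewrite /capped_passage min_l// e lee_fin; near: K; exact: nbhs_infty_ger.
Unshelve. all: by end_near. Qed.

(** If the cap comes before the earlier level is passed, the increment is 0; otherwise it starts
    exactly at that level and ends at or below the next. This bounds the martingale although X is
    unbounded below. *)
Let capped_incr_le K m w :
  X (capped_level K m.+1 w) w - X (capped_level K m w) w <= level_gap m.
Proof.
have le_x k : X (capped_level K k.+1 w) w <= x k.
  have /andP[c0 _] := capped_passage_itv (X^~ w) K (x k).
  apply: (le_at_passage (@X0 w) (@Xl w) (hJ w)) => //=.
  rewrite /capped_passage.
  case: (leP (passage_time (X^~ w) (x k)) K%:R%:E) => h; last exact: ltW.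
  by rewrite fineK// ge0_fin_numE ?passage_time_ge0// (le_lt_trans h)// ltry.
case: m => [|m] /=; first by rewrite X0 subr0; exact: le_x.
case: (leP K%:R%:E (passage_time (X^~ w) (x m))) => h.
  have h' := le_trans h (passage_time_mono (X^~ w) (xS m)).
  by rewrite /capped_passage !min_r// subrr subr_ge0.
apply: lerB; first exact: le_x.
have e : passage_time (X^~ w) (x m) = (fine (passage_time (X^~ w) (x m)))%:E.
  by rewrite fineK// ge0_fin_numE ?passage_time_ge0// (lt_trans h)// ltry.
by rewrite /capped_passage min_l ?(ltW h)// (at_passage (@Xr w) (@X0 w) (@Xl w) (hJ w) _ e).
Qed.

Let capped_level_mono K m w : capped_level K m w <= capped_level K m.+1 w.
Proof.
case: m => [|m]; first by have /andP[] := capped_passage_itv (X^~ w) K (x 0%N).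
rewrite /= /capped_passage fine_le//.
- rewrite ge0_fin_numE; last by rewrite le_min passage_time_ge0 lee_fin ler0n.
  by rewrite (@le_lt_trans _ _ K%:R%:E)// ?ltry// ge_min lexx orbT.
- rewrite ge0_fin_numE; last by rewrite le_min passage_time_ge0 lee_fin ler0n.
  by rewrite (@le_lt_trans _ _ K%:R%:E)// ?ltry// ge_min lexx orbT.
by rewrite le_min !ge_min lexx passage_time_mono ?orbT.
Qed.

Lemma passage_gap_ge0 m w : (m <= n)%N -> 0 <= passage_gap m w.
Proof.
move=> mn; rewrite /passage_gap /passage_indicator.
have [h|h] := boolP (passage_time (X^~ w) (x n) < +oo)%E; last by rewrite mul0r.
rewrite mul1r subr_ge0; case: m mn => [|m] mn /=.
  by rewrite fine_ge0// passage_time_ge0.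
rewrite -lee_fin -!tau_fin//; last exact: ltnW.
exact: passage_time_mono.
Qed.

Let exists_lower_bound (u : nat -> R) N : (forall m, 0 < u m) ->
  exists2 c, 0 < c & forall m, (m < N)%N -> c <= u m.
Proof.
move=> u0; elim: N => [|N [c c0 h]]; first by exists 1.
exists (Num.min c (u N)); first by rewrite lt_min c0 u0.
move=> m; rewrite ltnS leq_eqVlt => /orP[/eqP ->|/h]; first by rewrite ge_min lexx orbT.
by move=> cm; rewrite ge_min cm.
Qed.

Lemma capped_martingale_le th K w : (forall k, 0 <= th k) -> (forall k, 0 < psi (th k)) ->
  capped_martingale th K w <= expR (\sum_(m < n.+1) th m * level_gap m).
Proof.
move=> th0 q0; rewrite /capped_martingale ler_expR; apply: ler_sum => m _.
rewrite lerBlDr; apply: (@le_trans _ _ (th m * level_gap m)).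
  by apply: ler_wpM2l => //; exact: capped_incr_le.
rewrite lerDl; apply: mulr_ge0; first exact: ltW.
by rewrite subr_ge0 capped_level_mono.
Qed.

(** If the last level is never passed, the capped durations add up to K. With c a common lower bound
    of the finitely many rates psi(th m), the exponent is at most S - c K. *)
Let capped_martingale_vanish th w : (forall k, 0 <= th k) -> (forall k, 0 < psi (th k)) ->
  ~~ (passage_time (X^~ w) (x n) < +oo)%E ->
  capped_martingale th K w @[K --> \oo] --> (0 : R).
Proof.
move=> th0 q0 h; have [c c0 hc] := exists_lower_bound n.+1 q0.
pose S := \sum_(m < n.+1) th m * level_gap m.
have tn : passage_time (X^~ w) (x n) = +oo%E.
  by apply/eqP; rewrite -leye_eq leNgt.
have le K : capped_martingale th K w <= expR S * expR (- (c * K%:R)).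
  rewrite -expRD ler_expR sumrB lerD//.
    by apply: ler_sum => m _; apply: ler_wpM2l => //; exact: capped_incr_le.
  rewrite lerN2; apply: (@le_trans _ _ (\sum_(m < n.+1) c * (capped_level K m.+1 w - capped_level K m w))).
    rewrite -mulr_sumr ler_wpM2l ?(ltW c0)//.
    rewrite -(big_mkord xpredT (fun m => capped_level K m.+1 w - capped_level K m w)).
    by rewrite telescope_sumr//= subr0 /capped_passage tn min_r// leey.
  by apply: ler_sum => m _; apply: ler_wpM2r; [rewrite subr_ge0 capped_level_mono|exact: hc].
apply: (@squeeze_cvgr _ _ _ _ (cst 0) (fun K => expR S * expR (- (c * K%:R)))).
- by apply: nearW => K; rewrite expR_ge0 le.
- exact: cvg_cst.
- rewrite -(mulr0 (expR S)); apply: cvgMr.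
  have cK : c * K%:R @[K --> \oo] --> +oo.
    apply/cvgryPge => A; apply: filterS (nbhs_infty_ger (A / c)) => K.
    by rewrite ler_pdivrMr// mulrC.
  exact: (cvg_comp _ _ cK (@cvgr_expR R)).
Qed.

Let capped_martingale_limit th w : (forall k, 0 <= th k) -> (forall k, 0 < psi (th k)) ->
  capped_martingale th K w @[K --> \oo] --> passage_indicator w *
    expR (\sum_(m < n.+1) (th m * level_gap m - psi (th m) * passage_gap m w)).
Proof.
move=> th0 q0; rewrite /passage_indicator.
have [h|h] := boolP (passage_time (X^~ w) (x n) < +oo)%E; last first.
  by rewrite mul0r; exact: capped_martingale_vanish.
rewrite mul1r; apply: cvg_near_cst.
have : \forall K \near \oo, forall m : 'I_n.+2, capped_level K m w = level_passage m w.
  by apply: filter_forall => m; apply: capped_eventually => //; rewrite -ltnS.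
apply: filterS => K hK; congr expR; apply: eq_bigr => m _.
have -> : capped_level K m.+1 w = level_passage m.+1 w by exact: (hK (lift ord0 m)).
have -> : capped_level K m w = level_passage m w by exact: (hK (widen_ord (leqnSn _) m)).
rewrite /passage_gap /passage_indicator h mul1r; congr (th m * _ - _).
have Xx k : (k <= n)%N -> X (level_passage k.+1 w) w = x k.
  by move=> kn; apply: (at_passage (@Xr w) (@X0 w) (@Xl w) (hJ w) _ (tau_fin kn h)).
have mn : (m <= n)%N by rewrite -ltnS.
rewrite Xx//; case: (nat_of_ord m) mn => [|k] kn; first by rewrite /= X0 subr0.
by rewrite Xx// ltnW.
Qed.

(** With mesh 1 / (v + 1) the grid reaches up to time v + 1: the mesh shrinks while the horizon
    grows. *)
Let Nv v := (v.+1 * v.+1)%N.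

Definition grid_passage_level v m w : R := grid v (hit_level (X^~ w) v (Nv v) x m).

Definition grid_indicator v w : bool := (hit (X^~ w) v (Nv v) (x n) < Nv v)%N.

Let gridNv v : grid v (Nv v) = v.+1%:R :> R.
Proof. by rewrite /grid natrM mulfK. Qed.

Lemma grid_indicator_near w :
  \forall v \near \oo, grid_indicator v w = (passage_time (X^~ w) (x n) < +oo)%E.
Proof.
have [h|h] := boolP (passage_time (X^~ w) (x n) < +oo)%E; last first.
  apply: nearW => v; rewrite /grid_indicator (@hit_capped _ _ (v.+1%:R)) ?ltnn ?gridNv//.
  by apply: le_trans (leey _) _; rewrite leNgt.
have e := tau_fin (leqnn n) h.
apply: filterS2 (hit_near (@Xr w) e ltr01)
  (nbhs_infty_ger (fine (passage_time (X^~ w) (x n)) + 1)) => v h1 h2.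
have pre : fine (passage_time (X^~ w) (x n)) + 1 <= grid v (Nv v).
  by rewrite gridNv; apply: le_trans h2 _; rewrite ler_nat.
by have [] := h1 _ pre.
Qed.

Lemma grid_passage_level_near w m e : (m <= n.+1)%N ->
  (passage_time (X^~ w) (x n) < +oo)%E -> 0 < e ->
  \forall v \near \oo, level_passage m w <= grid_passage_level v m w < level_passage m w + e.
Proof.
case: m => [|m] mn h e0.
  by apply: nearW => v; rewrite /grid_passage_level /= grid0 lexx add0r e0.
have t := tau_fin (mn : (m <= n)%N) h.
apply: filterS2 (hit_near (@Xr w) t e0)
  (nbhs_infty_ger (fine (passage_time (X^~ w) (x m)) + e)) => v h1 h2.
rewrite /grid_passage_level /=; have [|_ -> ->//] := h1 (Nv v).
by rewrite gridNv; apply: le_trans h2 _; rewrite ler_nat.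
Qed.

Lemma measurable_grid_passage_level v m : measurable_fun setT (grid_passage_level v m).
Proof.
apply: (@measurable_fun_index _ _ _ (fun w => hit_level (X^~ w) v (Nv v) x m) (Nv v)
    (fun k => cst (grid v k))).
- by move=> k; exact: measurable_hit_level.
- by move=> w; exact: hit_level_le.
- by move=> k; exact: measurable_cst.
Qed.

Lemma measurable_grid_indicator v : measurable_fun setT (fun w => (grid_indicator v w)%:R : R).
Proof.
apply: (@measurable_fun_index _ _ _ (fun w => hit (X^~ w) v (Nv v) (x n)) (Nv v)
    (fun k => cst (k < Nv v)%N%:R)).
- by move=> k; exact: measurable_hit.
- by move=> w; exact: hit_le.
- by move=> k; exact: measurable_cst.
Qed.

Let grid_indicator_cvg w : (grid_indicator v w)%:R @[v --> \oo] --> passage_indicator w.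
Proof.
apply: cvg_near_cst; apply: filterS (grid_indicator_near w) => v ->.
by [].
Qed.

Lemma measurable_passage_indicator : measurable_fun setT passage_indicator.
Proof.
apply: (@measurable_fun_cvg _ Omega R setT (fun v w => (grid_indicator v w)%:R)).
  exact: measurable_grid_indicator.
by move=> w _; exact: grid_indicator_cvg.
Qed.

Lemma grid_gap_cvg w m : (m <= n)%N ->
  (grid_indicator v w)%:R * (grid_passage_level v m.+1 w - grid_passage_level v m w)
    @[v --> \oo] --> passage_gap m w.
Proof.
move=> mn; have := grid_indicator_near w.
rewrite /passage_gap /passage_indicator.
have [h|h] := boolP (passage_time (X^~ w) (x n) < +oo)%E => hI; last first.
  by rewrite mul0r; apply: cvg_near_cst; apply: filterS hI => v ->; rewrite mul0r.
apply: cvgM.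
  by apply: cvg_near_cst; apply: filterS hI => v ->.
have lev k : (k <= n.+1)%N -> grid_passage_level v k w @[v --> \oo] --> level_passage k w.
  move=> kn; have l0 : 0 <= level_passage k w.
    by case: k kn => //= k _; rewrite fine_ge0// passage_time_ge0.
  have [] // := @cvg_right_seq _ (X^~ w) (@Xr w) (fun v => grid_passage_level v k w)
    (level_passage k w) l0.
  by move=> e e0; exact: grid_passage_level_near.
by apply: cvgB; apply: lev => //; exact: ltnW.
Qed.

Lemma measurable_passage_gap m : (m <= n)%N -> measurable_fun setT (passage_gap m).
Proof.
move=> mn; apply: (@measurable_fun_cvg _ Omega R setT (fun v w => (grid_indicator v w)%:R *
    (grid_passage_level v m.+1 w - grid_passage_level v m w))).
  move=> v; apply: measurable_funM; first exact: measurable_grid_indicator.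
  by apply: measurable_funB; exact: measurable_grid_passage_level.
by move=> w _; exact: grid_gap_cvg.
Qed.

(** Bounded convergence as the cap K is removed. On paths that pass all levels X gains exactly the
    level gaps, so its part of the exponent is the constant S and leaves the expectation. *)
Lemma passage_laplace (th : nat -> R) : (forall k, 0 <= th k) -> (forall k, 0 < psi (th k)) ->
  (\int[P]_w (passage_indicator w * \prod_(m < n.+1) expR (- (psi (th m) * passage_gap m w)))%:E =
   (\prod_(m < n.+1) expR (- (level_gap m * th m)))%:E)%E.
Proof.
move=> th0 q0; pose S := \sum_(m < n.+1) th m * level_gap m.
have [|||mg] := @bounded_cvg_integral _ _ _ P (capped_martingale th)
  (fun w => passage_indicator w *
    expR (\sum_(m < n.+1) (th m * level_gap m - psi (th m) * passage_gap m w))) (expR S).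
- by move=> K; have [] := capped_martingale_integral K th0.
- by move=> K w; rewrite expR_ge0/=; exact: capped_martingale_le.
- by move=> w; exact: capped_martingale_limit.
rewrite (_ : (fun K => \int[P]_w (capped_martingale th K w)%:E) = cst 1)%E; last first.
  by apply/funext => K; have [] := capped_martingale_integral K th0.
move=> /(@cvg_unique _ (@ereal_hausdorff R) _ _ _ _ (cvg_cst 1%E)) h.
have E w : passage_indicator w * \prod_(m < n.+1) expR (- (psi (th m) * passage_gap m w)) =
   expR (- S) * (passage_indicator w *
    expR (\sum_(m < n.+1) (th m * level_gap m - psi (th m) * passage_gap m w))).
  rewrite -expR_sum mulrCA -expRD; congr (_ * expR _).
  by rewrite /S sumrB addrA addNr add0r sumrN.
under eq_integral do rewrite E EFinM.
rewrite ge0_integralZl//.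
- rewrite -h mule1 -expR_sum; congr (expR _)%:E.
  by rewrite /S -sumrN; apply: eq_bigr => m _; rewrite mulrC.
- exact/measurable_EFinP.
- by move=> w _; rewrite lee_fin mulr_ge0// expR_ge0.
Qed.

End PassageLaplace.

(** * The chain at first passage times *)

Section ExpmxContinuity.
Context {R : realType} {p : nat}.
Implicit Types A T : 'M[R]_p.

(** [expmx_approx] handles the first N terms; the rest is at most the tail of the series of exp(a),
    whatever the matrix. *)
Lemma expmx_cvg (A_ : nat -> 'M[R]_p) A a i j :
  (forall N i, \sum_j `|A_ N i j| <= a) ->
  (forall i j, A_ N i j @[N --> \oo] --> A i j) ->
  expmx (A_ N) i j @[N --> \oo] --> expmx A i j.
Proof.
move=> Aa AA.
have a0 : 0 <= a by apply: le_trans (Aa 0%N i); exact: sumr_ge0.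
pose g k := a ^+ k / k`!%:R.
have g0 k : 0 <= g k by rewrite mulr_ge0// exprn_ge0.
have cg : cvgn (series g) := @exp_series_cvg R a.
pose u N k := (A_ N ^+ k) i j / k`!%:R.
have h := expmx_approx (L := id) (i := i) (j := j) Aa AA (fun=> leqnn _).
have le N : `|expmx (A_ N) i j - series (u N) N| <= limn (series g) - series g N.
  have cN := @cvg_expmx R p (A_ N) i j.
  have cB : `|series (u N) M - series (u N) N| @[M --> \oo] -->
      `|expmx (A_ N) i j - series (u N) N|.
    by apply: cvg_norm; apply: cvgB; [exact: cN|exact: cvg_cst].
  rewrite -(cvg_lim _ cB)//; apply: limr_le; first exact: cvgP cB.
  exists N => // M /= NM; rewrite sub_series NM.
  apply: le_trans (ler_norm_sum _ _ _) _.
  apply: (@le_trans _ _ (\sum_(N <= k < M) g k)).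
    apply: ler_sum => k _.
    by rewrite normrM (ger0_norm (_ : 0 <= _^-1))// ler_wpM2r// mxpow_norm_le.
  rewrite lerBrDl (_ : series g N + _ = series g M); first exact: series_le_lim.
  by rewrite /series /= -big_cat_nat.
have d0 : expmx (A_ N) i j - series (u N) N @[N --> \oo] --> 0.
  apply/cvgrPdist_le => e e0; move/cvgrPdist_le : (cg) => /(_ e e0).
  apply: filterS => N hN; rewrite sub0r normrN; apply: le_trans (le N) _.
  by apply: le_trans hN; exact: ler_norm.
rewrite (_ : (fun N => _) = (fun N => (expmx (A_ N) i j - series (u N) N) + series (u N) N)).
  by rewrite -[expmx A i j]add0r; exact: cvgD.
by apply/funext => N; rewrite subrK.
Qed.

Lemma expmx_scale_cvg T (t_ : nat -> R) (t : R) i j :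
  t_ N @[N --> \oo] --> t -> expmx (t_ N *: T) i j @[N --> \oo] --> expmx (t *: T) i j.
Proof.
move=> ct; have [a Ta] := row_norm_bound T.
have [M HM] : exists M, forall N, `|t_ N| <= M.
  have := cvg_seq_bounded (cvgP _ ct) => -[M [_ hM]].
  by exists (M + 1) => N; apply: (hM (M + 1)) => //; rewrite ltrDl.
apply: (@expmx_cvg _ _ (M * a)).
- move=> N k; under eq_bigr do rewrite mxE normrM.
  by rewrite -mulr_sumr ler_pM// sumr_ge0.
- by move=> k l; under eq_fun do rewrite mxE; rewrite mxE; exact: cvgMl.
Qed.

Lemma measurable_expmx T i j : measurable_fun setT (fun t : R => expmx (t *: T) i j).
Proof.
apply: (@measurable_fun_cvg _ R R setT
  (fun N t => \sum_(0 <= k < N) ((t *: T) ^+ k) i j / k`!%:R)).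
  move=> N; apply: measurable_sum => k.
  rewrite (_ : (fun t => _) = fun t => t ^+ k * ((T ^+ k) i j / k`!%:R)).
    by apply: measurable_funM => //; exact: exprn_measurable.
  apply/funext => t; suff -> : (t *: T) ^+ k = t ^+ k *: T ^+ k by rewrite mxE mulrA.
  elim: k => [|k IH]; first by rewrite !expr0 scale1r.
  by rewrite !exprS IH -mulmxE -scalemxAl -scalemxAr scalerA.
by move=> t _; exact: cvg_expmx.
Qed.

End ExpmxContinuity.

Section IndependentIndex.
Local Open Scope ereal_scope.
Context {R : realType} {d : measure_display} {Omega : measurableType d}.
Variable P : probability Omega R.

(** Decomposition over the finitely many values of [s]. It is applied to hit indices of X and to
    events on J at the corresponding fixed times. *)
Lemma independent_index (I : finType) (s : Omega -> I) (B : I -> set Omega) :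
  (forall a, measurable [set w | s w = a]) -> (forall a, measurable (B a)) ->
  (forall a, P ([set w | s w = a] `&` B a) = P [set w | s w = a] * P (B a)) ->
  measurable [set w | B (s w) w] /\
  P [set w | B (s w) w] = \int[P]_w (fine (P (B (s w))))%:E.
Proof.
move=> ms mB ind.
have split_sum (g : I -> R) w : g (s w) = (\sum_(a <- index_enum I) \1_[set w | s w = a] w * g a)%R.
  rewrite (bigD1 (s w))//= big1 ?addr0; first by rewrite indicE mem_set// mul1r.
  by move=> a sa; rewrite indicE memNset ?mul0r// => /= sw; rewrite sw eqxx in sa.
have E : [set w | B (s w) w] = \big[setU/set0]_(a <- index_enum I) ([set w | s w = a] `&` B a).
  rewrite -bigcup_seq; apply/seteqP; split=> w /=.
    by move=> h; exists (s w) => //=; rewrite mem_index_enum.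
  by move=> [a _ [/= -> ]].
have mS : measurable [set w | B (s w) w].
  by rewrite E; apply: bigsetU_measurable => a _; exact: measurableI.
split => //; rewrite -[X in P X]setIT -integral_indic//.
transitivity (\int[P]_w \sum_(a <- index_enum I) (\1_([set w | s w = a] `&` B a) w)%:E).
  apply: eq_integral => w _; rewrite sumEFin; congr EFin.
  transitivity (\sum_(a <- index_enum I) (\1_[set w | s w = a] w : R) * \1_(B a) w)%R.
    rewrite -(split_sum (fun a => \1_(B a) w)) !indicE; congr ((nat_of_bool _)%:R).
  by apply: eq_bigr => a _; rewrite !indicE in_setI -natrM mulnb.
rewrite ge0_integral_sum//; last first.
  by move=> a; apply/measurable_EFinP; apply: measurable_indic; exact: measurableI.
transitivity (\sum_(a <- index_enum I) \int[P]_w ((\1_[set w | s w = a] w)%:E * (fine (P (B a)))%:E)).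
  apply: eq_bigr => a _; rewrite integral_indic// ?setIT; last exact: measurableI.
  rewrite [LHS]ind ge0_integralZr//.
  - by rewrite integral_indic// setIT fineK// fin_num_measure.
  - by apply/measurable_EFinP; exact: measurable_indic.
  - by rewrite lee_fin fine_ge0.
rewrite -ge0_integral_sum//.
- apply: eq_integral => w _; under eq_bigr do rewrite -EFinM.
  by rewrite sumEFin -(split_sum (fun a => fine (P (B a)))).
- move=> a; apply: emeasurable_funM => //; apply/measurable_EFinP; exact: measurable_indic.
- by move=> a w _; rewrite mule_ge0// lee_fin fine_ge0.
Qed.

End IndependentIndex.

Section ChainPaths.
Context {R : realType} {d : measure_display} {Omega : measurableType d} {p : nat}.
Variables (X : R -> Omega -> R) (J : R -> Omega -> option 'I_p).
Hypothesis Xr : forall w (t : R), 0 <= t -> X s w @[s --> t^'+] --> X t w.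
Hypothesis Jabs : forall w (s t : R), 0 <= s -> s <= t -> J s w = None -> J t w = None.
Hypothesis Jr : forall w (t : R), 0 <= t -> \forall s \near t^'+, J s w = J t w.

Lemma chain_right_constant w (t : R) : 0 <= t ->
  exists2 e : R, 0 < e & forall s, t <= s < t + e -> J s w = J t w.
Proof.
move=> t0; have [e /= e0 he] := Jr w t0; exists e => // s /andP[ts se].
have [->//|st] := eqVneq s t; apply: he => /=; last by rewrite lt_neqAle eq_sym st.
by rewrite distrC ger0_norm ?subr_ge0// ltrBlDl.
Qed.

(** The inequality is strict because J keeps its value for a while after t. *)
Lemma life_time_gt w (t : R) k : 0 <= t -> J t w = Some k -> (t%:E < life_time J w)%E.
Proof.
move=> t0 Jt; have [e e0 he] := chain_right_constant w t0.
apply: (@lt_le_trans _ _ (t + e)%:E); first by rewrite lte_fin ltrDl.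
apply: le_ereal_inf_tmp => _ [s [s0 Js] <-]; rewrite lee_fin leNgt; apply/negP => se.
have [st|ts] := leP s t; first by have := Jabs s0 st Js; rewrite Jt.
by have := he s; rewrite (ltW ts) se Jt Js => /(_ isT).
Qed.

(* The comparison with the life time is redundant: J stays at None afterwards. *)
Lemma chain_at_passageE x w : chain_at_passage X J x w =
  if (passage_time (X^~ w) x < +oo)%E then J (fine (passage_time (X^~ w) x)) w else None.
Proof.
rewrite /chain_at_passage -/(passage_time (X^~ w) x).
have p0 := passage_time_ge0 (X^~ w) x.
case: ifPn => [h|]; first by rewrite (lt_le_trans h)// leey.
case: ifPn => // h; rewrite -leNgt => le.
have e : passage_time (X^~ w) x = (fine (passage_time (X^~ w) x))%:E.
  by rewrite fineK// ge0_fin_numE.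
case E : (J _ w) => [k|//]; have := life_time_gt _ E.
by rewrite fine_ge0// -e ltNge le => /(_ isT).
Qed.

Lemma chain_at_passage_absorbing w (s t : R) : s <= t ->
  chain_at_passage X J s w = None -> chain_at_passage X J t w = None.
Proof.
move=> st; rewrite !chain_at_passageE; case: ifPn => [hs Js|hs _]; last first.
  rewrite ifN//; apply: contra hs; apply: le_lt_trans.
  exact: passage_time_mono.
case: ifPn => // ht; apply: Jabs Js; first by rewrite fine_ge0// passage_time_ge0.
by rewrite fine_le ?ge0_fin_numE ?passage_time_ge0 ?passage_time_mono.
Qed.

(** A time t1 with X t1 > t, close to the passage over t, also bounds the passage over every s in
    (t, X t1); these passages fall where J is still constant. *)
Lemma chain_at_passage_right w (t : R) :
  \forall s \near t^'+, chain_at_passage X J s w = chain_at_passage X J t w.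
Proof.
have p0 y := passage_time_ge0 (X^~ w) y.
have [ht|ht] := boolP (passage_time (X^~ w) t < +oo)%E; last first.
  near=> s; have ts : t < s by near: s; exact: nbhs_right_gt.
  rewrite !chain_at_passageE (negbTE ht) ifN//; apply: contra ht.
  by apply: le_lt_trans; exact/passage_time_mono/ltW.
have e : passage_time (X^~ w) t = (fine (passage_time (X^~ w) t))%:E.
  by rewrite fineK// ge0_fin_numE.
have t0 : 0 <= fine (passage_time (X^~ w) t) by rewrite fine_ge0.
have [ep ep0 hJ] := chain_right_constant w t0.
have [t1 [t01 t1e Xt1]] := passage_time_approx e ep0.
near=> s; have ts : t < s by near: s; exact: nbhs_right_gt.
have sX : s < X t1 w by near: s; exact: nbhs_right_lt.
have le1 : (passage_time (X^~ w) s <= t1%:E)%E.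
  by apply: passage_time_le => //; exact: le_trans t01.
have hs : (passage_time (X^~ w) s < +oo)%E by apply: le_lt_trans le1 _; exact: ltry.
rewrite !chain_at_passageE ht hs; apply: hJ.
have es : passage_time (X^~ w) s = (fine (passage_time (X^~ w) s))%:E.
  by rewrite fineK// ge0_fin_numE.
rewrite -lee_fin -e -es passage_time_mono ?(ltW ts)//=.
by rewrite -lte_fin -es (le_lt_trans le1)// lte_fin.
Unshelve. all: by end_near. Qed.

End ChainPaths.

(** * Finite-dimensional laws of J at passage times *)

Section JointLaw.
Context {R : realType} {d : measure_display} {Omega : measurableType d}.
Variables (P : probability Omega R) (X : R -> Omega -> R) (p : nat).
Variables (alpha : 'rV[R]_p) (T : 'M[R]_p) (J : R -> Omega -> option 'I_p).
Hypotheses (hX : levy_process P X) (hJ : markov_chain P alpha T J).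
Hypothesis hXJ : independent_processes P X J.
Variables (n : nat) (x : nat -> R) (ii : nat -> 'I_p).
Hypotheses (xS : forall k, x k <= x k.+1) (x0 : 0 <= x 0%N).

Let mX t : 0 <= t -> measurable_fun setT (X t). Proof. by case: hX => h _ _ _ _; exact: h. Qed.
Let Xr w (t : R) : 0 <= t -> X s w @[s --> t^'+] --> X t w.
Proof. by case: hX => _ _ _ _ /(_ w) [h _]; exact: h. Qed.
Let hT : sub_intensity T. Proof. by case: hJ => [[]]. Qed.
Let Jabs w (s t : R) : 0 <= s -> s <= t -> J s w = None -> J t w = None.
Proof. by case: hJ => _ _ h _ _; exact: h. Qed.
Let Jr w (t : R) : 0 <= t -> \forall s \near t^'+, J s w = J t w.
Proof. by case: hJ => _ _ _ h _; exact: h. Qed.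

Let Nv v := (v.+1 * v.+1)%N.

Definition hit_tuple v w : {ffun 'I_n.+1 -> 'I_(Nv v).+1} :=
  [ffun m : 'I_n.+1 => inord (hit (X^~ w) v (Nv v) (x m))].

(** Beyond n + 1 the last index is repeated: [markov_chain] takes nondecreasing time sequences
    indexed by all natural numbers. *)
Definition tuple_level N (a : {ffun 'I_n.+1 -> 'I_N.+1}) k : nat :=
  if k is k'.+1 then a (inord (minn k' n)) else 0%N.

(** Empty when the last index is N, the default value of [hit], which stands for a level not hit on
    the grid. *)
Definition chain_on_grid v N (a : {ffun 'I_n.+1 -> 'I_N.+1}) : set Omega :=
  if (a ord_max < N)%N
  then \bigcap_(k in `I_n.+2) [set w | J (grid v (tuple_level a k)) w = Some (ii k)]
  else set0.

Let tuple_level_hit v w k : (k <= n.+1)%N ->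
  tuple_level (hit_tuple v w) k = hit_level (X^~ w) v (Nv v) x k.
Proof.
case: k => [|k] //= kn; rewrite ffunE inordK; last by rewrite ltnS hit_le.
by rewrite inordK ?ltnS ?geq_minr// (minn_idPl _).
Qed.

(** The measurable space is arbitrary, as this is applied both to Omega and to the sigma-algebra
    generated by X. *)
Let hit_tuple_event (d' : measure_display) (Om : measurableType d') (Y : R -> Om -> R) v
    (a : {ffun 'I_n.+1 -> 'I_(Nv v).+1}) :
  (forall t, 0 <= t -> measurable_fun setT (Y t)) ->
  measurable [set w : Om | [ffun m : 'I_n.+1 => inord (hit (Y^~ w) v (Nv v) (x m))] = a].
Proof.
move=> mY.
rewrite (_ : [set _ | _] = \bigcap_(m in [set: 'I_n.+1])
    [set w | hit (Y^~ w) v (Nv v) (x m) = a m]).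
  apply: fin_bigcap_measurable => // m _; exact: measurable_hit.
apply/seteqP; split=> w /= => [<- m _ /=|h].
  by rewrite ffunE inordK// ltnS hit_le.
by apply/ffunP => m; rewrite ffunE; apply: val_inj; rewrite /= inordK ?ltnS ?hit_le// h.
Qed.

Let chain_on_grid_sigma v N (a : {ffun 'I_n.+1 -> 'I_N.+1}) :
  process_sigma setT J (chain_on_grid v a).
Proof.
pose G := [set J t @^-1` B | t in [set t : R | 0 <= t] & B in [set: set (option 'I_p)]].
have : measurable (chain_on_grid v a : set (g_sigma_algebraType G)).
  rewrite /chain_on_grid; case: ifP => // _; apply: bigcap_measurableType => k _.
  apply: sub_sigma_algebra; exists (grid v (tuple_level a k)) => /=; first exact: grid_ge0.
  by exists [set Some (ii k)].
by [].
Qed.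

Let hit_tuple_sigma v a : process_sigma measurable X [set w | hit_tuple v w = a].
Proof.
pose G := [set X t @^-1` B | t in [set t : R | 0 <= t] & B in measurable].
have mXG t : 0 <= t -> measurable_fun [set: g_sigma_algebraType G] (X t).
  move=> t0 _ B mB; rewrite setTI; apply: sub_sigma_algebra.
  by exists t => //; exists B.
exact: (@hit_tuple_event _ (g_sigma_algebraType G) X v a mXG).
Qed.

Let chain_on_grid_measurable v N (a : {ffun 'I_n.+1 -> 'I_N.+1}) :
  measurable (chain_on_grid v a).
Proof.
rewrite /chain_on_grid; case: ifP => // _; apply: bigcap_measurableType => k _.
by case: hJ => _ h _ _ _; apply: h; exact: grid_ge0.
Qed.

Definition approx_weight v w : R :=
  (grid_indicator X n x v w)%:R * (alpha 0 (ii 0%N) * \prod_(k < n.+1)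
    expmx ((grid_passage_level X x v k.+1 w - grid_passage_level X x v k w) *: T) (ii k) (ii k.+1)).

(** For each fixed tuple of indices the times are deterministic and the finite-dimensional laws of J
    apply; the random tuple depends on X only and is independent of J. *)
Lemma chain_on_grid_prob v :
  measurable [set w | chain_on_grid v (hit_tuple v w) w] /\
  P [set w | chain_on_grid v (hit_tuple v w) w] = (\int[P]_w (approx_weight v w)%:E)%E.
Proof.
have [|||m ->] := @independent_index _ _ _ P _ (hit_tuple v) (fun a => chain_on_grid v a).
- by move=> a; exact: hit_tuple_event.
- by move=> a; exact: chain_on_grid_measurable.
- by move=> a; apply: hXJ; [exact: hit_tuple_sigma|exact: chain_on_grid_sigma].
split => //; apply: eq_integral => w _; congr EFin.
have maxE : (hit_tuple v w ord_max : nat) = hit (X^~ w) v (Nv v) (x n).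
  by rewrite ffunE inordK// ltnS hit_le.
rewrite /approx_weight /grid_indicator /chain_on_grid maxE -/(Nv v).
case: ifPn => h; last by rewrite measure0 mul0r.
rewrite mul1r.
pose t k : R := grid v (tuple_level (hit_tuple v w) k).
have tE k : (k <= n.+1)%N -> t k = grid_passage_level X x v k w.
  by move=> kn; rewrite /t tuple_level_hit.
have tS k : t k <= t k.+1.
  rewrite /t; apply: le_grid; have [kn|nk] := leqP k n.
    rewrite !tuple_level_hit ?ltnS// ?(leq_trans kn)//; case: k kn => //= k kn.
    exact: hit_mono.
  case: k nk => //= k nk; rewrite !(minn_idPr _)//; exact: ltnW.
have [_ _ _ _ fdd] := hJ.
rewrite -/(t _) (fdd n.+1 t ii) //; last by rewrite /t /= grid0.
congr (_ * _); apply: eq_bigr => k _; rewrite !tE//; exact: ltnW.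
Qed.

Definition passage_event : set Omega :=
  [set w | J 0 w = Some (ii 0%N) /\
     forall m, (m <= n)%N -> chain_at_passage X J (x m) w = Some (ii m.+1)].

(** On each path the finitely many hits end up in the intervals after the passage times on which J
    is constant. *)
Lemma passage_event_near w :
  \forall v \near \oo, chain_on_grid v (hit_tuple v w) w <-> passage_event w.
Proof.
have p0 y := passage_time_ge0 (X^~ w) y.
have gI := grid_indicator_near hX n xS w.
have maxE v : (hit_tuple v w ord_max : nat) = hit (X^~ w) v (Nv v) (x n).
  by rewrite ffunE inordK// ltnS hit_le.
have [h|h] := boolP (passage_time (X^~ w) (x n) < +oo)%E; last first.
  apply: filterS gI => v; rewrite (negbTE h) /grid_indicator -/(Nv v) => gv.
  rewrite /chain_on_grid maxE gv; split => // -[_ /(_ n (leqnn _))].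
  by rewrite chain_at_passageE// (negbTE h).
have nearJ : \forall v \near \oo, forall k : 'I_n.+2,
    J (grid_passage_level X x v k w) w = J (level_passage X x k w) w.
  apply: filter_forall => k; have l0 : 0 <= level_passage X x k w.
    by rewrite /level_passage; case: (nat_of_ord k) => // m; rewrite fine_ge0.
  have [e e0 he] := chain_right_constant Jr w l0.
  apply: filterS (grid_passage_level_near hX xS _ h e0); last by rewrite -ltnS.
  by move=> v; exact: he.
apply: filterS2 gI nearJ => v; rewrite h /grid_indicator -/(Nv v) => gv hv.
rewrite /chain_on_grid maxE gv.
have hlev k : (k <= n.+1)%N -> J (grid v (tuple_level (hit_tuple v w) k)) w =
    J (level_passage X x k w) w.
  by move=> kn; rewrite tuple_level_hit//; exact: (hv (Ordinal (kn : (k < n.+2)%N))).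
have tf m : (m <= n)%N -> (passage_time (X^~ w) (x m) < +oo)%E.
  move=> mn; apply: le_lt_trans h; apply: passage_time_mono.
  by move: m n mn; apply/nondecreasing_seqP.
split.
  move=> hh; split.
    by have h0 : J (grid v (tuple_level (hit_tuple v w) 0)) w = Some (ii 0%N) := hh 0%N isT;
      rewrite hlev in h0.
  move=> m mn; rewrite chain_at_passageE// tf//.
  have hm : J (grid v (tuple_level (hit_tuple v w) m.+1)) w = Some (ii m.+1) := hh m.+1 mn.
  by rewrite hlev in hm.
move=> [h0 hh] k /= kn; rewrite hlev//; case: k kn => [|k] kn //=.
by have := hh k kn; rewrite chain_at_passageE// tf.
Qed.

Let approx_gap_ge0 v k w :
  0 <= grid_passage_level X x v k.+1 w - grid_passage_level X x v k w.
Proof. by rewrite subr_ge0 le_grid//; case: k => //= k; exact: hit_mono. Qed.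

Lemma approx_weight_cvg w : approx_weight v w @[v --> \oo] -->
  passage_indicator X n x w * (alpha 0 (ii 0%N) * \prod_(k < n.+1)
    expmx (passage_gap X n x k w *: T) (ii k) (ii k.+1)).
Proof.
have gI := grid_indicator_near hX n xS w.
rewrite /passage_indicator.
have [h|h] := boolP (passage_time (X^~ w) (x n) < +oo)%E; last first.
  rewrite mul0r; apply: cvg_near_cst; apply: filterS gI => v.
  by rewrite (negbTE h) /approx_weight => ->; rewrite mul0r.
apply: cvgM.
  by apply: cvg_near_cst; apply: filterS gI => v ->; rewrite h.
apply: cvgMr; apply: cvg_big => [|k _]; first exact: mul_continuous.
apply: expmx_scale_cvg.
have kn : (k <= n)%N by rewrite -ltnS.
have c := @grid_gap_cvg _ _ _ _ _ hX _ _ xS w k kn; apply: cvg_trans c; apply: near_eq_cvg.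
by apply: filterS gI => v ->; rewrite h mul1r.
Qed.

Lemma approx_weight_itv v w : 0 <= approx_weight v w <= 1.
Proof.
have [[[a0 a1] _] _ _ _ _] := hJ.
have e01 (k : 'I_n.+1) : 0 <= expmx ((grid_passage_level X x v k.+1 w -
    grid_passage_level X x v k w) *: T) (ii k) (ii k.+1) <= 1.
  have hs := expmx_substochastic hT (approx_gap_ge0 v k w).
  by rewrite substochastic_le1// andbT; case: hs.
have al1 : alpha 0 (ii 0%N) <= 1.
  by rewrite -a1 (bigD1 (ii 0%N))//= lerDl sumr_ge0.
have pr0 : 0 <= \prod_(k < n.+1) expmx ((grid_passage_level X x v k.+1 w -
    grid_passage_level X x v k w) *: T) (ii k) (ii k.+1).
  by apply: prodr_ge0 => k _; have /andP[] := e01 k.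
have pr1 : \prod_(k < n.+1) expmx ((grid_passage_level X x v k.+1 w -
    grid_passage_level X x v k w) *: T) (ii k) (ii k.+1) <= 1.
  by apply: prodr_ile1 => k _; exact: e01.
have w0 : 0 <= alpha 0 (ii 0%N) * \prod_(k < n.+1) expmx ((grid_passage_level X x v k.+1 w -
    grid_passage_level X x v k w) *: T) (ii k) (ii k.+1) by exact: mulr_ge0.
have w1 : alpha 0 (ii 0%N) * \prod_(k < n.+1) expmx ((grid_passage_level X x v k.+1 w -
    grid_passage_level X x v k w) *: T) (ii k) (ii k.+1) <= 1.
  by rewrite -[leRHS]mulr1 ler_pM.
rewrite /approx_weight; case: grid_indicator; first by rewrite mul1r w0 w1.
by rewrite mul0r lexx ler01.
Qed.

Lemma measurable_approx_weight v : measurable_fun setT (approx_weight v).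
Proof.
apply: measurable_funM; first exact: (measurable_grid_indicator hX n x v).
apply: measurable_funM => //.
rewrite (_ : (fun w => _) = fun w => \prod_(k <- index_enum 'I_n.+1)
  expmx ((grid_passage_level X x v k.+1 w - grid_passage_level X x v k w) *: T) (ii k) (ii k.+1)); last by [].
apply: measurable_prod => k _.
apply: (measurableT_comp (@measurable_expmx _ _ T (ii k) (ii k.+1))).
by apply: measurable_funB; exact: (measurable_grid_passage_level hX x v).
Qed.

(** Grid events and grid weights have equal expectations; both sides of the identity are their
    bounded limits. *)
Lemma passage_event_prob : measurable passage_event /\
  P passage_event = (\int[P]_w (passage_indicator X n x w * (alpha 0 (ii 0%N) * \prod_(k < n.+1)
    expmx (passage_gap X n x k w *: T) (ii k) (ii k.+1)))%:E)%E.
Proof.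
pose A v := [set w | chain_on_grid v (hit_tuple v w) w].
have mA v : measurable (A v) by have [] := chain_on_grid_prob v.
have [|||m1 c1] := @bounded_cvg_integral _ _ _ P (fun v => \1_(A v) : Omega -> R)
  (\1_passage_event) 1.
- by move=> v; exact: measurable_indic.
- by move=> v w; rewrite indicE; case: (_ \in _); rewrite ?ler01 ?lexx.
- move=> w; apply: cvg_near_cst; apply: filterS (passage_event_near w) => v hv.
  rewrite !indicE; congr ((nat_of_bool _)%:R).
  by apply/idP/idP; rewrite !inE => /hv.
have [m2 c2] := @bounded_cvg_integral _ _ _ P approx_weight _ 1 measurable_approx_weight
  approx_weight_itv approx_weight_cvg.
have mE : measurable passage_event by apply/(@measurable_indicP _ _ R).
split => //; rewrite -[X in P X]setIT -integral_indic//.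
have E v : (\int[P]_w (\1_(A v) w)%:E = \int[P]_w (approx_weight v w)%:E)%E.
  by rewrite integral_indic// setIT; have [] := chain_on_grid_prob v.
move: c1; under eq_fun do rewrite E.
by move=> c1; exact: (cvg_unique (@ereal_hausdorff R) c1 c2).
Qed.

End JointLaw.

(** * From scalar rates to the matrix T in the joint transform *)

Section PassageTransfer.
Context {R : realType} {d : measure_display} {Omega : measurableType d}.
Variables (P : probability Omega R) (X : R -> Omega -> R) (psi Phi : R -> R).
Variables (qbar dbar : R) (nu : {measure set (measurableTypeR R) -> \bar R}).
Variables (p : nat) (T : 'M[R]_p.+1).
Hypotheses (hX : levy_process P X) (hXj : no_positive_jumps X).
Hypotheses (hpsi : laplace_exponent P X psi) (hPhi : unique_positive_root psi Phi).
Hypothesis hnu : bernstein_triplet qbar dbar nu.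
Hypothesis hrep : forall q : R, 0 < q -> Phi q = bernstein qbar dbar nu q.
Hypothesis hT : sub_intensity T.
Variables (n : nat) (x : nat -> R) (ii : nat -> 'I_p.+1).
Hypotheses (xS : forall k, x k <= x k.+1) (x0 : 0 <= x 0%N).

Let G := - bernstein_mx qbar dbar nu (- T).
Let gap_ge0 m w : (m <= n)%N -> 0 <= passage_gap X n x m w.
Proof. by move=> mn; exact: passage_gap_ge0. Qed.

Let level_gap_ge0 m : 0 <= level_gap x m.
Proof. by case: m => [|m] //=; rewrite subr_ge0. Qed.

Definition passage_factor (r : nat -> R) j m w : R :=
  if (m < j)%N then expmx (passage_gap X n x m w *: T) (ii m) (ii m.+1)
  else expR (- (r m * passage_gap X n x m w)).

Definition level_factor (r : nat -> R) j m : R :=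
  if (m < j)%N then expmx (level_gap x m *: G) (ii m) (ii m.+1)
  else expR (- (level_gap x m * Phi (r m))).

Let passage_factor_itv r j m w : (forall k, 0 < r k) -> (m <= n)%N ->
  0 <= passage_factor r j m w <= 1.
Proof.
move=> r0 mn; rewrite /passage_factor; case: ifP => _.
  have hs := expmx_substochastic hT (gap_ge0 w mn).
  by rewrite substochastic_le1// andbT; case: hs.
by rewrite expR_ge0 -expR0 ler_expR oppr_le0 mulr_ge0 ?gap_ge0// ltW.
Qed.

Let measurable_passage_factor r j m : (m <= n)%N ->
  measurable_fun setT (passage_factor r j m).
Proof.
move=> mn; have mg := measurable_passage_gap hX xS mn.
rewrite /passage_factor; case: (m < j)%N.
  exact: (measurableT_comp (@measurable_expmx _ _ T (ii m) (ii m.+1)) mg).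
apply: (measurableT_comp (@measurable_expR R)); apply: measurableT_comp => //.
exact: measurable_funM.
Qed.

Lemma passage_product_itv r j (Q : pred 'I_n.+1) w : (forall k, 0 < r k) ->
  0 <= passage_indicator X n x w * \prod_(m < n.+1 | Q m) passage_factor r j m w <= 1.
Proof.
move=> r0; have f01 (m : 'I_n.+1) : 0 <= passage_factor r j m w <= 1.
  by apply: passage_factor_itv => //; rewrite -ltnS.
have p0 : 0 <= \prod_(m < n.+1 | Q m) passage_factor r j m w.
  by apply: prodr_ge0 => m _; have /andP[] := f01 m.
rewrite /passage_indicator; case: (_ < _)%E; last by rewrite mul0r lexx ler01.
by rewrite mul1r p0; apply: prodr_ile1 => m _; exact: f01.
Qed.

Lemma measurable_passage_product r j (Q : pred 'I_n.+1) : measurable_fun setT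
  (fun w => passage_indicator X n x w * \prod_(m < n.+1 | Q m) passage_factor r j m w).
Proof.
apply: measurable_funM; first exact: (measurable_passage_indicator hX n xS).
rewrite (_ : (fun w => _) = fun w => \prod_(m <- [seq m <- index_enum 'I_n.+1 | Q m])
  passage_factor r j m w); last by apply/funext => w; rewrite big_filter.
by apply: measurable_prod => m _; apply: measurable_passage_factor; rewrite -ltnS.
Qed.

(* The Laplace factors exp(-r gap) are replaced by the matrix factors
   exp(T gap) one coordinate at a time. *)
Lemma passage_transfer j : (j <= n.+1)%N -> forall r : nat -> R, (forall k, 0 < r k) ->
  (\int[P]_w (passage_indicator X n x w * \prod_(m < n.+1) passage_factor r j m w)%:E =
   (\prod_(m < n.+1) level_factor r j m)%:E)%E.
Proof.
elim: j => [_ r r0|j IH jn r r0].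
  have := @passage_laplace _ _ _ P X psi hX hXj hpsi n x xS x0 (Phi \o r).
  have h k : 0 <= Phi (r k) by have [/ltW] := hPhi (r0 k).
  have h' k : psi (Phi (r k)) = r k by have [] := hPhi (r0 k).
  move=> /(_ h) <-; last by move=> k /=; rewrite h'.
  apply: eq_integral => w _; congr (_ * _)%:E; apply: eq_bigr => m _.
  by rewrite /passage_factor /= h'.
pose o : 'I_n.+1 := Ordinal jn.
pose W w := passage_indicator X n x w * \prod_(m < n.+1 | m != o) passage_factor r j m w.
pose c := \prod_(m < n.+1 | m != o) level_factor r j m.
have no (m : 'I_n.+1) : m != o -> (m < j.+1)%N = (m < j)%N.
  by move=> mo; rewrite ltnS leq_eqVlt (negbTE (mo : (m : nat) != j)).
transitivity (\int[P]_w (W w * expmx (passage_gap X n x j w *: T) (ii j) (ii j.+1))%:E)%E.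
  apply: eq_integral => w _; congr EFin; rewrite (bigD1 o)//= /W mulrCA [RHS]mulrC.
  congr (_ * (_ * _)); first by rewrite /passage_factor/= ltnSn.
  by apply: eq_bigr => m mo; rewrite /passage_factor no.
have mW : measurable_fun setT W by exact: measurable_passage_product.
have Wb w : 0 <= W w <= 1 by exact: passage_product_itv.
have jn' : (j <= n)%N by [].
rewrite (@laplace_transfer _ _ _ P Phi qbar dbar nu p T W (passage_gap X n x j) c
  (level_gap x j) 1 (ii j) (ii j.+1) hnu hrep hT mW) //.
- rewrite [in RHS](bigD1 o)//= mulrC; congr (_ * _)%:E.
    by rewrite /level_factor/= ltnSn.
  by apply: eq_bigr => m mo; rewrite /level_factor no.
- exact: (measurable_passage_gap hX xS jn').
- by move=> w; exact: gap_ge0.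
(* The rate of gap j is made a free variable q while the other factors stay the same; this is why
   the induction hypothesis ranges over all rates. *)
- move=> q q0; pose r' k := if k == j then q else r k.
  have r'0 k : 0 < r' k by rewrite /r'; case: ifP.
  have E1 m w : m != j -> passage_factor r' j m w = passage_factor r j m w.
    by move=> mj; rewrite /passage_factor /r' (negbTE mj).
  have E2 m : m != j -> level_factor r' j m = level_factor r j m.
    by move=> mj; rewrite /level_factor /r' (negbTE mj).
  have := IH (ltnW jn) r' r'0; rewrite (bigD1 o)//=.
  rewrite {1}/level_factor ltnn /r' eqxx -/r' mulrC => h.
  transitivity (\int[P]_w (passage_indicator X n x w *
    \prod_(m < n.+1) passage_factor r' j m w)%:E)%E.
    apply: eq_integral => w _; congr EFin; rewrite (bigD1 o)//= /W -mulrA; congr (_ * _).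
    rewrite mulrC {2}/passage_factor ltnn /r' eqxx -/r'; congr (_ * _).
    by apply: eq_bigr => m mo; rewrite E1.
  rewrite h; congr (_ * _)%:E; apply: eq_bigr => m mo; exact: E2.
Qed.

End PassageTransfer.

(** * The chain at passage times and its generator *)

Section PassageChain.
Context {R : realType} {d : measure_display} {Omega : measurableType d}.
Variables (P : probability Omega R) (X : R -> Omega -> R) (psi Phi : R -> R).
Variables (qbar dbar : R) (nu : {measure set (measurableTypeR R) -> \bar R}).
Variables (p : nat) (alpha : 'rV[R]_p.+1) (T : 'M[R]_p.+1).
Variable J : R -> Omega -> option 'I_p.+1.
Hypotheses (hX : levy_process P X) (hXj : no_positive_jumps X).
Hypotheses (hpsi : laplace_exponent P X psi) (hPhi : unique_positive_root psi Phi).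
Hypothesis hnu : bernstein_triplet qbar dbar nu.
Hypothesis hrep : forall q : R, 0 < q -> Phi q = bernstein qbar dbar nu q.
Hypothesis hJ : markov_chain P alpha T J.
Hypothesis hXJ : independent_processes P X J.

Let G := - bernstein_mx qbar dbar nu (- T).
Let hT : sub_intensity T. Proof. by case: hJ => [[]]. Qed.

Lemma passage_event_law n (x : nat -> R) (ii : nat -> 'I_p.+1) :
  (forall k, x k <= x k.+1) -> 0 <= x 0%N ->
  measurable (passage_event X J n x ii) /\
  P (passage_event X J n x ii) = (alpha 0 (ii 0%N) *
    \prod_(k < n.+1) expmx (level_gap x k *: G) (ii k) (ii k.+1))%:E.
Proof.
move=> xS x0; have [m ->] := passage_event_prob hX hJ hXJ n ii xS; split => //.
have [[[a0 _] _] _ _ _ _] := hJ.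
(* At j = n + 1 no Laplace factor is left, so any positive rates will do, here 1. *)
have := passage_transfer hX hXj hpsi hPhi hnu hrep hT ii xS x0 (leqnn n.+1) (fun=> ltr01).
have -> : \prod_(m0 < n.+1) level_factor Phi qbar dbar nu T x ii (fun=> 1) n.+1 m0 =
   \prod_(k < n.+1) expmx (level_gap x k *: G) (ii k) (ii k.+1).
  by apply: eq_bigr => k _; rewrite /level_factor ltn_ord.
rewrite EFinM => <-; rewrite -ge0_integralZl//.
- apply: eq_integral => w _; rewrite -EFinM mulrCA; congr (_ * (_ * _))%:E.
  by apply: eq_bigr => k _; rewrite /passage_factor ltn_ord.
- apply/measurable_EFinP.
  exact: (@measurable_passage_product _ _ _ _ _ p T hX n x ii xS (fun=> 1) n.+1 xpredT).
- move=> w _; rewrite lee_fin.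
  have h : forall k : nat, 0 < (fun=> 1) k :> R by move=> ?; exact: ltr01.
  by have /andP[] := @passage_product_itv _ _ _ X _ _ hT n x ii xS _ n.+1 xpredT w h.
- by rewrite lee_fin a0.
Qed.

Lemma chain_at_passage_markov : markov_chain P alpha G (chain_at_passage X J).
Proof.
have [[ha _] mJ abs rc fdd] := hJ.
have J0 t w i : 0 <= t -> chain_at_passage X J t w = Some i -> exists i0, J 0 w = Some i0.
  move=> t0; case E : (J 0 w) => [i0|]; first by exists i0.
  rewrite chain_at_passageE//; case: ifP => // _.
  by rewrite (abs w 0)// fine_ge0// passage_time_ge0.
split.
- split=> //; exact: bernstein_sub_intensity hnu hT.
- move=> t i t0.
  (* [passage_event] prescribes the state of J at time 0, so one takes the union over it; J must be
     alive at 0 to be alive later. *)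
  rewrite (_ : [set w | _] = \bigcup_(i0 in [set: 'I_p.+1])
     passage_event X J 0 (fun=> t) (fun k => if k is k'.+1 then i else i0)).
    apply: fin_bigcup_measurable => // i0 _.
    by have [] := @passage_event_law 0%N (fun=> t) (fun k => if k is k'.+1 then i else i0).
  apply/seteqP; split=> w /= => [h|[i0 _ [_ /(_ 0%N isT)]]//].
  by have [i0 h0] := J0 _ _ _ t0 h; exists i0.
- by move=> w s t _ st; exact: (chain_at_passage_absorbing abs rc).
- by move=> w t _; exact: (chain_at_passage_right X abs rc).
- move=> n t i t00 tS.
  have t0 : 0 <= t 0%N by rewrite t00.
  pose ii i0 k := if k is k'.+1 then i k' else i0 : 'I_p.+1.
  pose E i0 := passage_event X J n t (ii i0).
  have E0 : \bigcap_(k in `I_n.+1) [set w | chain_at_passage X J (t k) w = Some (i k)] =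
      \big[setU/set0]_(i0 < p.+1) E i0.
    rewrite -bigcup_seq; apply/seteqP; split=> w /= => [h|[i0 _ [_ h]] k kn]; last exact: h.
    have [i0 h0] := J0 _ _ _ t0 (h 0%N isT).
    by exists i0 => /=; [exact: mem_index_enum|split=> // m mn; exact: h].
  have law i0 := passage_event_law n (ii i0) tS t0.
  rewrite E0 measure_bigsetU_ord.
  + rewrite (eq_bigr (fun i0 => (alpha 0 i0 * \prod_(k < n.+1)
      expmx (level_gap t k *: G) (ii i0 k) (ii i0 k.+1))%:E)); last first.
      by move=> i0 _; have [_ e] := law i0; exact: e.
    (* As t 0 = 0, the first gap is empty and its factor is the identity matrix: only the initial
       state [i 0] contributes. *)
    rewrite sumEFin (bigD1 (i 0%N))//= [X in _ + X]big1 => [|i0 ni].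
      by rewrite addr0 big_ord_recl/= t00 scale0r expmx0 mxE eqxx mul1r.
    by rewrite big_ord_recl/= t00 scale0r expmx0 mxE (negbTE ni) mul0r mulr0.
  + by move=> i0; have [] := law i0.
  + apply/trivIsetP => a b _ _ ab; apply/seteqP; split=> // w [[ha1 _] [hb1 _]].
    by case/eqP: ab; move: ha1; rewrite hb1 => -[].
Qed.

Lemma chain_at_passage_cond_prob (i j : 'I_p.+1) (x : R) : 0 <= x -> alpha 0 i != 0 ->
  cond_prob P
    [set w | (first_passage X x w < life_time J w)%E /\
             J (fine (first_passage X x w)) w = Some j]
    [set w | J 0 w = Some i]
  = expmx (x *: G) i j.
Proof.
move=> x0 ai; have [_ _ _ _ fdd] := hJ.
pose ii k := if k is 0%N then i else j.
have [_ PA] := passage_event_law 0%N ii (fun=> lexx x) x0.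
rewrite /cond_prob (_ : _ `&` _ = passage_event X J 0 (fun=> x) ii).
  have := fdd 0%N (fun=> 0) (fun=> i) erefl (fun=> lexx _).
  rewrite (_ : \bigcap_(_ in _) _ = [set w | J 0 w = Some i]); last first.
    by apply/seteqP; split=> w /= => [/(_ 0%N isT)|h k _].
  rewrite big_ord0 mulr1 => ->.
  by rewrite PA/= big_ord_recl big_ord0 mulr1/= mulrAC divff// mul1r.
rewrite /passage_event; apply/seteqP; split=> w /=.
  by move=> [[h1 h2] h3]; split=> // -[|m]// _; rewrite /chain_at_passage h1.
move=> [h3 /(_ 0%N isT)]; rewrite /chain_at_passage; case: ifP => //.
Qed.

End PassageChain.

Theorem corollary4 (R : realType) (d : measure_display)
    (Omega : measurableType d) (P : probability Omega R)
    (X : R -> Omega -> R) (psi Phi : R -> R)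
    (qbar dbar : R) (nu : {measure set (measurableTypeR R) -> \bar R})
    (p : nat) (alpha : 'rV[R]_p) (T : 'M[R]_p)
    (J : R -> Omega -> option 'I_p)
    (hX : spectrally_negative P X)
    (hpsi : laplace_exponent P X psi)
    (hPhi : unique_positive_root psi Phi)
    (hnu : bernstein_triplet qbar dbar nu)
    (hrep : forall q : R, 0 < q -> Phi q = bernstein qbar dbar nu q)
    (hT : transient T)
    (hJ : markov_chain P alpha T J)
    (hXJ : independent_processes P X J) :
  let G := - bernstein_mx qbar dbar nu (- T) in
  markov_chain P alpha G (chain_at_passage X J) /\
  (forall (i j : 'I_p) (x : R), 0 <= x -> alpha 0 i != 0 ->
     cond_prob P
       [set w | (first_passage X x w < life_time J w)%E /\
                J (fine (first_passage X x w)) w = Some j]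
       [set w | J 0 w = Some i]
     = expmx (x *: G) i j).
Proof.
have [hlevy hjump _] := hX.
(* For p = 0 the weights of [alpha] would have an empty sum equal to 1. *)
case: p alpha T J hT hJ hXJ => [|p] alpha T J _ hJ hXJ.
  have [[[_ a1] _] _ _ _ _] := hJ.
  by move: a1 => /eqP; rewrite big_ord0 eq_sym oner_eq0.
split; first exact: chain_at_passage_markov hlevy hjump hpsi hPhi hnu hrep hJ hXJ.
move=> i j x; exact: chain_at_passage_cond_prob hlevy hjump hpsi hPhi hnu hrep hJ hXJ i j x.
Qed.
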